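(* Let $K$ be an algebraically closed field and $D\ge1$. For each constructible set $\mathcal{C}\subset\mathcal{C}_{3,D}$ and each pair of integers $t,r\geq1$ with $r<\operatorname{char}K$, there are an integer $J=J(t,\mathcal{C},r)$, a subset $B_{F(t,\mathcal{C},r)}\subset\{0,1\}^J$, and a constant $C(t,\mathcal{C},r)$ so that the following holds. For each $1\leq j\leq J$ and for each nonconstant $T\in K[x_1,x_2,x_3]$, there are polynomials $\operatorname{Flec}_jT=\operatorname{Flec}_{t,\mathcal{C},r,j}T\in K[x_1,x_2,x_3]$ so that (1) $\deg\operatorname{Flec}_jT\leq C(t,\mathcal{C},r)\deg T$ for each $j$; (2) a point $x\in K^3$ is $(t,\mathcal{C},r)$-flecnodal for $T$ if and only if the vector $\big(v(\operatorname{Flec}_1T(x)),\dots,v(\operatorname{Flec}_JT(x))\big)$ belongs to $B_{F(t,\mathcal{C},r)}\subset\{0,1\}^J$.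
   Context: Here $v(y)=0$ if $y=0$ and $v(y)=1$ if $y\neq0$. Standing conventions: $\operatorname{char}K=0$ or $\operatorname{char}K>D$; if $\operatorname{char}K=0$ the condition $r<\operatorname{char}K$ is regarded as automatically satisfied. Constructible sets: a set $Y\subset K^N$ is constructible if it is a finite Boolean combination of algebraic sets. The parameter space $\mathcal{C}_{3,D}$ of curves of degree at most $D$: for $1\le j\le D$, each irreducible curve of degree $j$ in projective space $K\mathbf{P}^3$ has a Chow point in a projective space $K\mathbf{P}^{N_j}$ (the coefficient vector, up to scaling, of its Cayley–Chow form, i.e. of the irreducible form in $(u,v)\in K^4\times K^4$ vanishing iff the curve meets $\{u\cdot x=v\cdot x=0\}$). Fix a generic hyperplane $H_j\subset K\mathbf{P}^{N_j}$, identify $K\mathbf{P}^{N_j}\setminus H_j$ with $K^{N_j}$, and let $\tilde{\mathcal{C}}_{3,j}\subset K^{N_j}$ be the set of Chow points outside $H_j$ of irreducible degree $j$ curves not contained in the plane $\{x_0=0\}$; each such curve is identified with its affine part in $K^3=\{x_0=1\}$. Let $\varphi_j$ be the embedding of $K^{N_j}$ as the $j$-th factor of $K^{N}=K^{N_1}\times\dots\times K^{N_D}$ (other coordinates $0$) and put $\mathcal{C}_{3,D}=\bigcup_{j=1}^D\varphi_j(\tilde{\mathcal{C}}_{3,j})\subset K^N$. Points of $\mathcal{C}_{3,D}$ correspond one-to-one to irreducible curves $\gamma\subset K^3$ of degree $j\le D$ with Chow point not in $H_j$; $\mathcal{C}_{3,D}$ and the incidence set $\{(z_\gamma,x): x\in\gamma\}\subset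 K^N\times K^3$ ($z_\gamma$ the point corresponding to $\gamma$) are constructible. We identify $\gamma$ with $z_\gamma$ and write $\gamma\in\mathcal{C}$. Tangency: a point $z\in\gamma$ is a regular point of a curve $\gamma$ if there are $f_1,f_2\in I(\gamma)$ with $\nabla f_1(z),\nabla f_2(z)$ linearly independent. Let $\mathcal{O}_{K^3,z}$ be the local ring of rational functions $p/q$ with $q(z)\ne0$; for an ideal $I\subset K[x_1,x_2,x_3]$ let $I_z$ be the ideal of $\mathcal{O}_{K^3,z}$ generated by $I$. Let $I_{z,\ge s}$ be the ideal of polynomials vanishing at $z$ to order $\ge s$. For an irreducible curve $\gamma$, a regular point $z\in\gamma$, and $r<\operatorname{char}(K)$, $\gamma$ is tangent to $Z(T)$ at $z$ to order $\ge r$ if $T/1\in I(\gamma)_z+(I_{z,\ge r+1})_z$ (this depends on the polynomial $T$). Flecnodal points: a point $x\in K^3$ is $(t,\mathcal{C},r)$-flecnodal for $T$ if there are at least $t$ distinct curves $\gamma_1,\dots,\gamma_t\in\mathcal{C}$ passing through $x$, such that $x$ is a regular point of each of these curves and each of them is tangent to $Z(T)$ at $x$ to order $\geq r$. *)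

(* Defs.v *)
From mathcomp Require Export all_boot all_order all_algebra.
From mathcomp Require Export mpoly.

Set Implicit Arguments.
Unset Strict Implicit.
Unset Printing Implicit Defensive.

Import GRing.Theory.
Local Open Scope ring_scope.

(* Points of affine n-space are row vectors 'rV[K]_n; points of projective
   3-space are nonzero vectors of 'rV[K]_4 up to nonzero scalars. A row vector
   x is passed to polynomial evaluation as the function x 0. *)

Definition subset_of (V : Type) (X Y : V -> Prop) : Prop :=
  forall x, X x -> Y x.

Definition same_set (V : Type) (X Y : V -> Prop) : Prop :=
  forall x, X x <-> Y x.

Section Constructible.
Variables (K : fieldType) (n : nat).

Definition zero_locus (S : seq {mpoly K[n]}) (x : 'rV[K]_n) : Prop :=
  forall p, p \in S -> p.@[x 0] = 0.

Inductive constructible : ('rV[K]_n -> Prop) -> Prop :=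
| constructible_algebraic S : constructible (zero_locus S)
| constructible_compl Y : constructible Y -> constructible (fun x => ~ Y x)
| constructible_union Y Z : constructible Y -> constructible Z ->
    constructible (fun x => Y x \/ Z x)
| constructible_ext Y Z : same_set Y Z -> constructible Y -> constructible Z.

(* The total degree; the zero polynomial gets degree 0. *)
Definition mp_degree (p : {mpoly K[n]}) : nat := (msize p).-1.

End Constructible.

Section ProjectiveCurves.
Variable K : fieldType.
Implicit Types X Y Z : 'rV[K]_4 -> Prop.

Definition proj_closed X : Prop :=
  exists2 S : seq {mpoly K[4]},
    (forall p, p \in S -> exists d, p \is d.-homog)
    & same_set X (fun x => x != 0 /\ zero_locus S x).

Definition proj_irreducible X : Prop :=
  [/\ proj_closed X,
      exists x, X x
    & forall Y Z, proj_closed Y -> proj_closed Z ->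
        subset_of X (fun x => Y x \/ Z x) -> subset_of X Y \/ subset_of X Z].

(* There is a chain Z 0 < Z 1 < ... < Z n of irreducible closed subsets of X. *)
Definition irreducible_chain X (n : nat) : Prop :=
  exists Z : nat -> 'rV[K]_4 -> Prop,
    (forall i, (i <= n)%N -> proj_irreducible (Z i) /\ subset_of (Z i) X) /\
    (forall i, (i < n)%N ->
       subset_of (Z i) (Z i.+1) /\ ~ subset_of (Z i.+1) (Z i)).

Definition proj_dim X (n : nat) : Prop :=
  irreducible_chain X n /\ ~ irreducible_chain X n.+1.

Definition proj_irreducible_curve X : Prop :=
  proj_irreducible X /\ proj_dim X 1.

Definition dot (u x : 'rV[K]_4) : K := \sum_i u 0 i * x 0 i.

Definition proportional (x y : 'rV[K]_4) : Prop :=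
  exists2 c : K, c != 0 & x = c *: y.

Definition proj_card X (d : nat) : Prop :=
  exists p : 'I_d -> 'rV[K]_4,
    [/\ forall i, X (p i),
        forall i k, proportional (p i) (p k) -> i = k
      & forall x, X x -> exists i, proportional x (p i)].

(* The degree of a curve: the number of points of a generic plane section. *)
Definition proj_curve_degree X (d : nat) : Prop :=
  exists2 g : {mpoly K[4]}, g != 0 &
    forall u : 'rV[K]_4, g.@[u 0] != 0 ->
      proj_card (fun x => X x /\ dot u x = 0) d.

End ProjectiveCurves.

Definition irreducible_elt (R : idomainType) (x : R) : Prop :=
  [/\ x != 0, x \isn't a GRing.unit
    & forall a b, x = a * b -> a \is a GRing.unit \/ b \is a GRing.unit].

(* Monomials of bidegree (j, j) in (u, v), where u and v are the first and the
   last four of the eight variables. *)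
Definition chow_monoms (j : nat) : seq 'X_{1.. 4 + 4} :=
  [seq bmnm m | m <- enum {: 'X_{1.. (4 + 4) < j.*2.+1}}
     & ((\sum_(i < 4) bmnm m (lshift 4 i))%N == j)
       && ((\sum_(i < 4) bmnm m (rshift 4 i))%N == j)].

(* The dimension N_j of the projective space of nonzero forms of bidegree
   (j, j) up to scaling. *)
Definition chow_dim (j : nat) : nat := (size (chow_monoms j)).-1.

Lemma chow_monoms_uniq j : uniq (chow_monoms j).
Proof.
by rewrite map_inj_uniq; [apply/filter_uniq/enum_uniq | apply: val_inj].
Qed.

Lemma mem_chow_monoms j m : (m \in chow_monoms j) =
  ((\sum_(i < 4) m (lshift 4 i))%N == j)
  && ((\sum_(i < 4) m (rshift 4 i))%N == j).
Proof.
apply/mapP/idP => [[b]|mj]; first by rewrite mem_filter => /andP[? _] ->.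
have mb : (mdeg m < j.*2.+1)%N.
  have [/eqP m1 /eqP m2] := andP mj.
  by rewrite mdegE big_split_ord /= m1 m2 addnn.
by exists (BMultinom mb) => //; rewrite mem_filter mj mem_enum.
Qed.

Lemma size_chow_monoms j : size (chow_monoms j) = (chow_dim j).+1.
Proof.
rewrite /chow_dim prednK // -has_predT; apply/hasP.
pose m := [multinom (if (i == lshift 4 ord0) || (i == rshift 4 ord0) then j
                     else 0)%N | i < 4 + 4].
exists m => //; rewrite mem_chow_monoms.
by rewrite !big_ord_recl !big_ord0 !mnmE /= !addn0 eqxx.
Qed.

Section ChowSpace.
Variable K : fieldType.

(* The form of bidegree (j, j) whose coefficient vector is w. *)
Definition chow_form (j : nat) (w : 'rV[K]_(chow_dim j).+1) :
    {mpoly K[4 + 4]} :=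
  \sum_(i < (chow_dim j).+1) w 0 i *: 'X_[nth 0%MM (chow_monoms j) i].

Definition is_chow_vector (X : 'rV[K]_4 -> Prop) (j : nat)
    (w : 'rV[K]_(chow_dim j).+1) : Prop :=
  irreducible_elt (chow_form w) /\
  forall u v : 'rV[K]_4,
    (chow_form w).@[row_mx u v 0] = 0
    <-> exists x, [/\ X x, dot u x = 0 & dot v x = 0].

(* A hyperplane H of the projective space of 'rV[K]_(N.+1) and an
   identification of its complement with 'rV[K]_N are encoded by an invertible
   matrix L: H is the zero set of the first coordinate of w *m L, and the
   affine coordinates of w off H are the ratios of the other coordinates of
   w *m L to the first one. *)
Definition off_hyperplane (N : nat) (L : 'M[K]_N.+1) (w : 'rV[K]_N.+1) : bool :=
  (w *m L) 0 0 != 0.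

Definition affine_coord (N : nat) (L : 'M[K]_N.+1) (w : 'rV[K]_N.+1) :
    'rV[K]_N :=
  \row_i ((w *m L) 0 (lift ord0 i) / (w *m L) 0 0).

Variable D : nat.

(* Since 'I_D starts at 0, the index j stands for the degree j.+1. *)
Definition chow_ambient_dim : nat := (\sum_(j < D) chow_dim j.+1)%N.

(* The embedding of the j-th factor; conform_mx is the identity on the block of
   index j, where the dimensions agree. *)
Definition embed_factor (j : 'I_D) (z : 'rV[K]_(chow_dim j.+1)) :
    'rV[K]_chow_ambient_dim :=
  \mxrow_(i < D)
    (if i == j then conform_mx (0 : 'rV[K]_(chow_dim i.+1)) z else 0).

Lemma submxrow_embed_factor (j : 'I_D) (z : 'rV[K]_(chow_dim j.+1)) :
  submxrow (embed_factor z) j = z.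
Proof. by rewrite mxrowK eqxx conform_mx_id. Qed.

Lemma submxrow_embed_factor_neq (i j : 'I_D) (z : 'rV[K]_(chow_dim j.+1)) :
  i != j -> submxrow (embed_factor z) i = 0.
Proof. by move=> /negPf ij; rewrite mxrowK ij. Qed.

Variable L : forall j : 'I_D, 'M[K]_((chow_dim j.+1).+1).

(* X is an irreducible projective curve of degree at most D, not contained in
   the plane x_0 = 0, and Z is its point in the parameter space. *)
Definition parameter_of (X : 'rV[K]_4 -> Prop) (Z : 'rV[K]_chow_ambient_dim) :
    Prop :=
  [/\ proj_irreducible_curve X,
      exists2 x, X x & x 0 0 != 0
    & exists (j : 'I_D) (w : 'rV[K]_(chow_dim j.+1).+1),
        [/\ proj_curve_degree X j.+1, is_chow_vector X w,
            off_hyperplane (L j) w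
          & Z = embed_factor (affine_coord (L j) w)]].

Definition curve_space (Z : 'rV[K]_chow_ambient_dim) : Prop :=
  exists X, parameter_of X Z.

Definition affine_part (X : 'rV[K]_4 -> Prop) (x : 'rV[K]_3) : Prop :=
  X (row_mx (1%:M : 'M[K]_1) x).

(* The affine curve gamma belongs to the set of curves C. *)
Definition curve_in (C : 'rV[K]_chow_ambient_dim -> Prop)
    (gamma : 'rV[K]_3 -> Prop) : Prop :=
  exists X Z, [/\ parameter_of X Z, C Z & same_set gamma (affine_part X)].

End ChowSpace.

Section Tangency.
Variable K : fieldType.
Implicit Types (gamma : 'rV[K]_3 -> Prop) (z : 'rV[K]_3).
Implicit Types (I : {mpoly K[3]} -> Prop) (T p q : {mpoly K[3]}).

Definition vanishing_ideal gamma p : Prop :=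
  forall x, gamma x -> p.@[x 0] = 0.

Definition gradient p z : 'rV[K]_3 := \row_i (p^`M(i)).@[z 0].

Definition regular_point gamma z : Prop :=
  gamma z /\
  exists f1 f2, [/\ vanishing_ideal gamma f1, vanishing_ideal gamma f2
                  & row_free (col_mx (gradient f1 z) (gradient f2 z))].

(* The local ring of K^3 at z and its ideals are subsets of K(x1, x2, x3). *)
Definition local_ring z (f : {fraction {mpoly K[3]}}) : Prop :=
  exists p q, q.@[z 0] != 0 /\ f = tofrac p / tofrac q.

Definition local_ideal I z (f : {fraction {mpoly K[3]}}) : Prop :=
  exists n (a : 'I_n -> {fraction {mpoly K[3]}}) (g : 'I_n -> {mpoly K[3]}),
    [/\ forall i, local_ring z (a i), forall i, I (g i)
      & f = \sum_i a i * tofrac (g i)].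

(* p vanishes at z to order at least s: its expansion at z has no term of
   degree less than s. *)
Definition order_ideal z (s : nat) p : Prop :=
  forall m : 'X_{1.. 3}, (mdeg m < s)%N ->
    (p \mPo [tuple 'X_i + (z 0 i)%:MP | i < 3])@_m = 0.

Definition tangent_to_order (r : nat) gamma T z : Prop :=
  exists f1 f2, [/\ local_ideal (vanishing_ideal gamma) z f1,
                    local_ideal (order_ideal z r.+1) z f2
                  & tofrac T = f1 + f2].

Definition flecnodal (D : nat) (L : forall j : 'I_D, 'M[K]_((chow_dim j.+1).+1))
    (t : nat) (C : 'rV[K]_(chow_ambient_dim D) -> Prop) (r : nat) T
    (x : 'rV[K]_3) : Prop :=
  exists gamma : 'I_t -> 'rV[K]_3 -> Prop,
    (forall i k, i != k -> ~ same_set (gamma i) (gamma k)) /\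
    (forall i, [/\ curve_in L C (gamma i), regular_point (gamma i) x
                 & tangent_to_order r (gamma i) T x]).

End Tangency.

(* Main.v *)
From HB Require Import structures.
Require Import Defs.
From mathcomp Require Import closed_field ring.
From mathcomp Require Import boolp classical_sets functions.

(* Whether a curve passes through x, is regular there and is tangent to Z(T) at
   x to order r is a first-order property of its Chow vector w, of x and of the
   r-jet of T at x.  By quantifier elimination, being flecnodal is then decided
   by the vanishing pattern at (x, jet of T) of finitely many polynomials that
   do not depend on T.  The jet of T at x is polynomial in x of degree at most
   deg T, so substituting it multiplies degrees by at most deg T.

   The first-order description uses the surfaces f_(a,b)(y) = 0, where f_(a,b)(y)
   is the value of the Chow form at the two planes through y with normals a and
   b.  They all contain the curve, and exactly the points of the curve are
   common to all of them.  At a regular point two of the f_(a,b) have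
   independent gradients, since a generic plane section through the point is
   transversal and its number of points equals the degree of the Chow form in
   each variable; two elements of the ideal of the curve with independent
   gradients at a point generate it locally. *)

Set Implicit Arguments.
Unset Strict Implicit.
Unset Printing Implicit Defensive.

Import GRing.Theory.
Local Open Scope ring_scope.

(** * Constructible sets and definability *)

(** The degree of a curve constrains only generic planes, whereas membership and regularity concern
    the planes through one prescribed point. The bridge is a limit: the special plane is joined to a
    generic one by a pencil, infinitely many members of which have the expected number of section
    points; suitably normalized, these points are integral over the parameter of the pencil and
    therefore specialize at the special plane. Polynomial identities survive, in particular the
    splitting of the Chow form into factors [dot v p]. A collision of two points leaves a trace in
    the gradients, through divided differences, and this is what transversality excludes. Tangency
    quantifies over rational functions of unbounded degree. It becomes first-order because it is
    tested only modulo order r+1: once the ideal is replaced by two fixed generators, the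
    multipliers matter only through their r-jets, which have a fixed number of coefficients. *)

Section ConstructibleClosure.
Variables (K : fieldType) (n : nat).
Implicit Types P Q : 'rV[K]_n -> Prop.

Lemma constructible_and P Q :
  constructible P -> constructible Q -> constructible (fun x => P x /\ Q x).
Proof.
move=> cP cQ; apply: constructible_ext (constructible_compl
  (constructible_union (constructible_compl cP) (constructible_compl cQ))) => x.
split=> [/not_orP[/contrapT Px /contrapT Qx] //|[Px Qx]].
by case=> [/(_ Px)|/(_ Qx)].
Qed.

Lemma constructible_eq0 (p : {mpoly K[n]}) :
  constructible (fun x => p.@[x 0] = 0).
Proof.
apply: constructible_ext (constructible_algebraic [:: p]) => x.
by split=> [|px q]; [apply; rewrite inE | rewrite inE => /eqP->].
Qed.

Lemma constructible_const (A : Prop) : constructible (fun _ : 'rV[K]_n => A).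
Proof.
have [HA|HA] := pselect A.
  apply: constructible_ext (constructible_eq0 0) => x.
  by split=> // _; rewrite meval0.
apply: constructible_ext (constructible_eq0 1) => x.
by split=> // /eqP; rewrite meval1 oner_eq0.
Qed.

End ConstructibleClosure.

(** * Quantifier elimination and projections of constructible sets *)

Section Chevalley.
Variable K : closedFieldType.

Definition env_of n (x : 'rV[K]_n) : seq K := [seq x 0 i | i <- enum 'I_n].

Lemma nth_env_of n (x : 'rV[K]_n) (i : 'I_n) : (env_of x)`_i = x 0 i.
Proof. by rewrite (nth_map i) ?size_enum_ord ?nth_ord_enum. Qed.

Lemma nth_env_of_default n (x : 'rV[K]_n) i : (n <= i)%N -> (env_of x)`_i = 0.
Proof. by move=> ni; rewrite nth_default // size_map size_enum_ord. Qed.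

Lemma mpoly_term n (p : {mpoly K[n]}) :
  exists t : GRing.term K, forall x, GRing.eval (env_of x) t = p.@[x 0].
Proof.
elim/mpolyind: p => [|c m p _ _ [t IHt]].
  by exists (GRing.Const 0) => x; rewrite meval0.
pose s := foldr
  (fun i s => GRing.Mul (GRing.Exp (GRing.Var K (nat_of_ord i)) (m i)) s)
   (GRing.Const 1) (enum 'I_n).
exists (GRing.Add (GRing.Mul (GRing.Const c) s) t) => x /=.
rewrite IHt mevalD mevalZ mevalX; congr (_ * _ + _).
rewrite -big_enum /s; elim: (enum 'I_n) => [|i r IHr] /=.
  by rewrite big_nil.
by rewrite big_cons -IHr nth_env_of.
Qed.

Lemma term_mpoly n (t : GRing.term K) : GRing.rterm t ->
  exists p : {mpoly K[n]}, forall x, GRing.eval (env_of x) t = p.@[x 0].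
Proof.
elim: t => //=.
- move=> i _; have [lt_in|le_ni] := ltnP i n.
    by exists 'X_(Ordinal lt_in) => x; rewrite mevalXU -nth_env_of.
  by exists 0 => x; rewrite meval0 nth_env_of_default.
- by move=> c _; exists c%:MP => x; rewrite mevalC.
- by move=> k _; exists (k%:R)%:MP => x; rewrite mevalC.
- move=> t1 IH1 t2 IH2 /andP[/IH1[p Hp] /IH2[q Hq]].
  by exists (p + q) => x; rewrite mevalD Hp Hq.
- by move=> t IH /IH[p Hp]; exists (- p) => x; rewrite mevalN Hp.
- by move=> t IH k /IH[p Hp]; exists (p *+ k) => x; rewrite mevalMn Hp.
- move=> t1 IH1 t2 IH2 /andP[/IH1[p Hp] /IH2[q Hq]].
  by exists (p * q) => x; rewrite mevalM Hp Hq.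
- by move=> t IH k /IH[p Hp]; exists (p ^+ k) => x; rewrite rmorphXn /= Hp.
Qed.

Lemma constructible_formula n (P : 'rV[K]_n -> Prop) : constructible P ->
  exists f : GRing.formula K, forall x, P x <-> GRing.holds (env_of x) f.
Proof.
elim=> {P} [S|P _ [f Hf]|P Q _ [f Hf] _ [g Hg]|P Q PQ _ [f Hf]].
- elim: S => [|p S [f IHf]]; first by exists (GRing.Bool true); split.
  have [t Ht] := mpoly_term p.
  exists (GRing.And (GRing.Equal t (GRing.Const 0)) f) => x /=.
  rewrite Ht -IHf; split=> [HS|[p0 HS] q].
    split; first by apply: HS; rewrite inE eqxx.
    by move=> q qS; apply: HS; rewrite inE qS orbT.
  by rewrite inE => /predU1P[->|/HS].
- by exists (GRing.Not f) => x /=; rewrite Hf.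
- by exists (GRing.Or f g) => x /=; rewrite Hf Hg.
- by exists f => x; rewrite -Hf (PQ x).
Qed.

Lemma qf_constructible n (f : GRing.formula K) :
  GRing.qf_form f -> GRing.rformula f ->
  constructible (fun x : 'rV[K]_n => GRing.qf_eval (env_of x) f).
Proof.
elim: f => //=.
- by move=> b _ _; apply: constructible_const.
- move=> t1 t2 _ /andP[/(term_mpoly n)[p Hp] /(term_mpoly n)[q Hq]].
  apply: constructible_ext (constructible_eq0 (p - q)) => x.
  by rewrite Hp Hq mevalB (rwP eqP) subr_eq0.
- move=> f IHf g IHg /andP[qf qg] /andP[rf rg].
  apply: constructible_ext (constructible_and (IHf qf rf) (IHg qg rg)) => x.
  by rewrite (rwP andP).
- move=> f IHf g IHg /andP[qf qg] /andP[rf rg].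
  apply: constructible_ext (constructible_union (IHf qf rf) (IHg qg rg)) => x.
  by rewrite (rwP orP).
- move=> f IHf g IHg /andP[qf qg] /andP[rf rg].
  apply: constructible_ext (constructible_union
    (constructible_compl (IHf qf rf)) (IHg qg rg)) => x.
  by case: GRing.qf_eval => /=; split=> [[]|] //; [right | left].
- move=> f IHf qf rf.
  by apply: constructible_ext (constructible_compl (IHf qf rf)) => x; rewrite (rwP negP).
Qed.

(** Quantifier elimination over an algebraically closed field. Elimination works on formulas without
    inverses, so [f] first passes through [to_rform]. *)
Lemma formula_constructible n (f : GRing.formula K) :
  constructible (fun x : 'rV[K]_n => GRing.holds (env_of x) f).
Proof.
have ok := ClosedFieldQE.holds_ex_elim (@GRing.solve_monicpoly K).
have wf := @ClosedFieldQE.wf_ex_elim K.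
have rf := GRing.to_rform_rformula f.
have /andP[qq rq] := GRing.quantifier_elim_wf wf rf.
apply: constructible_ext (qf_constructible n qq rq) => x.
rewrite -GRing.to_rformP; split.
  by move/(GRing.quantifier_elim_rformP wf ok _ rf).
by move=> h; apply/(GRing.quantifier_elim_rformP wf ok _ rf).
Qed.

Lemma constructible_proj n m (Q : 'rV[K]_(n + m) -> Prop) : constructible Q ->
  constructible (fun x : 'rV[K]_n => exists y : 'rV[K]_m, Q (row_mx x y)).
Proof.
case/constructible_formula => f Hf.
apply: constructible_ext
  (formula_constructible n (foldr GRing.Exists f (iota n m))) => x.
split=> [/GRing.foldExistsP[e He ef]|[y /Hf Qy]]; last first.
  apply/GRing.foldExistsP; exists (env_of (row_mx x y)) => // i.
  rewrite inE /= mem_iota negb_and -ltnNge -leqNgt => /orP[lt_in|le_i].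
    rewrite -[i]/(val (Ordinal lt_in)) nth_env_of.
    by rewrite -[val _]/(val (lshift m (Ordinal lt_in))) nth_env_of row_mxEl.
  by rewrite !nth_env_of_default // (leq_trans _ le_i) ?leq_addr.
exists (\row_i e`_(n + i)); apply/Hf.
(* The environment [e] agrees with that of [x] off the quantified variables [n, ..., n + m - 1];
   beyond [n + m] both therefore read the default 0. *)
apply: GRing.eq_holds ef => i; have [lt_i|le_i] := ltnP i (n + m); last first.
  rewrite nth_env_of_default // -He ?nth_env_of_default //.
    by rewrite (leq_trans _ le_i) ?leq_addr.
  by rewrite inE /= mem_iota negb_and -leqNgt le_i orbT.
rewrite -[i]/(val (Ordinal lt_i)) nth_env_of.
case: (split_ordP (Ordinal lt_i)) => k Ek; rewrite Ek ?row_mxEl ?row_mxEr ?mxE //=.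
rewrite -nth_env_of -He //= inE /= mem_iota negb_and -ltnNge; apply/orP; left.
exact: ltn_ord.
Qed.

End Chevalley.

(** * Polynomial families over a type of environments, and definable predicates *)

Section PolynomialFunctions.
Variables (K : fieldType) (E : Type) (n : nat) (c : E -> 'rV[K]_n).
Implicit Types f g : E -> K.

(** [E] is an abstract type of environments: bound variables stay components of nested pairs, and
    [c] alone records how they are laid out as coordinates. *)
Definition polyf f := exists p : {mpoly K[n]}, forall e, f e = p.@[c e 0].

Definition polyvec m (v : E -> 'rV[K]_m) := forall i, polyf (fun e => v e 0 i).

Definition polymp k (p : E -> {mpoly K[k]}) :=
  forall m, polyf (fun e => (p e)@_m).

Lemma polyf_ext f g : (forall e, f e = g e) -> polyf f -> polyf g.
Proof. by move=> fg [p Hp]; exists p => e; rewrite -fg. Qed.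

Lemma polyf_const a : polyf (fun _ => a).
Proof. by exists a%:MP => e; rewrite mevalC. Qed.

Lemma polyf_coord : polyvec c.
Proof. by move=> i; exists 'X_i => e; rewrite mevalXU. Qed.

Lemma polyfD f g : polyf f -> polyf g -> polyf (fun e => f e + g e).
Proof. by move=> [p Hp] [q Hq]; exists (p + q) => e; rewrite mevalD Hp Hq. Qed.

Lemma polyfN f : polyf f -> polyf (fun e => - f e).
Proof. by move=> [p Hp]; exists (- p) => e; rewrite mevalN Hp. Qed.

Lemma polyfB f g : polyf f -> polyf g -> polyf (fun e => f e - g e).
Proof. by move=> Hf Hg; apply/polyfD/polyfN. Qed.

Lemma polyfM f g : polyf f -> polyf g -> polyf (fun e => f e * g e).
Proof. by move=> [p Hp] [q Hq]; exists (p * q) => e; rewrite mevalM Hp Hq. Qed.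

Lemma polyf_sum I (r : seq I) (P : pred I) (F : I -> E -> K) :
  (forall i, polyf (F i)) -> polyf (fun e => \sum_(i <- r | P i) F i e).
Proof.
move=> HF; elim: r => [|i r IHr].
  by apply: polyf_ext (polyf_const 0) => e; rewrite big_nil.
have [Pi|Pi] := boolP (P i); last first.
  by apply: polyf_ext IHr => e; rewrite big_cons (negPf Pi).
by apply: polyf_ext (polyfD (HF i) IHr) => e; rewrite big_cons Pi.
Qed.

Lemma polyf_prod I (r : seq I) (P : pred I) (F : I -> E -> K) :
  (forall i, polyf (F i)) -> polyf (fun e => \prod_(i <- r | P i) F i e).
Proof.
move=> HF; elim: r => [|i r IHr].
  by apply: polyf_ext (polyf_const 1) => e; rewrite big_nil.
have [Pi|Pi] := boolP (P i); last first.
  by apply: polyf_ext IHr => e; rewrite big_cons (negPf Pi).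
by apply: polyf_ext (polyfM (HF i) IHr) => e; rewrite big_cons Pi.
Qed.

Lemma polyfX f k : polyf f -> polyf (fun e => f e ^+ k).
Proof. by move=> [p Hp]; exists (p ^+ k) => e; rewrite rmorphXn /= Hp. Qed.

Lemma polyf_det m (A : E -> 'M[K]_m) :
  (forall i j, polyf (fun e => A e i j)) -> polyf (fun e => \det (A e)).
Proof.
move=> HA; apply: polyf_sum => s; apply: polyfM; first exact: polyf_const.
by apply: polyf_prod => i.
Qed.

Lemma polyf_meval k (p : {mpoly K[k]}) (v : E -> 'I_k -> K) :
  (forall i, polyf (fun e => v e i)) -> polyf (fun e => p.@[v e]).
Proof.
move=> Hv; apply: (@polyf_ext (fun e =>
  \sum_(m <- msupp p) p@_m * \prod_(i < k) v e i ^+ m i)) => [e|].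
  by rewrite mevalE.
apply: polyf_sum => m; apply: polyfM; first exact: polyf_const.
by apply: polyf_prod => i; apply: polyfX.
Qed.

Lemma polymp_const k (p : {mpoly K[k]}) : polymp (fun _ => p).
Proof. by move=> m; apply: polyf_const. Qed.

Lemma polympC k f : polyf f -> polymp (fun e => (f e)%:MP : {mpoly K[k]}).
Proof.
move=> Hf m; apply: (@polyf_ext (fun e => f e * (m == 0%MM)%:R)) => [e|].
  by rewrite mcoeffC.
by apply: polyfM => //; apply: polyf_const.
Qed.

Lemma polympD k (p q : E -> {mpoly K[k]}) :
  polymp p -> polymp q -> polymp (fun e => p e + q e).
Proof.
move=> Hp Hq m; apply: (@polyf_ext (fun e => (p e)@_m + (q e)@_m)) => [e|].
  by rewrite mcoeffD.
exact: polyfD.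
Qed.

Lemma polympN k (p : E -> {mpoly K[k]}) : polymp p -> polymp (fun e => - p e).
Proof.
move=> Hp m; apply: (@polyf_ext (fun e => - (p e)@_m)) => [e|].
  by rewrite mcoeffN.
exact: polyfN.
Qed.

Lemma polympM k (p q : E -> {mpoly K[k]}) :
  polymp p -> polymp q -> polymp (fun e => p e * q e).
Proof.
move=> Hp Hq m; apply: polyf_ext (fun e => esym (mcoeffM (p e) (q e) m)) _.
by apply: polyf_sum => i; apply: polyfM.
Qed.

Lemma polymp_sum k I (r : seq I) (P : pred I) (F : I -> E -> {mpoly K[k]}) :
  (forall i, polymp (F i)) -> polymp (fun e => \sum_(i <- r | P i) F i e).
Proof.
move=> HF m; apply: (@polyf_ext (fun e => \sum_(i <- r | P i) (F i e)@_m)).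
  by move=> e; rewrite raddf_sum.
by apply: polyf_sum => i; apply: HF.
Qed.

Lemma polympX k (p : E -> {mpoly K[k]}) d :
  polymp p -> polymp (fun e => p e ^+ d).
Proof.
move=> Hp; elim: d => [|d IHd] m.
  by apply: polyf_ext (polyf_const (1 : {mpoly K[k]})@_m) => e; rewrite expr0.
by apply: polyf_ext (polympM Hp IHd m) => e; rewrite exprS.
Qed.

Lemma polymp_prod k I (r : seq I) (F : I -> E -> {mpoly K[k]}) :
  (forall i, polymp (F i)) -> polymp (fun e => \prod_(i <- r) F i e).
Proof.
move=> HF; elim: r => [|i r IHr] m.
  by apply: polyf_ext (polyf_const (1 : {mpoly K[k]})@_m) => e; rewrite big_nil.
by apply: polyf_ext (polympM (HF i) IHr m) => e; rewrite big_cons.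
Qed.

End PolynomialFunctions.

Section ContextExtension.
Variables (K : fieldType) (E : Type) (n : nat) (c : E -> 'rV[K]_n) (m : nat).

Definition cext (e : E * 'rV[K]_m) : 'rV[K]_(n + m) := row_mx (c e.1) e.2.

Lemma polyf_fst f : polyf c f -> polyf cext (fun e => f e.1).
Proof.
move=> [p Hp]; exists (p \mPo [tuple 'X_(lshift m i) | i < n]) => -[e y] /=.
rewrite comp_mpoly_meval Hp; apply: meval_eq => i.
by rewrite tnth_mktuple mevalXU /cext row_mxEl.
Qed.

Lemma polyvec_fst k (v : E -> 'rV[K]_k) :
  polyvec c v -> polyvec cext (fun e => v e.1).
Proof. by move=> Hv i; apply: (polyf_fst (Hv i)). Qed.

Lemma polyvec_snd : polyvec cext (fun e => e.2).
Proof.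
move=> i; exists 'X_(rshift n i) => -[e y] /=.
by rewrite mevalXU /cext row_mxEr.
Qed.

End ContextExtension.

Section Definability.
Variables (K : closedFieldType) (E : Type) (n : nat) (c : E -> 'rV[K]_n).
Implicit Types P Q : E -> Prop.

Definition definable P :=
  exists2 S : 'rV[K]_n -> Prop, constructible S & forall e, P e <-> S (c e).

Lemma definable_ext P Q : (forall e, P e <-> Q e) -> definable P -> definable Q.
Proof. by move=> PQ [S cS HS]; exists S => // e; rewrite -PQ. Qed.

Lemma definable_const (A : Prop) : definable (fun _ => A).
Proof. by exists (fun _ => A); first exact: constructible_const. Qed.

Lemma definable_eq0 f : polyf c f -> definable (fun e => f e = 0).
Proof.
move=> [p Hp]; exists (fun x => p.@[x 0] = 0); first exact: constructible_eq0.
by move=> e; rewrite Hp.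
Qed.

Lemma definable_not P : definable P -> definable (fun e => ~ P e).
Proof.
move=> [S cS HS]; exists (fun x => ~ S x); first exact: constructible_compl.
by move=> e; rewrite HS.
Qed.

Lemma definable_or P Q :
  definable P -> definable Q -> definable (fun e => P e \/ Q e).
Proof.
move=> [S cS HS] [S' cS' HS']; exists (fun x => S x \/ S' x).
  exact: constructible_union.
by move=> e; rewrite HS HS'.
Qed.

Lemma definable_and P Q :
  definable P -> definable Q -> definable (fun e => P e /\ Q e).
Proof.
move=> [S cS HS] [S' cS' HS']; exists (fun x => S x /\ S' x).
  exact: constructible_and.
by move=> e; rewrite HS HS'.
Qed.

Lemma definable_imp P Q :
  definable P -> definable Q -> definable (fun e => P e -> Q e).
Proof.
move=> dP dQ; apply: definable_ext (definable_or (definable_not dP) dQ) => e.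
split=> [[//|//]|PQ]; have [Pe|Pe] := pselect (P e); [right; exact: PQ | by left].
Qed.

Lemma definable_iff P Q :
  definable P -> definable Q -> definable (fun e => P e <-> Q e).
Proof.
by move=> dP dQ; apply: definable_and; apply: definable_imp.
Qed.

Lemma definable_and3 P Q R :
  definable P -> definable Q -> definable R ->
  definable (fun e => [/\ P e, Q e & R e]).
Proof.
move=> dP dQ dR.
apply: definable_ext (definable_and dP (definable_and dQ dR)) => e.
by split=> [[? [? ?]]|[]].
Qed.

Lemma definable_neq0 f : polyf c f -> definable (fun e => f e != 0).
Proof.
move=> Hf; apply: definable_ext (definable_not (definable_eq0 Hf)) => e.
by split=> [/eqP|/eqP].
Qed.

Lemma definable_forall_fin (I : finType) (P : I -> E -> Prop) :
  (forall i, definable (P i)) -> definable (fun e => forall i, P i e).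
Proof.
move=> HP; apply: (@definable_ext (fun e => forall i, i \in enum I -> P i e)).
  by move=> e; split=> h i; [apply: h; rewrite mem_enum | move=> _].
elim: (enum I) => [|j r IHr]; first exact: definable_ext (definable_const True).
apply: definable_ext (definable_and (HP j) IHr) => e.
split=> [[Pj Pr] i|h]; first by rewrite inE => /predU1P[->//|/Pr].
by split=> [|i ir]; apply: h; rewrite inE ?eqxx // ir orbT.
Qed.

Lemma definable_exists_fin (I : finType) (P : I -> E -> Prop) :
  (forall i, definable (P i)) -> definable (fun e => exists i, P i e).
Proof.
move=> HP; apply: definable_ext (definable_not (definable_forall_fin
  (fun i => definable_not (HP i)))) => e.
by split=> [/existsNP[i /contrapT Pi]|[i Pi] /(_ i)]; [exists i|].
Qed.

Lemma definable_preim m (S : 'rV[K]_m -> Prop) (v : E -> 'rV[K]_m) :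
  constructible S -> polyvec c v -> definable (fun e => S (v e)).
Proof.
move=> cS Hv; elim: cS => {S} [S|P _|P Q _ IHP _ IHQ|P Q PQ _].
- elim: S => [|p S IHS]; first exact: definable_ext (definable_const True).
  have Hp : polyf c (fun e => p.@[v e 0]) by apply: polyf_meval.
  apply: definable_ext (definable_and (definable_eq0 Hp) IHS) => e.
  split=> [[p0 HS] q|h]; first by rewrite inE => /predU1P[->//|/HS].
  by split=> [|q qS]; apply: h; rewrite inE ?eqxx // qS orbT.
- exact: definable_not.
- exact: definable_or.
- by apply: definable_ext => e; apply: PQ.
Qed.

End Definability.

(** The context gains a free block of coordinates for [y], and the quantifier becomes the projection
    forgetting this block. *)
Lemma definable_ex (K : closedFieldType) (E : Type) n (c : E -> 'rV[K]_n) m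
    (Q : E -> 'rV[K]_m -> Prop) :
  definable (@cext K E n c m) (fun e => Q e.1 e.2) ->
  definable c (fun e => exists y, Q e y).
Proof.
move=> [S cS HS]; exists (fun x => exists y, S (row_mx x y)).
  exact: constructible_proj.
by move=> e; split=> -[y Hy]; exists y; apply/(HS (e, y)).
Qed.

Lemma definable_all (K : closedFieldType) (E : Type) n (c : E -> 'rV[K]_n) m
    (Q : E -> 'rV[K]_m -> Prop) :
  definable (@cext K E n c m) (fun e => Q e.1 e.2) ->
  definable c (fun e => forall y, Q e y).
Proof.
move=> dQ; apply: definable_ext (definable_not (definable_ex
  (Q := fun e y => ~ Q e y) (definable_not dQ))) => e.
split=> [h y|h [y]]; last by apply.
by apply: contrapT => nQ; apply: h; exists y.
Qed.

(** Induction with a list of polynomials and a Boolean function of their vanishing pattern: a union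
    concatenates the lists, a complement negates the function. *)
Lemma constructible_pattern (K : fieldType) n (P : 'rV[K]_n -> Prop) :
  constructible P ->
  exists (J : nat) (q : 'I_J -> {mpoly K[n]}) (B : {set {ffun 'I_J -> bool}}),
    forall x, P x <-> [ffun j => (q j).@[x 0] != 0] \in B.
Proof.
move=> cP.
suff [s [b Hb]] : exists (s : seq {mpoly K[n]}) (b : seq bool -> bool),
    forall x, P x <-> b [seq p.@[x 0] != 0 | p <- s].
  exists (size s), (fun j => s`_j).
  exists [set f : {ffun 'I_(size s) -> bool} | b (codom f)].
  move=> x; rewrite Hb inE codomE.
  suff -> : [seq p.@[x 0] != 0 | p <- s] =
    [seq [ffun j : 'I_(size s) => (s`_j).@[x 0] != 0] i
    | i <- enum 'I_(size s)] by [].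
  apply: (@eq_from_nth _ false) => [|i].
    by rewrite size_map [RHS]size_map -[LHS](size_enum_ord (size s)).
  rewrite size_map => lt_i.
  rewrite (nth_map 0) // (nth_map (Ordinal lt_i)) ?size_enum_ord // ffunE.
  by rewrite nth_enum_ord.
elim: cP => {P} [S|P _ [s [b Hb]]|P Q _ [s [b Hb]] _ [s' [b' Hb']]|
  P Q PQ _ [s [b Hb]]].
- exists S, (fun r => all negb r) => x; rewrite all_map; split=> [h|/allP h p pS].
    by apply/allP => p pS /=; rewrite h ?eqxx.
  by have /= := h p pS; rewrite negbK => /eqP.
- by exists s, (fun r => ~~ b r) => x; rewrite Hb (rwP negP).
- exists (s ++ s'), (fun r => b (take (size s) r) || b' (drop (size s) r)) => x.
  rewrite map_cat take_size_cat ?size_map // drop_size_cat ?size_map //.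
  by rewrite Hb Hb' (rwP orP).
- by exists s, b => x; rewrite -Hb (PQ x).
Qed.

Lemma mpoly_ring_ind (R : comNzRingType) n (P : {mpoly R[n]} -> Prop) :
  (forall a, P a%:MP) -> (forall i, P 'X_i) ->
  (forall p q, P p -> P q -> P (p + q)) ->
  (forall p q, P p -> P q -> P (p * q)) -> forall p, P p.
Proof.
move=> PC PX PD PM; have PXn m : P 'X_[m].
  rewrite mpolyXE_id; elim/big_ind: _ => // [|i _]; first exact: (PC 1).
  by elim: (m i) => [|d IHd]; rewrite ?exprS; [exact: (PC 1) | exact: PM].
elim/mpolyind => [|c m p _ _ Pp]; first by rewrite -mpolyC0.
by apply: PD => //; rewrite -mul_mpolyC; apply: PM.
Qed.

(** * Polynomial preliminaries *)

Section ChainRule.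
Variables (R : comNzRingType) (n k : nat) (lq : n.-tuple {mpoly R[k]}).

Lemma mderiv_comp (p : {mpoly R[n]}) i :
  (p \mPo lq)^`M(i) = \sum_(l < n) (p^`M(l) \mPo lq) * (tnth lq l)^`M(i).
Proof.
elim/mpoly_ring_ind: p => [a|l|p q IHp IHq|p q IHp IHq].
- rewrite comp_mpolyC mderivC big1 // => l _.
  by rewrite mderivC comp_mpoly0 mul0r.
- rewrite (bigD1 l) //= big1 => [|j jl].
    rewrite comp_mpolyXU mderivX mnm1E eqxx scale1r.
    rewrite (_ : (U_(l) - U_(l))%MM = 0%MM); last first.
      by apply/mnmP => j; rewrite mnmBE subnn mnm0E.
    by rewrite mpolyX0 comp_mpoly1 mul1r addr0 -tnth_nth.
  by rewrite mderivX mnm1E eq_sym (negPf jl) scale0r comp_mpoly0 mul0r.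
- rewrite comp_mpolyD mderivD IHp IHq -big_split /=; apply: eq_bigr => l _.
  by rewrite mderivD comp_mpolyD mulrDl.
- rewrite rmorphM mderivM IHp IHq mulr_suml mulr_sumr -big_split /=.
  apply: eq_bigr => l _; rewrite mderivM comp_mpolyD !rmorphM /= mulrDl.
  by rewrite -!mulrA [X in _ * X]mulrC.
Qed.

End ChainRule.

Lemma mulrBB (R : comPzRingType) (a b a' b' : R) :
  a * b - a' * b' = a * (b - b') + b' * (a - a').
Proof. by rewrite !mulrBr (mulrC a b') addrA subrK (mulrC a'). Qed.

Section DividedDifferences.
Variables (R : comNzRingType) (n : nat).

Definition lvars : n.-tuple {mpoly R[n + n]} := [tuple 'X_(lshift n i) | i < n].
Definition rvars : n.-tuple {mpoly R[n + n]} := [tuple 'X_(rshift n i) | i < n].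

(** Telescoping as in the Leibniz rule. The point of [D] is that it lives on pairs of points,
    coincident ones included: off the diagonal it measures secants, on the diagonal it is the
    gradient. *)
Lemma divided_difference (f : {mpoly R[n]}) :
  exists D : 'I_n -> {mpoly R[n + n]},
    (f \mPo lvars) - (f \mPo rvars)
      = \sum_k D k * ('X_(lshift n k) - 'X_(rshift n k))
    /\ forall k (x : 'rV[R]_n),
         (D k).@[row_mx x x 0] = (f^`M(k)).@[x 0].
Proof.
have evl (p : {mpoly R[n]}) (x : 'rV[R]_n) :
    (p \mPo lvars).@[row_mx x x 0] = p.@[x 0].
  rewrite comp_mpoly_meval; apply: meval_eq => i.
  by rewrite tnth_mktuple mevalXU row_mxEl.
have evr (p : {mpoly R[n]}) (x : 'rV[R]_n) :
    (p \mPo rvars).@[row_mx x x 0] = p.@[x 0].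
  rewrite comp_mpoly_meval; apply: meval_eq => i.
  by rewrite tnth_mktuple mevalXU row_mxEr.
elim/mpoly_ring_ind: f => [a|i|p q [D [HD D0]] [D' [HD' D'0]]|
  p q [D [HD D0]] [D' [HD' D'0]]].
- exists (fun _ => 0); split=> [|k x]; last by rewrite mderivC !meval0.
  by rewrite !comp_mpolyC subrr big1 // => k _; rewrite mul0r.
- exists (fun k => (i == k)%:R); split=> [|k x].
    rewrite (bigD1 i) //= big1 => [|k /negPf ki]; last by rewrite eq_sym ki mul0r.
    by rewrite eqxx mul1r addr0 !comp_mpolyXU -!tnth_nth !tnth_mktuple.
  rewrite mderivX mnm1E; case: eqP => [->|_]; last by rewrite scale0r !meval0.
  rewrite (_ : (U_(k) - U_(k))%MM = 0%MM); last first.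
    by apply/mnmP => j; rewrite mnmBE subnn mnm0E.
  by rewrite scale1r mpolyX0 !meval1.
- exists (fun k => D k + D' k); split=> [|k x]; last first.
    by rewrite mderivD !mevalD D0 D'0.
  rewrite !comp_mpolyD opprD addrACA HD HD' -big_split /=.
  by apply: eq_bigr => k _; rewrite mulrDl.
- exists (fun k => (p \mPo lvars) * D' k + (q \mPo rvars) * D k); split; last first.
    move=> k x; rewrite mderivM !mevalD !mevalM evl evr D0 D'0 addrC.
    by rewrite [q.@[_] * _]mulrC.
  rewrite !rmorphM /= mulrBB HD HD' !mulr_sumr -big_split /=.
  apply: eq_bigr => k _.
  by rewrite mulrDl !mulrA.
Qed.

Lemma divided_difference_eval (f : {mpoly R[n]}) :
  exists D : 'I_n -> {mpoly R[n + n]},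
    (forall x y : 'rV[R]_n, f.@[x 0] - f.@[y 0]
      = \sum_k (D k).@[row_mx x y 0] * (x 0 k - y 0 k))
    /\ forall k (x : 'rV[R]_n), (D k).@[row_mx x x 0] = (f^`M(k)).@[x 0].
Proof.
have [D [HD D0]] := divided_difference f; exists D; split=> // x y.
have := congr1 (meval (row_mx x y 0)) HD; rewrite mevalB !comp_mpoly_meval.
rewrite (meval_eq (v2 := x 0)); last first.
  by move=> i; rewrite tnth_mktuple mevalXU row_mxEl.
rewrite [X in _ - X](meval_eq (v2 := y 0)); last first.
  by move=> i; rewrite tnth_mktuple mevalXU row_mxEr.
move=> ->; rewrite raddf_sum /=; apply: eq_bigr => k _.
by rewrite mevalM mevalB !mevalXU row_mxEl row_mxEr.
Qed.

End DividedDifferences.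

(** * Generic points and density *)

Section Genericity.
Variable K : closedFieldType.

Lemma muni_coef n (p : {mpoly K[n.+1]}) (m : 'X_{1..n.+1}) :
  ((muni p)`_(m ord_max))@_[multinom m (widen_ord (leqnSn n) i) | i < n] = p@_m.
Proof.
rewrite muniE coef_sum raddf_sum /=.
transitivity (\sum_(m' <- msupp p) p@_m' * (m' == m)%:R).
  apply: eq_bigr => m' _; rewrite coefZ coefXn.
  rewrite -scalerAl mcoeffZ; congr (_ * _).
  case: (eqVneq m' m) => [->|ne]; first by rewrite eqxx mulr1 mcoeffX eqxx.
  case: eqVneq => [e|_]; last by rewrite mulr0 mcoeff0.
  rewrite mulr1 mcoeffX; case: eqVneq => // /mnmP e'; case/eqP: ne.
  apply/mnmP => i; case: (unliftP ord_max i) => [j ->|->] //.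
  have := e' j; rewrite !mnmE.
  suff -> : lift ord_max j = widen_ord (leqnSn n) j by [].
  by apply: val_inj; rewrite /= /bump leqNgt ltn_ord.
have [pm|pm] := boolP (m \in msupp p).
  rewrite (bigD1_seq m) ?msupp_uniq //= eqxx mulr1 big1 ?addr0 // => m' /negPf->.
  by rewrite mulr0.
rewrite (memN_msupp_eq0 pm) big_seq big1 // => m' pm'.
by case: eqVneq pm' pm => [->->|_ _ _] //; rewrite mulr0.
Qed.

Lemma muni_eval n (p : {mpoly K[n.+1]}) (v : 'I_n.+1 -> K) :
  (map_poly (meval (fun i => v (widen_ord (leqnSn n) i))) (muni p)).[v ord_max]
  = p.@[v].
Proof.
rewrite muniE raddf_sum /= -[_.[_]]/(horner_eval (v ord_max) _) raddf_sum /=.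
rewrite mevalE; apply: eq_bigr => m _.
rewrite map_polyZ /= mevalZ /horner_eval hornerZ map_polyXn hornerXn mevalX -mulrA.
by rewrite big_ord_recr /=; congr (_ * (_ * _)); apply: eq_bigr => i _; rewrite mnmE.
Qed.

(** The leading coefficient in the last variable is made nonzero by induction; the last variable
    then has only finitely many values to avoid. *)
Lemma mpoly_neq0_eval n (p : {mpoly K[n]}) : p != 0 ->
  exists v : 'I_n -> K, p.@[v] != 0.
Proof.
elim: n p => [|n IHn] p.
  rewrite (nvar0_mpolyC p) mpolyC_eq0 => p0.
  by exists (fun _ => 0); rewrite mevalC.
have [p0 /negP[]|] := eqVneq (muni p) 0.
  by apply/eqP/mpolyP => m; rewrite -muni_coef p0 coef0 !mcoeff0.
rewrite -lead_coef_eq0 => /IHn[v Hv] _.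
pose q := map_poly (meval v) (muni p).
have : q != 0 by apply: contraNneq Hv => q0; rewrite lead_coefE -coef_map -/q q0 coef0.
case/closed_nonrootP => t /rootP/eqP Ht.
pose V (i : 'I_n.+1) := if unlift ord_max i is Some j then v j else t.
exists V; rewrite -muni_eval /V unlift_none.
rewrite (_ : map_poly _ _ = q) //; apply/polyP => i; rewrite !coef_map /=.
apply: meval_eq => j; rewrite (_ : widen_ord _ _ = lift ord_max j) ?liftK //.
by apply: val_inj; rewrite /= /bump leqNgt ltn_ord.
Qed.

Lemma mpoly_eval_neq0 n (p : {mpoly K[n]}) : p != 0 ->
  exists x : 'rV[K]_n, p.@[x 0] != 0.
Proof.
case/mpoly_neq0_eval => v Hv; exists (\row_i v i).
by rewrite (meval_eq (v2 := v)) // => i; rewrite mxE.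
Qed.

Lemma mpoly_eval_inj n (p q : {mpoly K[n]}) :
  (forall x : 'rV[K]_n, p.@[x 0] = q.@[x 0]) -> p = q.
Proof.
move=> pq; apply/eqP; rewrite -subr_eq0; apply: contraT => /mpoly_eval_neq0[x].
by rewrite mevalB pq subrr eqxx.
Qed.

Section Surjective.
Variables (E : Type) (n : nat) (c : E -> 'rV[K]_n).
Hypothesis c_surj : forall x, exists e, c e = x.

Lemma polyf_generic f g : polyf c f -> polyf c g ->
  (exists e, f e != 0) -> (exists e, g e != 0) ->
  exists e, f e != 0 /\ g e != 0.
Proof.
move=> [p Hp] [q Hq] [e fe] [e' ge].
have p0 : p != 0 by apply: contraNneq fe => p0; rewrite Hp p0 meval0.
have q0 : q != 0 by apply: contraNneq ge => q0; rewrite Hq q0 meval0.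
have /mpoly_eval_neq0[x] : p * q != 0 by rewrite mulf_neq0.
have [a <-] := c_surj x; rewrite mevalM mulf_eq0 => /norP[pa qa].
by exists a; rewrite Hp Hq.
Qed.

Lemma polyf_generic_prod (I : finType) (P : pred I) (f : I -> E -> K) :
  (forall i, polyf c (f i)) -> (forall i, P i -> exists e, f i e != 0) ->
  exists e, forall i, P i -> f i e != 0.
Proof.
move=> Hf ne; have [e He] : exists e,
    \prod_(i <- [seq i <- index_enum I | P i]) f i e != 0.
  have: {subset [seq i <- index_enum I | P i] <= P}.
    by move=> i; rewrite mem_filter => /andP[].
  elim: [seq i <- index_enum I | P i] => [_|i r IHr sP].
    by have [e _] := c_surj 0; exists e; rewrite big_nil oner_neq0.
  have nei : exists e, f i e != 0 by apply: ne; apply: sP; rewrite inE eqxx.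
  have ner : exists e, \prod_(j <- r) f j e != 0.
    by apply: IHr => j jr; apply: sP; rewrite inE jr orbT.
  have [e [fe re]] := polyf_generic (Hf i) (polyf_prod r xpredT Hf) nei ner.
  by exists e; rewrite big_cons mulf_neq0.
exists e => i Pi; apply: contraNneq He => fi.
by rewrite big_filter (bigD1 i) //= fi mul0r.
Qed.

(** Density of a nonempty open set: otherwise some point would make both [h] and the difference
    nonzero. *)
Lemma polyf_eq f g h : polyf c f -> polyf c g -> polyf c h ->
  (exists e, h e != 0) -> (forall e, h e != 0 -> f e = g e) ->
  forall e, f e = g e.
Proof.
move=> Hf Hg Hh h0 fg e; apply/eqP; rewrite -subr_eq0; apply: contraT => fge.
have [|a [nfg /fg fga]] := polyf_generic (polyfB Hf Hg) Hh _ h0; first by exists e.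
by rewrite fga subrr eqxx in nfg.
Qed.

End Surjective.

Lemma id_surj n (x : 'rV[K]_n) : exists e, (fun y : 'rV[K]_n => y) e = x.
Proof. by exists x. Qed.

Lemma cext_surj E n (c : E -> 'rV[K]_n) m :
  (forall x, exists e, c e = x) ->
  forall x : 'rV[K]_(n + m), exists e, cext c e = x.
Proof.
move=> cs x; have [e He] := cs (lsubmx x).
by exists (e, rsubmx x); rewrite /cext He hsubmxK.
Qed.

End Genericity.

(** * Specialization of a sequence of points *)

Section Ideals.
Variable A : comNzRingType.

Definition is_ideal (I : A -> Prop) : Prop :=
  [/\ I 0, forall a b, I a -> I b -> I (a + b) & forall x a, I a -> I (x * a)].

Definition adjoin (I : A -> Prop) (a x : A) : Prop :=
  exists b q, I b /\ x = b + q * a.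

Variables (I : A -> Prop) (idI : is_ideal I).

Lemma adjoin_ideal a : is_ideal (adjoin I a).
Proof.
case: idI => I0 ID IM; split.
- by exists 0, 0; rewrite mul0r addr0.
- move=> _ _ [b [q [Ib ->]]] [b' [q' [Ib' ->]]].
  by exists (b + b'), (q + q'); split; [exact: ID | rewrite mulrDl addrACA].
- move=> x _ [b [q [Ib ->]]]; exists (x * b), (x * q).
  by split; [exact: IM | rewrite mulrDr mulrA].
Qed.

Lemma adjoin_sub a b : I b -> adjoin I a b.
Proof. by move=> Ib; exists b, 0; rewrite mul0r addr0. Qed.

Lemma adjoin_gen a : adjoin I a a.
Proof. by case: idI => I0 _ _; exists 0, 1; rewrite mul1r add0r. Qed.

(* If adjoining every factor gave the unit ideal, the product of the factors
   being in I would put 1 in I. *)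
Lemma proper_adjoin_factor (rs : seq A) :
  ~ I 1 -> I (\prod_(r <- rs) r) -> exists2 r, r \in rs & ~ adjoin I r 1.
Proof.
case: idI => I0 ID IM I1; elim: rs => [|r rs IHrs]; first by rewrite big_nil.
rewrite big_cons => Irs.
have [[b [q [Ib e1]]]|] := pselect (adjoin I r 1); last first.
  by exists r; rewrite ?inE ?eqxx.
move: (\prod_(j <- rs) j) Irs IHrs => pr Irs IHrs.
have [|s srs Hs] := IHrs; last by exists s; rewrite ?inE ?srs ?orbT.
rewrite -[X in I X]mul1r e1 mulrDl [b * _]mulrC -mulrA.
by apply: ID; apply: IM.
Qed.

End Ideals.

(** * Sequences as an algebra over polynomials in one variable *)

Section SequenceEvaluation.
Variables (K : comNzRingType).

Definition seq_eval (n : nat) (f : nat -> K) : K := f n.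

Fact seq_eval_is_additive n : additive (seq_eval n). Proof. by []. Qed.
Fact seq_eval_is_multiplicative n : multiplicative (seq_eval n).
Proof. by []. Qed.

HB.instance Definition _ n :=
  GRing.isAdditive.Build (nat -> K) K (seq_eval n) (seq_eval_is_additive n).
HB.instance Definition _ n :=
  GRing.isMultiplicative.Build (nat -> K) K (seq_eval n)
    (seq_eval_is_multiplicative n).

Variable u : nat -> K.

(** Structure map making sequences an algebra over [{poly K}] through the sample values [u n]. An
    integral equation over it is one monic polynomial valid at all samples simultaneously. *)
Definition seq_horner (p : {poly K}) : nat -> K := fun n => p.[u n].

Fact seq_horner_is_additive : additive seq_horner.
Proof. by move=> p q; apply: funext => n; rewrite /seq_horner hornerD hornerN. Qed.
Fact seq_horner_is_multiplicative : multiplicative seq_horner.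
Proof.
split; first by move=> p q; apply: funext => n; rewrite /seq_horner hornerM.
by apply: funext => n; rewrite /seq_horner hornerC.
Qed.

HB.instance Definition _ :=
  GRing.isAdditive.Build {poly K} (nat -> K) seq_horner seq_horner_is_additive.
HB.instance Definition _ :=
  GRing.isMultiplicative.Build {poly K} (nat -> K) seq_horner
    seq_horner_is_multiplicative.

Lemma root_seq_horner (p : {poly {poly K}}) (f : nat -> K) :
  root (map_poly seq_horner p) f <->
  forall n, (map_poly (horner_eval (u n)) p).[f n] = 0.
Proof.
have ev n : seq_eval n (map_poly seq_horner p).[f]
    = (map_poly (horner_eval (u n)) p).[f n].
  rewrite -horner_map -map_poly_comp /=.
  by congr (_.[_]); apply: eq_map_poly.
split=> [/rootP p0 n|p0]; first by rewrite -ev p0.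
by apply/rootP/funext => n; rewrite -[LHS]/(seq_eval n _) ev p0.
Qed.

End SequenceEvaluation.

Section Specialization.
Variables (K : closedFieldType) (N : nat) (P : nat -> 'rV[K]_N) (k0 : 'I_N).
Hypothesis P_inj : injective (fun n => P n 0 k0).
Hypothesis P_int : forall k, exists2 m : {poly {poly K}}, m \is monic
  & forall n, (map_poly (horner_eval (P n 0 k0)) m).[P n 0 k] = 0.

Let eps n := P n 0 k0.

Let poly_inj_eq0 (p : {poly K}) : (forall n, p.[eps n] = 0) -> p = 0.
Proof.
move=> p0; apply/eqP; apply: contraT => pn0.
have := max_poly_roots (rs := [seq eps n | n <- iota 0 (size p)]) pn0.
rewrite map_inj_uniq // iota_uniq size_map size_iota ltnn => -> //.
by apply/allP => _ /mapP[n _ ->]; apply/rootP.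
Qed.

Let vanishing (h : {mpoly K[N]}) := forall n, h.@[P n 0] = 0.

Let vanishing_ideal : is_ideal vanishing.
Proof.
split=> [n|a b a0 b0 n|x a a0 n]; first by rewrite meval0.
  by rewrite mevalD a0 b0 addr0.
by rewrite mevalM a0 mulr0.
Qed.

Let integral_eval (h : {mpoly K[N]}) :
  integralOver (seq_horner eps) (fun n => h.@[P n 0]).
Proof.
elim/mpoly_ring_ind: h => [a|k|p q Hp Hq|p q Hp Hq].
- rewrite (_ : (fun n => _) = seq_horner eps a%:P); first exact: integral_id.
  by apply: funext => n; rewrite mevalC /seq_horner hornerC.
- have [m mon_m Hm] := P_int k; exists m => //; apply/root_seq_horner => n.
  by rewrite mevalXU Hm.
- rewrite (_ : (fun n => _) = (fun n => p.@[P n 0]) + (fun n => q.@[P n 0])).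
    exact: integral_add.
  by apply: funext => n; rewrite mevalD.
- rewrite (_ : (fun n => _) = (fun n => p.@[P n 0]) * (fun n => q.@[P n 0])).
    exact: integral_mul.
  by apply: funext => n; rewrite mevalM.
Qed.

(* If 1 = eps * s with s integral over K[eps], an integral equation of s
   multiplied by a power of eps is a polynomial identity that fails at
   eps = 0. *)
Let proper_base : ~ adjoin vanishing 'X_k0 1.
Proof.
case=> b [s [b0 e1]].
have es n : s.@[P n 0] * eps n = 1.
  by have := congr1 (meval (P n 0)) e1; rewrite meval1 mevalD b0 add0r mevalM mevalXU.
have [q mon_q /root_seq_horner q0] := integral_eval s.
have sz_q : size q = (size q).-1.+1 by rewrite prednK // size_poly_gt0 monic_neq0.
set d := (size q).-1 in sz_q.
pose G := \sum_(i < d.+1) q`_i * 'X^(d - i).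
have G0 : G = 0.
  apply: poly_inj_eq0 => n; rewrite horner_sum.
  transitivity (eps n ^+ d * (map_poly (horner_eval (eps n)) q).[s.@[P n 0]]).
    2: by rewrite q0 mulr0.
  rewrite horner_coef size_map_poly_id0; last first.
    by rewrite (monicP mon_q) /horner_eval hornerC oner_neq0.
  rewrite sz_q mulr_sumr; apply: eq_bigr => -[i lt_i] _ /=.
  rewrite coef_map /= /horner_eval hornerM hornerXn.
  rewrite mulrCA; congr (_ * _).
  rewrite -[in RHS](subnK (_ : i <= d)%N) // exprD -mulrA -exprMn mulrC.
  by rewrite [eps n * _]mulrC es expr1n mul1r.
have := congr1 (horner_eval 0) G0; rewrite /horner_eval horner0 horner_sum.
rewrite big_ord_recr /= big1 => [|[i lt_i] _].
  rewrite add0r subnn expr0 mulr1 -/(lead_coef q) (monicP mon_q) hornerC.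
  by move/eqP; rewrite oner_eq0.
by rewrite hornerM hornerXn expr0n subn_eq0 leqNgt lt_i mulr0.
Qed.

(** Modulo ['X_k0] the coefficients of the monic equation of coordinate [k] become their values at
    0, and the resulting polynomial splits over the algebraically closed field. *)
Let coord_split k : exists rs : seq K,
  adjoin vanishing 'X_k0 (\prod_(r <- [seq 'X_k - r%:MP | r <- rs]) r).
Proof.
have [m mon_m Hm] := P_int k.
have [_ ID IM] := adjoin_ideal vanishing_ideal 'X_k0.
pose psi (p : {poly K}) : {mpoly K[N]} := (map_poly (@mpolyC N K) p).['X_k0].
have ev_psi p v : (psi p).@[v] = p.[v k0].
  rewrite /psi -horner_map -map_poly_comp /= mevalXU map_poly_id // => a _ /=.
  by rewrite mevalC.
have psi0 p : exists q, psi p = q * 'X_k0 + (p.[0])%:MP.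
  have /factor_theorem[q Hq] : root (p - (p.[0])%:P) 0.
    by apply/rootP; rewrite hornerD hornerN hornerC subrr.
  exists (psi q); rewrite -[in LHS](subrK (p.[0])%:P p) Hq subr0 /psi.
  by rewrite rmorphD rmorphM /= map_polyX map_polyC /= hornerD hornerM hornerX hornerC.
pose m0 := map_poly (horner_eval 0) m.
have [rs Hrs] := closed_field_poly_normal m0.
exists rs; rewrite big_map.
have lm0 : lead_coef m0 = 1 by apply/monicP/monic_map.
have -> : \prod_(r <- rs) ('X_k - r%:MP) = (map_poly (@mpolyC N K) m0).['X_k].
  rewrite Hrs lm0 scale1r rmorph_prod /= horner_prod; apply: eq_bigr => r _.
  by rewrite rmorphB /= map_polyX map_polyC /= hornerD hornerN hornerX hornerC.
have [q Hq] : exists q, \sum_(i < size m) psi m`_i * 'X_k ^+ i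
    = q * 'X_k0 + (map_poly (@mpolyC N K) m0).['X_k].
  rewrite horner_coef size_map_poly_id0 ?lm0 ?mpolyC1 ?oner_neq0 //.
  rewrite size_map_poly_id0; last first.
    by rewrite (monicP mon_m) /horner_eval hornerC oner_neq0.
  have /choice[q Hq] := fun i => psi0 m`_i.
  exists (\sum_(i < size m) q i * 'X_k ^+ i).
  rewrite mulr_suml -big_split; apply: eq_bigr => i _ /=.
  by rewrite Hq !coef_map /= mulrDl mulrAC.
have -> : (map_poly (@mpolyC N K) m0).['X_k]
    = \sum_(i < size m) psi m`_i * 'X_k ^+ i + - q * 'X_k0.
  by rewrite Hq mulNr addrAC subrr add0r.
apply: ID; last exact/IM/adjoin_gen.
apply: adjoin_sub => n; rewrite raddf_sum /= -[RHS](Hm n) [RHS]horner_coef.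
rewrite size_map_poly_id0; last first.
  by rewrite (monicP mon_m) /horner_eval hornerC oner_neq0.
apply: eq_bigr => i _; rewrite mevalM rmorphXn /= mevalXU ev_psi.
by rewrite coef_map.
Qed.

(** A point is built without the Nullstellensatz: for one coordinate after another a product of
    linear factors lies in the ideal, and adjoining a suitable factor keeps it proper. *)
Let proper_split (s : seq 'I_N) : exists I : {mpoly K[N]} -> Prop,
  [/\ is_ideal I, ~ I 1, forall h, adjoin vanishing 'X_k0 h -> I h
    & forall k, k \in s -> exists r : K, I ('X_k - r%:MP)].
Proof.
elim: s => [|k s [I [idI I1 sI IHs]]].
  exists (adjoin vanishing 'X_k0).
  by split; [exact: adjoin_ideal|exact: proper_base| |].
have [rs /sI Hrs] := coord_split k.
have [_ /mapP[r _ ->] Ir] := proper_adjoin_factor idI I1 Hrs.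
exists (adjoin I ('X_k - r%:MP)); split=> //.
- exact: adjoin_ideal.
- by move=> h /sI; apply: adjoin_sub.
- move=> l; rewrite inE => /predU1P[->|/IHs[r' Hr']].
    by exists r; apply: adjoin_gen.
  by exists r'; apply: adjoin_sub.
Qed.

(** Modulo a proper ideal containing every ['X_k - c_k], each [h] is congruent to its value at [c],
    and no nonzero constant lies in the ideal. All relations satisfied by the samples lie in it, so
    they hold at [c]. *)
Lemma specialization : exists c : 'rV[K]_N, c 0 k0 = 0 /\
  forall h : {mpoly K[N]}, (forall n, h.@[P n 0] = 0) -> h.@[c 0] = 0.
Proof.
have [I [[I0 ID IM] I1 sI HI]] := proper_split (enum 'I_N).
have /choice[c0 Hc0] k : exists r : K, I ('X_k - r%:MP).
  by apply: HI; rewrite mem_enum.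
pose c : 'rV[K]_N := \row_k c0 k.
have Hc h : I (h - (h.@[c 0])%:MP).
  elim/mpoly_ring_ind: h => [a|k|p q Hp Hq|p q Hp Hq].
  - by rewrite mevalC subrr.
  - by rewrite mevalXU mxE.
  - by rewrite mevalD mpolyCD opprD addrACA; apply: ID.
  - rewrite mevalM mpolyCM mulrBB; apply: ID; last exact: IM.
    exact: IM.
have Iconst a : I a%:MP -> a = 0.
  move=> Ia; apply/eqP; apply: contraT => a0; case: I1.
  by rewrite -mpolyC1 -(mulVf a0) mpolyCM; apply: IM.
have I_eval h : I h -> h.@[c 0] = 0.
  move=> Ih; apply: Iconst.
  rewrite (_ : _%:MP = h + -1 * (h - (h.@[c 0])%:MP)).
    by apply: ID => //; apply: IM.
  by rewrite mulN1r opprB addrC subrK.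
exists c; split; last by move=> h Hh; apply/I_eval/sI/adjoin_sub.
by rewrite -[LHS](mevalXU (c 0)); apply/I_eval/sI/adjoin_gen.
Qed.

End Specialization.

(** * Chow forms *)

Section TopCoefficient.
Variable A : comNzRingType.

(** [a] may vanish, so [d] is only a bound on the degree; this keeps the notion stable under sums
    and products over any commutative ring. *)
Definition top_coef d (p : {poly A}) (a : A) := (size p <= d.+1)%N /\ p`_d = a.

Lemma top_coefM d e p q a b :
  top_coef d p a -> top_coef e q b -> top_coef (d + e) (p * q) (a * b).
Proof.
move=> [sp pa] [sq qb]; split.
  apply: leq_trans (size_polyMleq p q) _.
  by rewrite -subn1 leq_subLR add1n -addSn -addnS leq_add.
have lt_d : (d < (d + e).+1)%N by rewrite ltnS leq_addr.
rewrite coefM (bigD1 (Ordinal lt_d)) //= addKn pa qb big1 ?addr0 // => -[i /= lt_i].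
rewrite -val_eqE /= neq_ltn => /orP[lt_id|lt_di].
  by rewrite [q`__]nth_default ?mulr0 // (leq_trans sq) // ltn_subRL ltn_add2r.
by rewrite [p`__]nth_default ?mul0r // (leq_trans sp).
Qed.

Lemma top_coefX d p a k : top_coef d p a -> top_coef (d * k) (p ^+ k) (a ^+ k).
Proof.
move=> ta; elim: k => [|k IHk]; first by rewrite muln0 /top_coef size_poly1 coef1.
by rewrite mulnS !exprS; apply: top_coefM.
Qed.

Lemma top_coef_prod (I : finType) (d : I -> nat) p a :
  (forall i, top_coef (d i) (p i) (a i)) ->
  top_coef (\sum_i d i)%N (\prod_i p i) (\prod_i a i).
Proof.
move=> ta; elim/big_rec3: _ => [|i x y z _ txy]; last exact: top_coefM.
by rewrite /top_coef size_poly1 coef1.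
Qed.

Lemma top_coef_sum (I : finType) d p a :
  (forall i : I, top_coef d (p i) (a i)) -> top_coef d (\sum_i p i) (\sum_i a i).
Proof.
move=> ta; split; last by rewrite coef_sum; apply: eq_bigr => i _; case: (ta i).
by apply: leq_trans (size_sum _ _ _) _; apply/bigmax_leqP => i _; case: (ta i).
Qed.

End TopCoefficient.

Definition pair_fun A m n (u : 'I_m -> A) (v : 'I_n -> A) (i : 'I_(m + n)) : A :=
  match fintype.split i with inl k => u k | inr k => v k end.

Lemma pair_funl A m n (u : 'I_m -> A) (v : 'I_n -> A) k :
  pair_fun u v (lshift n k) = u k.
Proof. by rewrite /pair_fun (unsplitK (inl k)). Qed.

Lemma pair_funr A m n (u : 'I_m -> A) (v : 'I_n -> A) k :
  pair_fun u v (rshift m k) = v k.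
Proof. by rewrite /pair_fun (unsplitK (inr k)). Qed.

Section ChowLine.
Variables (K : fieldType) (j : nat) (w : 'rV[K]_(chow_dim j).+1).

Lemma nth_chow_monoms (i : 'I_(chow_dim j).+1) (m := nth 0%MM (chow_monoms j) i) :
  (\sum_(k < 4) m (lshift 4 k))%N = j /\ (\sum_(k < 4) m (rshift 4 k))%N = j.
Proof.
have : m \in chow_monoms j by rewrite mem_nth // size_chow_monoms.
by rewrite mem_chow_monoms => /andP[/eqP ? /eqP ?].
Qed.

Section Line.
Variables (A : comNzRingType) (h : {rmorphism K -> A}) (u a b : 'I_4 -> A).

(** Scalars are extended to an algebra [A] because the planes of a pencil have coordinates that are
    polynomials in its parameter. *)
Definition chow_value (v : 'I_4 -> A) : A :=
  mmap h (pair_fun u v) (chow_form w).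

Definition chow_line : {poly A} :=
  mmap (polyC \o h) (pair_fun (fun k => (u k)%:P)
    (fun k => (a k)%:P + 'X * (b k)%:P)) (chow_form w).

Lemma chow_valueE v : chow_value v = \sum_(i < (chow_dim j).+1)
  h (w 0 i) * ((\prod_k u k ^+ nth 0%MM (chow_monoms j) i (lshift 4 k))
    * \prod_k v k ^+ nth 0%MM (chow_monoms j) i (rshift 4 k)).
Proof.
rewrite /chow_value /chow_form raddf_sum /=; apply: eq_bigr => i _.
rewrite mmapZ mmapX /mmap1 big_split_ord /=; congr (_ * (_ * _)).
  by apply: eq_bigr => k _; rewrite pair_funl.
by apply: eq_bigr => k _; rewrite pair_funr.
Qed.

(** Every monomial has degree exactly [j] in the second plane, so along [a + t b] the coefficient of
    degree [j] sees only the direction [b]. *)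
Lemma chow_line_top : top_coef j chow_line (chow_value b).
Proof.
rewrite chow_valueE /chow_line /chow_form raddf_sum /=.
apply: top_coef_sum => i; rewrite mmapZ mmapX /mmap1 big_split_ord /=.
apply: (@top_coefM _ 0 j); first by split; [exact: size_polyC_leq1 | rewrite coefC].
have [_] := nth_chow_monoms i; move: (nth 0%MM (chow_monoms j) i) => m mj.
apply: (@top_coefM _ 0 j).
  under eq_bigr => k _ do rewrite pair_funl -rmorphXn.
  rewrite -rmorph_prod.
  by split; [exact: size_polyC_leq1 | rewrite coefC].
rewrite -mj; apply: top_coef_prod => k; rewrite pair_funr -[X in top_coef X]mul1n.
apply: top_coefX; split; last by rewrite coefD coefC coefXM coefC add0r.
rewrite (leq_trans (size_polyD _ _)) // geq_max (leq_trans (size_polyC_leq1 _)) //=.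
rewrite mulrC mul_polyC (leq_trans (size_scale_leq _ _)) // size_polyX //.
Qed.

Lemma chow_line_horner t :
  chow_line.[t] = chow_value (fun k => a k + t * b k).
Proof.
rewrite /chow_line /chow_value /chow_form !raddf_sum horner_sum /=.
apply: eq_bigr => i _; rewrite !mmapZ !mmapX hornerM hornerC; congr (_ * _).
rewrite /mmap1 horner_prod; apply: eq_bigr => k _; rewrite horner_exp.
congr (_ ^+ _); case: (split_ordP k) => l ->; rewrite ?pair_funl ?pair_funr.
  by rewrite hornerC.
by rewrite hornerD hornerM hornerX !hornerC.
Qed.

End Line.

Definition chow_eval (u v : 'rV[K]_4) : K := (chow_form w).@[row_mx u v 0].

Lemma chow_evalE u v : chow_eval u v = chow_value idfun (u 0) (v 0).
Proof.
apply: meval_eq => i; case: (split_ordP i) => k ->.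
  by rewrite row_mxEl pair_funl.
by rewrite row_mxEr pair_funr.
Qed.

Lemma chow_value_ext (A : comNzRingType) (h : {rmorphism K -> A})
    (u v u' v' : 'I_4 -> A) :
  u =1 u' -> v =1 v' -> chow_value h u v = chow_value h u' v'.
Proof.
move=> uu vv; rewrite !chow_valueE; apply: eq_bigr => i _.
by congr (_ * (_ * _)); apply: eq_bigr => k _; rewrite ?uu ?vv.
Qed.

Lemma chow_value_map (A B : comNzRingType) (h : {rmorphism K -> A})
    (h' : {rmorphism K -> B}) (f : {rmorphism A -> B}) (u v : 'I_4 -> A) :
  (forall a, f (h a) = h' a) ->
  f (chow_value h u v) = chow_value h' (f \o u) (f \o v).
Proof.
move=> fh; rewrite !chow_valueE rmorph_sum; apply: eq_bigr => i _.
rewrite !rmorphM fh !rmorph_prod; congr (_ * (_ * _)).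
  by apply: eq_bigr => k _; rewrite rmorphXn.
by apply: eq_bigr => k _; rewrite rmorphXn.
Qed.

Lemma chow_evalZr a u v : chow_eval u (a *: v) = a ^+ j * chow_eval u v.
Proof.
rewrite !chow_evalE !chow_valueE mulr_sumr; apply: eq_bigr => i _ /=.
under [X in _ * (_ * X)]eq_bigr => k _ do rewrite mxE exprMn.
have [_ s] := nth_chow_monoms i.
rewrite big_split /= prodrXr s (mulrCA _ (a ^+ j)) (mulrCA (w 0 i)).
by congr (_ * (_ * (_ * _))).
Qed.

End ChowLine.

Section Dot.
Variable K : fieldType.
Implicit Types u v x y : 'rV[K]_4.

Lemma dotDl u v x : dot (u + v) x = dot u x + dot v x.
Proof. by rewrite /dot -big_split /=; apply: eq_bigr => i _; rewrite mxE mulrDl. Qed.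

Lemma dotDr u x y : dot u (x + y) = dot u x + dot u y.
Proof. by rewrite /dot -big_split /=; apply: eq_bigr => i _; rewrite mxE mulrDr. Qed.

Lemma dotZl a u x : dot (a *: u) x = a * dot u x.
Proof. by rewrite /dot mulr_sumr; apply: eq_bigr => i _; rewrite mxE mulrA. Qed.

Lemma dotZr a u x : dot u (a *: x) = a * dot u x.
Proof. by rewrite /dot mulr_sumr; apply: eq_bigr => i _; rewrite mxE mulrCA. Qed.

Lemma dotBr u x y : dot u (x - y) = dot u x - dot u y.
Proof. by rewrite dotDr -scaleN1r dotZr mulN1r. Qed.

Lemma dot0r u : dot u 0 = 0.
Proof. by rewrite /dot big1 // => i _; rewrite mxE mulr0. Qed.

Lemma dot_delta x k : dot (delta_mx 0 k) x = x 0 k.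
Proof.
rewrite /dot (bigD1 k) //= big1 => [|i ik]; last by rewrite mxE (negPf ik) andbF mul0r.
by rewrite mxE !eqxx mul1r addr0.
Qed.

Lemma polyf_dot E n (c : E -> 'rV[K]_n) (u x : E -> 'rV[K]_4) :
  polyvec c u -> polyvec c x -> polyf c (fun e => dot (u e) (x e)).
Proof. by move=> Hu Hx; apply: polyf_sum => i; apply: polyfM. Qed.

Lemma polyf_chow_eval E n (c : E -> 'rV[K]_n) j (w : E -> 'rV[K]_(chow_dim j).+1)
    (u v : E -> 'rV[K]_4) :
  polyvec c w -> polyvec c u -> polyvec c v ->
  polyf c (fun e => chow_eval (w e) (u e) (v e)).
Proof.
move=> Hw Hu Hv; apply: polyf_ext (fun e => esym (chow_evalE _ _ _)) _.
apply: polyf_ext (fun e => esym (chow_valueE _ _ _ _)) _.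
apply: polyf_sum => i; apply: polyfM; first exact: Hw.
by apply: polyfM; apply: polyf_prod => k; apply: polyfX.
Qed.

End Dot.

Lemma infinite_nonroots (K : closedFieldType) (p : {poly K}) : p != 0 ->
  exists eps : nat -> K, injective eps /\ forall n, p.[eps n] != 0.
Proof.
(* [f s] is a nonroot outside [s]; iterating it on the list of earlier choices gives distinct
   values. *)
move=> p0; have /choice[f Hf] (s : seq K) : exists x, x \notin s /\ p.[x] != 0.
  have /closed_nonrootP[x] : p * \prod_(z <- s) ('X - z%:P) != 0.
    by rewrite mulf_neq0 // monic_neq0 // monic_prod // => i; rewrite monicXsubC.
  by rewrite rootM negb_or root_prod_XsubC => /andP[px xs]; exists x.
pose s n := iter n (fun s => f s :: s) [::].
have sub m n : (m < n)%N -> f (s m) \in s n.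
  elim: n => // n IHn; rewrite ltnS leq_eqVlt inE => /predU1P[->|/IHn->].
    by rewrite eqxx.
  by rewrite orbT.
exists (fun n => f (s n)); split=> [m n e|n]; last by case: (Hf (s n)).
case: (ltngtP m n) => // /sub; first by rewrite e => h; case: (Hf (s n)); rewrite h.
by rewrite -e => h; case: (Hf (s m)); rewrite h.
Qed.

Lemma dhomog_meval (R : comNzRingType) n d (p : {mpoly R[n]}) (a : R)
    (x : 'rV[R]_n) :
  p \is d.-homog -> p.@[(a *: x) 0] = a ^+ d * p.@[x 0].
Proof.
move=> /dhomogP hp; rewrite !mevalE mulr_sumr big_seq [RHS]big_seq.
apply: eq_bigr => m /hp /= <-; rewrite mulrCA; congr (_ * _).
under eq_bigr => k _ do rewrite mxE exprMn.
by rewrite big_split /= prodrXr -mdegE.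
Qed.

Lemma proj_closed_scale (K : fieldType) (X : 'rV[K]_4 -> Prop) c x :
  proj_closed X -> c != 0 -> X x -> X (c *: x).
Proof.
case=> S hS SX c0 /SX[x0 Sx]; apply/SX; split=> [|p pS].
  by rewrite scaler_eq0 negb_or c0.
by have [d hd] := hS p pS; rewrite (dhomog_meval _ _ hd) Sx // mulr0.
Qed.

(** Multiplication by [k ^+ d.+1 * a ^+ d] turns an equation for [t] with leading coefficient [a]
    into a monic one for [k * a * t]. It is built over [R] once, so it serves every specialization
    [f]. *)
Lemma scale_monic (R : comNzRingType) (Q : {poly R}) d (a k : R) :
  top_coef d.+1 Q a ->
  exists2 M : {poly R}, M \is monic
    & forall (B : comNzRingType) (f : {rmorphism R -> B}) t,
      (map_poly f M).[f (k * a) * t] = f (k ^+ d.+1 * a ^+ d) * (map_poly f Q).[t].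
Proof.
move=> [sQ topQ].
pose C i := if i == d.+1 then 1 else Q`_i * (k ^+ (d.+1 - i) * a ^+ (d - i)).
exists (\poly_(i < d.+2) C i).
  by apply/monicP; rewrite lead_coef_poly // /C eqxx ?oner_neq0.
move=> B f t.
rewrite (horner_coef_wide _ (leq_trans (size_poly _ _) (size_poly _ _))).
rewrite (horner_coef_wide _ (leq_trans (size_poly _ _) sQ)) mulr_sumr.
apply: eq_bigr => -[i lt_i] _; rewrite !coef_map coef_poly /= lt_i /C.
rewrite exprMn mulrCA [RHS]mulrCA mulrA [RHS]mulrA; congr (_ * _).
rewrite -rmorphXn -!rmorphM; congr (f _); have [->|ni] := eqVneq i d.+1; rewrite ?eqxx /=.
  by rewrite mulr1 topQ exprMn [RHS]mulrCA -exprS.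
have le_i : (i <= d)%N by rewrite -ltnS ltn_neqAle ni.
rewrite mulrCA; congr (_ * _).
by rewrite exprMn mulrACA -!exprD !subnKC // ltnW.
Qed.

(** * Specialization of plane sections *)

Section PlaneSection.
Variables (K : closedFieldType) (X : 'rV[K]_4 -> Prop) (j : nat).
Variable w : 'rV[K]_(chow_dim j.+1).+1.
Hypotheses (closedX : proj_closed X) (chowX : is_chow_vector X w).

(** On the line [v + t b] the form has degree [j.+1] in [t], leading coefficient [chow_eval w u b],
    and roots [- dot v (p i) / beta]. These are distinct when [v] separates the points, so the form
    splits; density extends the identity to all [v]. *)
Lemma chow_factor u b beta (p : 'I_j.+1 -> 'rV[K]_4) :
  chow_eval w u b != 0 -> beta != 0 -> injective p ->
  (forall i, [/\ X (p i), dot u (p i) = 0 & dot b (p i) = beta]) ->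
  forall v, beta ^+ j.+1 * chow_eval w u v
            = chow_eval w u b * \prod_i dot v (p i).
Proof.
move=> ub0 beta0 p_inj Hp.
pose P := [pred ik : 'I_j.+1 * 'I_j.+1 | ik.1 != ik.2].
pose h v := \prod_(ik | P ik) dot v (p ik.1 - p ik.2).
have pv : polyvec (fun v : 'rV[K]_4 => v) (fun v => v) by apply: polyf_coord.
have cv (x : 'rV[K]_4) : polyvec (fun v : 'rV[K]_4 => v) (fun _ => x).
  by move=> i; apply: polyf_const.
apply: (@polyf_eq K 'rV_4 4 id (@id_surj K 4) _ _ h).
- apply: polyfM; first exact: polyf_const.
  by apply: polyf_chow_eval => // i; apply: polyf_const.
- apply: polyfM; first exact: polyf_const.
  by apply: polyf_prod => i; apply: polyf_dot.
- by apply: polyf_prod => i; apply: polyf_dot.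
- have [|ik Pik|v Hv] := @polyf_generic_prod K 'rV_4 4 id (@id_surj K 4) _ P
      (fun ik v => dot v (p ik.1 - p ik.2)).
  + by move=> ik; apply: polyf_dot.
  + have : p ik.1 - p ik.2 != 0 by rewrite subr_eq0 (inj_eq p_inj).
    case/rV0Pn => k pk.
    by exists (delta_mx 0 k); rewrite dot_delta.
  + by exists v; apply/prodf_neq0 => ik; apply: Hv.
move=> v /prodf_neq0 Hv.
pose L := chow_line w idfun (u 0) (v 0) (b 0).
have L_ev t : L.[t] = chow_eval w u (v + t *: b).
  rewrite chow_line_horner chow_evalE; apply: chow_value_ext => // k.
  by rewrite !mxE.
have [sL topL] := chow_line_top w idfun (u 0) (v 0) (b 0).
rewrite -/L -chow_evalE in sL topL.
have szL : size L = j.+2.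
  apply/eqP; rewrite eqn_leq sL ltnNge; apply: contra ub0 => sL'.
  by rewrite -topL nth_default.
pose rs := [seq - dot v (p i) / beta | i <- enum 'I_j.+1].
have L_roots : all (root L) rs.
  apply/allP => _ /mapP[i _ ->]; apply/rootP; rewrite L_ev.
  apply/chowX.2; exists (p i); have [Xi ui bi] := Hp i; split=> //.
  by rewrite dotDl dotZl bi mulfVK // subrr.
have rs_uniq : uniq_roots rs.
  rewrite uniq_rootsE map_inj_in_uniq ?enum_uniq // => i k _ _ /(mulIf _) e.
  apply/eqP; apply: contraT => ik; have := Hv (i, k) ik; rewrite dotBr /=.
  by rewrite -[dot v (p i)]opprK e ?invr_eq0 // opprK subrr eqxx.
have sz_rs : size L = (size rs).+1 by rewrite szL size_map size_enum_ord.
have := all_roots_prod_XsubC sz_rs L_roots rs_uniq.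
move/(congr1 (fun q => q.[0])); rewrite L_ev scale0r addr0 => ->.
rewrite hornerZ lead_coefE szL topL mulrCA; congr (_ * _).
rewrite horner_prod big_map big_enum /=.
rewrite (_ : beta ^+ j.+1 = \prod_(i < j.+1) beta); last first.
  by rewrite prodr_const card_ord.
rewrite -big_split /=; apply: eq_bigr => i _.
by rewrite hornerD hornerN hornerX hornerC add0r mulNr opprK mulrC mulfVK.
Qed.

Hypothesis degX : proj_curve_degree X j.+1.

Definition four_rows (a b c d : 'rV[K]_4) : 'M[K]_4 :=
  \matrix_(i, k) (if i == 0 then a else if i == 1 then b
                  else if i == 2%:R then c else d) 0 k.

Lemma four_rows_mul a b c d x :
  (forall u, u \in [:: a; b; c; d] -> dot u x = 0) ->
  four_rows a b c d *m x^T = 0.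
Proof.
move=> h; apply/matrixP => i k; rewrite !mxE.
rewrite -[RHS](h (if i == 0 then a else if i == 1 then b
                  else if i == 2%:R then c else d)); last first.
  by rewrite !inE; do ![case: ifP => _]; rewrite eqxx ?orbT.
by rewrite /dot; apply: eq_bigr => l _; rewrite !mxE !ord1.
Qed.

Lemma det_four_rows_eq0 a b c d x : x != 0 ->
  (forall u, u \in [:: a; b; c; d] -> dot u x = 0) ->
  \det (four_rows a b c d) = 0.
Proof.
move=> x0 /four_rows_mul Mx; apply/eqP; apply: contraNT x0 => dM.
have uM : four_rows a b c d \in unitmx by rewrite unitmxE unitfE.
by rewrite -(trmxK x) -[x^T](mulKmx uM) Mx mulmx0 trmx0.
Qed.

(* The sections of X by the planes u0 + eps * u1 consist, for all but finitely
   many eps, of the right number of distinct points, whose coordinates are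
   integral over K[eps]; the points p are a specialization of them at
   eps = 0.  Two points with the same specialization x satisfy a linear system
   whose matrix specializes to the one below. *)
Lemma plane_section_specialization u0 b kappa :
  chow_eval w u0 b != 0 -> kappa != 0 ->
  exists p : 'I_j.+1 -> 'rV[K]_4,
  [/\ forall i, [/\ X (p i), dot u0 (p i) = 0 & dot b (p i) = kappa],
      forall v, kappa ^+ j.+1 * chow_eval w u0 v
                = chow_eval w u0 b * \prod_i dot v (p i)
    & forall i k, i != k -> p i = p k ->
      forall f1 f2 : {mpoly K[4]}, (forall x, X x -> f1.@[x 0] = 0) ->
      (forall x, X x -> f2.@[x 0] = 0) ->
      \det (four_rows (\row_l (f1^`M(l)).@[p i 0]) (\row_l (f2^`M(l)).@[p i 0])
         u0 b) = 0].
Proof.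
move=> u0b kappa0; have [g g0 Hg] := degX.
have [u' gu'] := mpoly_eval_neq0 g0.
(* The pencil passes through the special plane at 0 and the generic plane [u'] at 1, so the
   genericity polynomial [g] is not identically zero along it. *)
pose u1 := u' - u0; pose u (e : K) := u0 + e *: u1.
pose upoly k : {poly K} := (u0 0 k)%:P + (u1 0 k) *: 'X.
have upolyE e k : (upoly k).[e] = u e 0 k.
  by rewrite hornerD hornerZ hornerX hornerC !mxE mulrC.
pose ell : {poly K} := chow_value w polyC upoly (fun k => (b 0 k)%:P).
have ellE e : ell.[e] = chow_eval w (u e) b.
  rewrite -[LHS]/(horner_eval e ell) /ell.
  rewrite (@chow_value_map _ _ _ _ _ _ idfun) => [|a /=]; last first.
    by rewrite /horner_eval hornerC.
  rewrite chow_evalE; apply: chow_value_ext => k /=; rewrite /horner_eval //.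
  by rewrite hornerC.
pose gpoly : {poly K} := mmap polyC upoly g.
have gpolyE e : gpoly.[e] = g.@[u e 0].
  rewrite /gpoly /mmap horner_sum mevalE; apply: eq_bigr => m _.
  rewrite hornerM hornerC /mmap1 horner_prod; congr (_ * _).
  by apply: eq_bigr => k _; rewrite horner_exp upolyE.
have [eps [eps_inj Heps]] : exists eps : nat -> K, injective eps /\
    forall n, (gpoly * ell).[eps n] != 0.
  apply: infinite_nonroots; apply: mulf_neq0.
    apply: contraNneq gu' => g1; have := gpolyE 1; rewrite g1 horner0 => ->.
    by rewrite /u scale1r addrC subrK eqxx.
  apply: contraNneq u0b => l0; have := ellE 0; rewrite l0 horner0 => ->.
  by rewrite /u scale0r addr0 eqxx.
have ell0 : ell.[0] != 0 by rewrite ellE /u scale0r addr0.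
(* Points are scaled to have [dot b] equal to [c0 * ell], not to a constant: [ell] is the leading
   coefficient of the Chow form along [b], and this factor makes the coordinates integral; [c0] is
   chosen to give [kappa] at 0. *)
pose c0 := kappa / ell.[0].
have c00 : c0 != 0 by rewrite mulf_neq0 ?invr_neq0.
have /choice[q Hq] n : exists q : 'I_j.+1 -> 'rV[K]_4, injective q /\
   forall i, [/\ X (q i), dot (u (eps n)) (q i) = 0
                & dot b (q i) = c0 * ell.[eps n]].
  have := Heps n; rewrite hornerM mulf_eq0 negb_or gpolyE => /andP[gn ln].
  have [q [Xq q_inj _]] := Hg _ gn.
  have bq i : dot b (q i) != 0.
    apply: contraNneq ln => bq0; rewrite ellE.
    by apply/eqP/chowX.2; have [Xqi uqi] := Xq i; exists (q i).
  exists (fun i => (c0 * ell.[eps n] / dot b (q i)) *: q i); split=> [i k|i].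
    move=> e; apply: q_inj; exists ((c0 * ell.[eps n] / dot b (q i))^-1
        * (c0 * ell.[eps n] / dot b (q k))).
      by rewrite !(mulf_neq0, invr_neq0).
    by rewrite -scalerA -e scalerA mulVf ?scale1r // !(mulf_neq0, invr_neq0).
  have [Xqi uqi] := Xq i; split.
  - by apply: proj_closed_scale => //; rewrite !(mulf_neq0, invr_neq0).
  - by rewrite dotZr uqi mulr0.
  - by rewrite dotZr mulfVK.
pose N := (1 + j.+1 * 4)%N.
pose P n : 'rV[K]_N := row_mx (eps n)%:M (mxvec (\matrix_i q n i)).
pose k0 : 'I_N := lshift _ 0.
pose pt (e : 'rV[K]_N) i : 'rV[K]_4 := row i (vec_mx (rsubmx e)).
have Pk0 n : P n 0 k0 = eps n by rewrite row_mxEl mxE eqxx mulr1n.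
have ptP n i : pt (P n) i = q n i by rewrite /pt row_mxKr mxvecK rowK.
have P_inj : injective (fun n => P n 0 k0).
  by move=> m n; rewrite !Pk0 => /eps_inj.
have P_int k : exists2 m : {poly {poly K}}, m \is monic
    & forall n, (map_poly (horner_eval (P n 0 k0)) m).[P n 0 k] = 0.
  case: (split_ordP k) => [l ->|].
    rewrite (ord1 l); exists ('X - 'X%:P); first exact: monicXsubC.
    move=> n; rewrite rmorphB /= map_polyX map_polyC /= hornerD hornerN hornerX.
    by rewrite hornerC /horner_eval hornerX subrr.
  (* The plane [delta_mx 0 l + t b], with [t] minus the ratio of coordinate [l] to [dot b], passes
     through the point, so [t] is a root of the Chow form along [b]; [scale_monic] turns this into a
     monic equation for the coordinate. *)
  move=> r ->; case: (mxvec_indexP r) => i l.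
  pose Q := chow_line w polyC upoly (fun k => (l == k)%:R%:P) (fun k => (b 0 k)%:P).
  have [M mon_M HM] := scale_monic (- c0)%:P
    (chow_line_top w polyC upoly (fun k => (l == k)%:R%:P) (fun k => (b 0 k)%:P)).
  exists M => // n; rewrite row_mxEr mxvecE mxE Pk0.
  have [_ /(_ i)[Xq uq bq]] := Hq n.
  have ln : ell.[eps n] != 0.
    by have := Heps n; rewrite hornerM mulf_eq0 negb_or => /andP[].
  pose t := q n i 0 l / (- c0 * ell.[eps n]).
  rewrite (_ : q n i 0 l = horner_eval (eps n) ((- c0)%:P * ell) * t); last first.
    by rewrite /horner_eval hornerM hornerC mulrC divfK // mulf_neq0 ?oppr_eq0.
  rewrite HM -/Q (_ : _.[t] = 0) ?mulr0 //.
  have -> : (map_poly (horner_eval (eps n)) Q).[t]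
      = chow_eval w (u (eps n)) (delta_mx 0 l + t *: b).
    have := chow_line_horner w polyC upoly (fun k => (l == k)%:R%:P)
      (fun k => (b 0 k)%:P) t%:P.
    move/(congr1 (horner_eval (eps n))).
    rewrite -[in LHS]horner_map /= {2}/horner_eval hornerC => ->.
    rewrite (@chow_value_map _ _ _ _ _ _ idfun) => [|a /=]; last first.
      by rewrite /horner_eval hornerC.
    rewrite chow_evalE; apply: chow_value_ext => k1 /=; rewrite /horner_eval //.
    by rewrite hornerD hornerM !hornerC !mxE eqxx eq_sym.
  apply/chowX.2; exists (q n i); split=> //.
  by rewrite dotDl dotZl dot_delta bq /t mulNr invrN mulrN mulNr divfK ?subrr // mulf_neq0.
have [c [ck0 Hc]] := specialization P_inj P_int.
have spec f : polyf id f -> (forall n, f (P n) = 0) -> f c = 0.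
  by move=> [h Hh] f0; rewrite Hh Hc // => n; rewrite -Hh f0.
have pf_eps : polyf id (fun e : 'rV[K]_N => e 0 k0) by apply: polyf_coord.
have pf_pt i : polyvec id (fun e => pt e i).
  move=> k; apply: (@polyf_ext _ _ _ _
    (fun e : 'rV[K]_N => e 0 (rshift 1 (mxvec_index i k)))).
    by move=> e; rewrite !mxE.
  exact: polyf_coord.
have pf_u : polyvec id (fun e : 'rV[K]_N => u (e 0 k0)).
  move=> k; apply: (@polyf_ext _ _ _ _
    (fun e : 'rV[K]_N => u0 0 k + e 0 k0 * u1 0 k)).
    by move=> e; rewrite !mxE.
  apply: polyfD; first exact: polyf_const.
  by apply: polyfM => //; apply: polyf_const.
have pf_ell : polyf id (fun e : 'rV[K]_N => ell.[e 0 k0]).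
  apply: polyf_ext (fun e => esym (ellE _)) _.
  by apply: polyf_chow_eval => //; move=> i; apply: polyf_const.
have u_0 : u 0 = u0 by rewrite /u scale0r addr0.
have uc : u (c 0 k0) = u0 by rewrite ck0 u_0.
have c0l : c0 * ell.[0] = kappa by rewrite divfK.
exists (pt c); split.
- move=> i.
  have bp : dot b (pt c i) = kappa.
    have := @spec (fun e => dot b (pt e i) - c0 * ell.[e 0 k0]).
    rewrite ck0 c0l => h; apply/eqP; rewrite -subr_eq0; apply/eqP.
    apply: h => [|n].
      apply: polyfB; last by apply: polyfM => //; apply: polyf_const.
      by apply: polyf_dot => // k; apply: polyf_const.
    by rewrite ptP Pk0; have [_ /(_ i)[_ _ ->]] := Hq n; rewrite subrr.
  have [S hS SX] := closedX; split=> //; last first.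
    rewrite -[in LHS]uc.
    apply: (@spec (fun e => dot (u (e 0 k0)) (pt e i))); first exact: polyf_dot.
    by move=> n; rewrite ptP Pk0; have [_ /(_ i)[]] := Hq n.
  apply/SX; split=> [|f fS].
    by apply: contraNneq kappa0 => c_0; rewrite -bp c_0 dot0r.
  apply: (@spec (fun e => f.@[pt e i 0])); first exact/polyf_meval/pf_pt.
  move=> n; rewrite ptP; have [_ /(_ i)[/SX[_]]] := Hq n.
  by move=> /(_ f fS).
- move=> v.
  have := @spec (fun e => (c0 * ell.[e 0 k0]) ^+ j.+1 * chow_eval w (u (e 0 k0)) v
     - ell.[e 0 k0] * \prod_i dot v (pt e i)).
  rewrite uc ck0 c0l ellE u_0 => h.
  apply/eqP; rewrite -subr_eq0; apply/eqP; apply: h => [|n].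
    apply: polyfB; apply: polyfM => //.
    - by apply: polyfX; apply: polyfM => //; apply: polyf_const.
    - by apply: polyf_chow_eval => // i; apply: polyf_const.
    - by apply: polyf_prod => i; apply: polyf_dot => // l; apply: polyf_const.
  have ln : ell.[eps n] != 0.
    by have := Heps n; rewrite hornerM mulf_eq0 negb_or => /andP[].
  rewrite Pk0; have [q_inj Hqn] := Hq n.
  have beta0 : c0 * ell.[eps n] != 0 by apply: mulf_neq0.
  rewrite (@chow_factor _ b _ (q n)) -?ellE //.
  by rewrite [X in _ - _ * X](eq_bigr (fun i => dot v (q n i))) ?subrr // => i _; rewrite ptP.
(* At each sample [q n i - q n k] is a nonzero kernel vector of the matrix whose first two rows are
   divided differences of [f1] and [f2]. The determinant vanishes there, hence also in the limit,
   where these rows become gradients since the two points coincide. *)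
move=> i k ik pik f1 f2 f1X f2X.
have [D1 [D1E D1x]] := divided_difference_eval f1.
have [D2 [D2E D2x]] := divided_difference_eval f2.
pose row_of (D : 'I_4 -> {mpoly K[4 + 4]}) (e : 'rV[K]_N) : 'rV[K]_4 :=
  \row_l (D l).@[row_mx (pt e i) (pt e k) 0].
have pf_row D : polyvec id (row_of D).
  move=> l; apply: (@polyf_ext _ _ _ _ (fun e =>
    (D l).@[row_mx (pt e i) (pt e k) 0])) => [e|]; first by rewrite mxE.
  apply: polyf_meval => a; case: (split_ordP a) => a' ->.
    by apply: polyf_ext (fun e => esym (row_mxEl _ _ _ _)) _; apply: pf_pt.
  by apply: polyf_ext (fun e => esym (row_mxEr _ _ _ _)) _; apply: pf_pt.
have grad_rowE D f (Dx : forall k (x : 'rV[K]_4), (D k).@[row_mx x x 0] = (f^`M(k)).@[x 0]) :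
    row_of D c = \row_l (f^`M(l)).@[pt c i 0].
  apply/rowP => l; rewrite [RHS]mxE /row_of mxE -pik Dx; reflexivity.
rewrite -(grad_rowE _ _ D1x) // -(grad_rowE _ _ D2x) // -[in X in four_rows _ _ X]uc.
apply: (@spec (fun e => \det (four_rows (row_of D1 e) (row_of D2 e) (u (e 0 k0)) b))).
  apply: polyf_det => a l; apply: (@polyf_ext _ _ _ _ (fun e => (if a == 0 then row_of D1 e
    else if a == 1 then row_of D2 e else if a == 2%:R then u (e 0 k0) else b) 0 l)).
    by move=> e; rewrite mxE.
  case: (a == 0); first exact: pf_row.
  case: (a == 1); first exact: pf_row.
  case: (a == 2%:R); first exact: pf_u.
  exact: polyf_const.
move=> n; have [q_inj Hqn] := Hq n.
have [Xi ui bi] := Hqn i; have [Xk uk bk] := Hqn k.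
apply: (@det_four_rows_eq0 _ _ _ _ (q n i - q n k)).
  by rewrite subr_eq0 (inj_eq q_inj).
move=> a; rewrite !inE Pk0 => /or4P[] /eqP->.
- transitivity (f1.@[q n i 0] - f1.@[q n k 0]); last by rewrite !f1X ?subrr.
  by rewrite D1E /dot; apply: eq_bigr => l _; rewrite !mxE !ptP.
- transitivity (f2.@[q n i 0] - f2.@[q n k 0]); last by rewrite !f2X ?subrr.
  by rewrite D2E /dot; apply: eq_bigr => l _; rewrite !mxE !ptP.
- by rewrite dotBr ui uk subrr.
- by rewrite dotBr bi bk subrr.
Qed.

End PlaneSection.

(** * The affine chart *)

Section AffineChart.
Variable K : fieldType.
Implicit Types (a b x y : 'rV[K]_3) (u v : 'rV[K]_4).

Definition hpt x : 'rV[K]_4 := row_mx (1%:M : 'M[K]_1) x.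

Definition plane_through a y : 'rV[K]_4 := row_mx (- (a *m y^T)) a.

Let lshift0 : lshift 3 (0 : 'I_1) = ord0. Proof. exact: val_inj. Qed.
Let rshift1 (k : 'I_3) : rshift 1 k = lift ord0 k. Proof. exact: val_inj. Qed.

Lemma hpt0 x : hpt x 0 ord0 = 1.
Proof. by rewrite -lshift0 [LHS]row_mxEl mxE. Qed.

Lemma hptS x k : hpt x 0 (lift ord0 k) = x 0 k.
Proof. by rewrite -rshift1 [LHS]row_mxEr. Qed.

Lemma plane_through0 a y : plane_through a y 0 ord0 = - \sum_k a 0 k * y 0 k.
Proof.
rewrite -lshift0 [LHS]row_mxEl !mxE; congr (- _).
by apply: eq_bigr => k _; rewrite mxE.
Qed.

Lemma plane_throughS a y k : plane_through a y 0 (lift ord0 k) = a 0 k.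
Proof. by rewrite -rshift1 [LHS]row_mxEr. Qed.

Lemma dot_recl u v :
  dot u v = u 0 ord0 * v 0 ord0
            + \sum_(k < 3) u 0 (lift ord0 k) * v 0 (lift ord0 k).
Proof. by rewrite /dot big_ord_recl. Qed.

Lemma dot_plane_through a x v :
  dot (plane_through a x) v
  = \sum_k a 0 k * (v 0 (lift ord0 k) - v 0 ord0 * x 0 k).
Proof.
rewrite dot_recl plane_through0 mulNr mulr_suml -sumrN -big_split /=.
by apply: eq_bigr => k _; rewrite plane_throughS mulrBr addrC -mulrA (mulrC (x 0 k)).
Qed.

Lemma dot_plane_through_hpt a x : dot (plane_through a x) (hpt x) = 0.
Proof.
by rewrite dot_plane_through big1 // => k _; rewrite hpt0 hptS mul1r subrr mulr0.
Qed.

Lemma plane_through_orthogonal u x :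
  dot u (hpt x) = 0 -> exists a, u = plane_through a x.
Proof.
move=> ux; exists (\row_k u 0 (lift ord0 k)); apply/rowP => i.
case: (unliftP ord0 i) => [k ->|->]; first by rewrite plane_throughS mxE.
move/eqP: ux; rewrite dot_recl hpt0 mulr1 addr_eq0 => /eqP->.
by rewrite plane_through0; congr (- _); apply: eq_bigr => k _; rewrite hptS mxE.
Qed.

Lemma hpt_proportional x v :
  (forall a, dot (plane_through a x) v = 0) -> v = v 0 ord0 *: hpt x.
Proof.
move=> h; apply/rowP => i; rewrite mxE.
case: (unliftP ord0 i) => [k ->|->]; last by rewrite hpt0 mulr1.
have := h (delta_mx 0 k); rewrite dot_plane_through (bigD1 k) //= big1.
  by rewrite mxE !eqxx mul1r addr0 hptS => /eqP; rewrite subr_eq0 => /eqP.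
by move=> l lk; rewrite mxE (negPf lk) andbF mul0r.
Qed.

Lemma polyvec_plane_through E n (c : E -> 'rV[K]_n) (a y : E -> 'rV[K]_3) :
  polyvec c a -> polyvec c y -> polyvec c (fun e => plane_through (a e) (y e)).
Proof.
move=> Ha Hy i; case: (unliftP ord0 i) => [k ->|->].
  by apply: polyf_ext (fun e => esym (plane_throughS _ _ _)) _; apply: Ha.
apply: polyf_ext (fun e => esym (plane_through0 _ _)) _.
by apply/polyfN/polyf_sum => k; apply: polyfM.
Qed.

End AffineChart.

Section Homogenization.
Variable K : closedFieldType.
Implicit Type f : {mpoly K[3]}.

Definition hom_monom (d : nat) (m : 'X_{1..3}) : 'X_{1..4} :=
  [multinom if unlift ord0 i is Some k then m k else (d - mdeg m)%N | i < 4].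

Definition homogenize f : {mpoly K[4]} :=
  \sum_(m <- msupp f) f@_m *: 'X_[hom_monom (msize f) m].

Lemma homogenize_homog f : homogenize f \is (msize f).-homog.
Proof.
rewrite /homogenize big_seq; apply: rpred_sum => m mf.
apply: rpredZ; rewrite dhomogX; apply/eqP.
rewrite /= mdegE big_ord_recl mnmE unlift_none.
under eq_bigr => k _ do rewrite mnmE liftK.
by rewrite -mdegE subnK // ltnW // msize_mdeg_lt.
Qed.

Lemma homogenize_eval f (y0 : K) (y : 'rV[K]_3) :
  (homogenize f).@[(y0 *: hpt y) 0] = y0 ^+ msize f * f.@[y 0].
Proof.
rewrite (dhomog_meval _ _ (homogenize_homog f)); congr (_ * _).
rewrite /homogenize raddf_sum mevalE /=; apply: eq_bigr => m _.
rewrite mevalZ mevalX; congr (_ * _).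
rewrite big_ord_recl hpt0 expr1n mul1r; apply: eq_bigr => k _.
by rewrite hptS mnmE liftK.
Qed.

(* The factor x0 makes the form vanish at infinity. *)
Definition affine_hom f : {mpoly K[4]} := 'X_ord0 * homogenize f.

Lemma affine_hom_homog f : affine_hom f \is (1 + msize f).-homog.
Proof. by apply: dhomogM (homogenize_homog f); rewrite dhomogX /= mdeg1. Qed.

Lemma hpt_decomp (v : 'rV[K]_4) : v 0 ord0 != 0 ->
  v = v 0 ord0 *: hpt (\row_k (v 0 (lift ord0 k) / v 0 ord0)).
Proof.
move=> v0; apply/rowP => i; rewrite mxE.
case: (unliftP ord0 i) => [k ->|->]; last by rewrite hpt0 mulr1.
by rewrite hptS mxE mulrC divfK.
Qed.

Lemma affine_hom_eval_hpt f y : (affine_hom f).@[hpt y 0] = f.@[y 0].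
Proof.
by rewrite mevalM mevalXU hpt0 mul1r -[hpt y]scale1r homogenize_eval expr1n mul1r.
Qed.

Lemma affine_hom_eq0 f (v : 'rV[K]_4) :
  (v 0 ord0 != 0 -> f.@[(\row_k (v 0 (lift ord0 k) / v 0 ord0)) 0] = 0) ->
  (affine_hom f).@[v 0] = 0.
Proof.
move=> h; rewrite mevalM mevalXU; have [->|v0] := eqVneq (v 0 ord0) 0.
  by rewrite mul0r.
have -> : (homogenize f).@[v 0] = 0; last by rewrite mulr0.
move: (h v0); have := hpt_decomp v0; set y := \row_k _ => vE fy.
by rewrite vE homogenize_eval fy mulr0.
Qed.

Lemma affine_hom_vanish (X : 'rV[K]_4 -> Prop) f : proj_closed X ->
  vanishing_ideal (affine_part X) f -> forall v, X v -> (affine_hom f).@[v 0] = 0.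
Proof.
move=> cX fX v Xv; apply: affine_hom_eq0 => v0; apply: fX.
rewrite /affine_part -/(hpt _).
have -> : hpt (\row_k (v 0 (lift ord0 k) / v 0 ord0)) = (v 0 ord0)^-1 *: v.
  by rewrite [X in _ = _ *: X](hpt_decomp v0) scalerA mulVf // scale1r.
by apply: proj_closed_scale; rewrite ?invr_eq0.
Qed.

(** Setting the zeroth variable to 1 gives back [f]; under this substitution the chain rule leaves a
    single term. *)
Lemma affine_hom_gradS f x k :
  ((affine_hom f)^`M(lift ord0 k)).@[hpt x 0] = (f^`M(k)).@[x 0].
Proof.
pose lq : 4.-tuple {mpoly K[3]} :=
  [tuple if unlift ord0 i is Some l then 'X_l else 1 | i < 4].
have lqE (y : 'rV[K]_3) i : (tnth lq i).@[y 0] = hpt y 0 i.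
  rewrite tnth_mktuple; case: unliftP => [l ->|->].
    by rewrite mevalXU hptS.
  by rewrite meval1 hpt0.
have fE : affine_hom f \mPo lq = f.
  apply: mpoly_eval_inj => y; rewrite comp_mpoly_meval (meval_eq _ (lqE y)).
  exact: affine_hom_eval_hpt.
rewrite -[in RHS]fE mderiv_comp (bigD1 (lift ord0 k)) //=.
rewrite [X in _ = (_ + X).@[_]]big1 => [|i].
  rewrite addr0 mevalM comp_mpoly_meval (meval_eq _ (lqE x)) tnth_mktuple liftK.
  rewrite mderivX mnm1E eqxx scale1r (_ : (U_(k) - U_(k))%MM = 0%MM).
    by rewrite mpolyX0 meval1 mulr1.
  by apply/mnmP => j; rewrite mnmBE subnn mnm0E.
rewrite tnth_mktuple; case: (unliftP ord0 i) => [l ->|-> _].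
  rewrite (inj_eq lift_inj) => /negPf lk.
  by rewrite mderivX mnm1E lk scale0r mulr0.
by rewrite -mpolyC1 mderivC mulr0.
Qed.

(** Euler's relation at a zero: the form vanishes on the whole line spanned by [hpt x], and its
    derivative along this line is read at parameter 1. *)
Lemma affine_hom_euler f (x : 'rV[K]_3) : f.@[x 0] = 0 ->
  \sum_l ((affine_hom f)^`M(l)).@[hpt x 0] * hpt x 0 l = 0.
Proof.
move=> fx; pose lq : 4.-tuple {mpoly K[1]} :=
  [tuple (hpt x 0 i)%:MP * 'X_ord0 | i < 4].
have lqE (t : 'rV[K]_1) i : (tnth lq i).@[t 0] = (t 0 0 *: hpt x) 0 i.
  by rewrite tnth_mktuple mevalM mevalC mevalXU [RHS]mxE mulrC.
have f0 : affine_hom f \mPo lq = 0.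
  apply: mpoly_eval_inj => t; rewrite comp_mpoly_meval (meval_eq _ (lqE t)).
  rewrite meval0 (dhomog_meval _ _ (affine_hom_homog f)).
  by rewrite affine_hom_eval_hpt fx mulr0.
have := congr1 (fun p => (p^`M(ord0)).@[(const_mx 1 : 'rV[K]_1) 0]) f0.
rewrite mderiv0 meval0 mderiv_comp raddf_sum /= => e; rewrite -[RHS]e.
apply: eq_bigr => l _; rewrite mevalM comp_mpoly_meval; congr (_ * _).
  by apply: meval_eq => i; rewrite lqE !mxE mul1r.
rewrite tnth_mktuple mderiv_mulC mevalM mevalC mderivX mnm1E eqxx scale1r.
rewrite (_ : (U_(ord0) - U_(ord0))%MM = 0%MM) ?mpolyX0 ?meval1 ?mulr1 //.
by apply/mnmP => j; rewrite mnmBE subnn mnm0E.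
Qed.

End Homogenization.

Section Det3.
Variable R : comNzRingType.
Implicit Types a b c : 'rV[R]_3.

Definition three_rows a b c : 'M[R]_3 := col_mx (col_mx a b) c.

Definition det3 a b c : R := \det (three_rows a b c).

Lemma ord3_forall (P : 'I_3 -> Prop) : P 0 -> P 1 -> P 2%:R -> forall i, P i.
Proof.
move=> P0 P1 P2 [[|[|[|i]]] lt_i] //.
- by rewrite (_ : Ordinal lt_i = 0) //; apply: val_inj.
- by rewrite (_ : Ordinal lt_i = 1) //; apply: val_inj.
- by rewrite (_ : Ordinal lt_i = 2%:R) //; apply: val_inj.
Qed.

Lemma det_mx33E (M : 'M[R]_3) : \det M =
  M 0 0 * (M 1 1 * M 2%:R 2%:R - M 1 2%:R * M 2%:R 1)
  - M 0 1 * (M 1 0 * M 2%:R 2%:R - M 1 2%:R * M 2%:R 0)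
  + M 0 2%:R * (M 1 0 * M 2%:R 1 - M 1 1 * M 2%:R 0).
Proof.
rewrite (expand_det_row _ 0) !big_ord_recl big_ord0 /cofactor.
rewrite !(expand_det_row _ 0) !big_ord_recl !big_ord0 /cofactor !det_mx11 !mxE.
have mE (p q : 'I_3) : M p q = M (inord (val p)) (inord (val q)).
  by rewrite !inord_val.
rewrite !(mE (lift _ _) _) !(mE _ (lift _ _)) !(mE 0 _) !(mE 1 _) !(mE 2%:R _) /=.
rewrite /bump /=.
ring.
Qed.

Lemma three_rowsE a b c :
  [/\ forall k, three_rows a b c 0 k = a 0 k,
      forall k, three_rows a b c 1 k = b 0 k
    & forall k, three_rows a b c 2%:R k = c 0 k].
Proof.
set M := three_rows a b c.
have M0 k : M 0 k = a 0 k.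
  transitivity (M (lshift 1 (lshift 1 (ord0 : 'I_1))) k).
    by congr (M _ _); apply: val_inj.
  by rewrite [LHS]col_mxEu col_mxEu.
have M1 k : M 1 k = b 0 k.
  transitivity (M (lshift 1 (rshift 1 (ord0 : 'I_1))) k).
    by congr (M _ _); apply: val_inj.
  by rewrite [LHS]col_mxEu col_mxEd.
have M2 k : M 2%:R k = c 0 k.
  transitivity (M (rshift 2 (ord0 : 'I_1)) k).
    by congr (M _ _); apply: val_inj.
  by rewrite [LHS]col_mxEd.
by [].
Qed.

Lemma det3E a b c : det3 a b c =
  a 0 0 * (b 0 1 * c 0 2%:R - b 0 2%:R * c 0 1)
  - a 0 1 * (b 0 0 * c 0 2%:R - b 0 2%:R * c 0 0)
  + a 0 2%:R * (b 0 0 * c 0 1 - b 0 1 * c 0 0).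
Proof.
rewrite /det3; have [M0 M1 M2] := three_rowsE a b c.
by rewrite det_mx33E !M0 !M1 !M2.
Qed.
End Det3.

Section Det3Field.
Variable K : fieldType.
Implicit Types a b c : 'rV[K]_3.

Lemma row_free_det3 a b :
  row_free (col_mx a b) <-> exists c, det3 a b c != 0.
Proof.
split=> [rf|[c]]; last first.
  rewrite -unitfE -unitmxE => uM; apply/row_freeP.
  pose V : 'M[K]_(3, (1 + 1) + 1) := invmx (three_rows a b c).
  pose M : 'M[K]_((1 + 1) + 1, 3) := three_rows a b c.
  exists (lsubmx V); have -> : col_mx a b = usubmx M by rewrite col_mxKu.
  rewrite mulmx_lsub mul_usub_mx [M *m V](mulmxV uM).
  have -> : (1%:M : 'M[K]_3) = block_mx (1%:M : 'M_(1 + 1)) 0 0 (1%:M : 'M_1).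
    by rewrite -scalar_mx_block.
  by rewrite -[lsubmx _]/(ulsubmx _) block_mxKul.
have [k Hk] : exists k, ~~ ((delta_mx 0 k : 'rV[K]_3) <= col_mx a b)%MS.
  apply/existsP; rewrite -negb_forall; apply: contraTN isT => /forallP h.
  have : (1%:M <= col_mx a b)%MS by apply/row_subP => k; rewrite row1.
  by move/mxrankS; rewrite mxrank1 (eqP rf).
exists (delta_mx 0 k); rewrite -unitfE -unitmxE -row_free_unit -row_leq_rank.
have lt_ab : (col_mx a b < col_mx a b + (delta_mx 0 k : 'rV[K]_3))%MS.
  by rewrite ltmxE addsmxSl /= addsmx_sub submx_refl.
have := rank_ltmx lt_ab; rewrite (eqP rf).
by rewrite addsmxE.
Qed.

End Det3Field.

Section CurvePoints.
Variables (K : closedFieldType) (X : 'rV[K]_4 -> Prop) (j : nat).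
Variable w : 'rV[K]_(chow_dim j.+1).+1.
Hypotheses (closedX : proj_closed X) (chowX : is_chow_vector X w).
Hypothesis degX : proj_curve_degree X j.+1.
Implicit Types (a b x y : 'rV[K]_3).

Definition on_curve j (w : 'rV[K]_(chow_dim j).+1) y : Prop :=
  forall a b, chow_eval w (plane_through a y) (plane_through b y) = 0.

(* Otherwise the Chow form would be divisible by u . x, hence proportional to
   it, although it has positive degree in v. *)
Lemma chow_eval_generic x :
  exists a (b : 'rV[K]_4), chow_eval w (plane_through a x) b != 0.
Proof.
have [[F0 _ Firr] _] := chowX.
apply: contrapT => none.
have Fzero a (b : 'rV[K]_4) : chow_eval w (plane_through a x) b = 0.
  by apply/eqP; apply: contraT => nz; case: none; exists a, b.
pose ell : {mpoly K[4 + 4]} :=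
  \sum_(k < 4) (hpt x 0 k)%:MP * 'X_(lshift 4 k).
have ellE (u v : 'rV[K]_4) : ell.@[row_mx u v 0] = dot u (hpt x).
  rewrite raddf_sum; apply: eq_bigr => k _ /=.
  by rewrite mevalM mevalC mevalXU row_mxEl mulrC.
pose i0 : 'I_(4 + 4) := lshift 4 ord0.
(* As [hpt x] has zeroth coordinate 1, correcting that coordinate of [u] projects it to a plane
   through the point, where the form vanishes by assumption. Only the term [i0] of the divided
   difference between [u] and its projection survives, and it is a multiple of [ell]. *)
pose z' (u v : 'rV[K]_4) := row_mx (u - dot u (hpt x) *: delta_mx 0 ord0) v.
have [D [DE _]] := divided_difference_eval (chow_form w).
have subE (u : 'rV[K]_4) (a : K) l :
    (u - a *: delta_mx 0 ord0) 0 l = u 0 l - a * (l == ord0)%:R.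
  by rewrite !mxE eqxx.
pose q := D i0 \mPo [tuple match fintype.split i with
    | inl k => 'X_k
    | inr k => if k == i0 then 'X_k - ell else 'X_k end | i < 4 + 4 + (4 + 4)].
have qE u v : q.@[row_mx u v 0] = (D i0).@[row_mx (row_mx u v) (z' u v) 0].
  rewrite comp_mpoly_meval; apply: meval_eq => i; rewrite tnth_mktuple.
  case: (split_ordP i) => k ->; rewrite ?row_mxEl ?row_mxEr.
    by rewrite mevalXU.
  rewrite /z'; case: (split_ordP k) => l ->.
    rewrite [RHS]row_mxEl subE (inj_eq (@lshift_inj _ _)).
    have [->|_] := eqVneq l ord0.
      by rewrite mevalB mevalXU ellE row_mxEl mulr1.
    by rewrite mulr0 subr0 mevalXU row_mxEl.
  rewrite [RHS]row_mxEr (_ : _ == i0 = false); last by rewrite -val_eqE.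
  by rewrite mevalXU row_mxEr.
have Fdvd : chow_form w = q * ell.
  apply: mpoly_eval_inj => z; rewrite -[z]hsubmxK mevalM.
  move: (lsubmx z) (rsubmx z) => u v; rewrite qE ellE.
  have [a Ha] : exists a, u - dot u (hpt x) *: delta_mx 0 ord0 = plane_through a x.
    apply: plane_through_orthogonal.
    by rewrite dotDl -scaleNr dotZl dot_delta hpt0 mulr1 subrr.
  have F0z : (chow_form w).@[z' u v 0] = 0 by rewrite /z' Ha; apply: Fzero.
  rewrite -[LHS]subr0 -[X in _ - X]F0z DE (bigD1 i0) //= big1 => [|k ki0].
    rewrite addr0 row_mxEl /z' row_mxEl subE eqxx mulr1.
    by rewrite subKr.
  rewrite /z'; case: (split_ordP k) ki0 => l ->; last by rewrite !row_mxEr subrr mulr0.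
  rewrite (inj_eq (@lshift_inj _ _)) => /negPf li0.
  by rewrite !row_mxEl subE li0 mulr0 subr0 subrr mulr0.
have ell1 : ell.@[row_mx (delta_mx 0 ord0 : 'rV[K]_4) (0 : 'rV[K]_4) 0] = 1.
  by rewrite ellE dot_delta hpt0.
have unit_const (p : {mpoly K[4 + 4]}) : p \is a GRing.unit ->
    exists2 c, c != 0 & p = c%:MP.
  by case/andP => /eqP-> ; rewrite mpolyCK unitfE => c0; exists p@_0%MM.
(* A constant cofactor [q] is refuted at [v = 0], where the form vanishes by its positive degree in
   [v]; a constant [ell] is refuted at [u = 0]. *)
case: (Firr _ _ Fdvd) => /unit_const[c c0 E].
  have := chow_evalZr w 0 (delta_mx 0 ord0) 0; rewrite expr0n /= mul0r scale0r.
  rewrite /chow_eval Fdvd mevalM ell1 mulr1 E mevalC => cc.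
  by rewrite cc eqxx in c0.
have : ell.@[row_mx (0 : 'rV[K]_4) (0 : 'rV[K]_4) 0] = 1 by rewrite -ell1 E !mevalC.
rewrite ellE /dot big1 => [/esym/eqP|k _]; last by rewrite mxE mul0r.
by rewrite oner_eq0.
Qed.

(** Take a plane through [x] whose Chow form is not identically zero. If none of its limit section
    points were [x], a generic plane [b'] through [x] would miss them all, and the factorization
    would give a nonzero value at two planes through [x]. *)
Lemma on_curveP x : on_curve w x <-> X (hpt x).
Proof.
split=> [xw|Xx a b]; last first.
  by apply/chowX.2; exists (hpt x); rewrite !dot_plane_through_hpt.
have [a [b ab0]] := chow_eval_generic x.
have [p [Hp pE _]] := plane_section_specialization closedX chowX degX ab0 (oner_neq0 K).
have [i Hi] : exists i, forall b', dot (plane_through b' x) (p i) = 0.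
  apply: contrapT => none.
  have [||b' Hb'] := @polyf_generic_prod K 'rV_3 3 id (@id_surj K 3) _ xpredT
      (fun i b' => dot (plane_through b' x) (p i)).
  - move=> i; apply: polyf_dot; last by move=> k; apply: polyf_const.
    apply: polyvec_plane_through; first exact: polyf_coord.
    by move=> k; apply: polyf_const.
  - move=> i _; apply: contrapT => none'; apply: none; exists i => b'.
    by apply/eqP; apply: contraT => nz; case: none'; exists b'.
  have /eqP := pE (plane_through b' x).
  rewrite xw mulr0 eq_sym mulf_eq0 (negPf ab0) /= => /prodf_eq0[i _].
  by rewrite (negPf (Hb' i isT)).
have pi := hpt_proportional Hi; have [Xpi _ bpi] := Hp i.
have pi0 : p i 0 ord0 != 0.
  by apply: contra_eq_neq bpi => pi0; rewrite pi pi0 scale0r dot0r eq_sym oner_neq0.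
rewrite -[hpt x]scale1r -(mulVf pi0) -scalerA -pi.
by apply: proj_closed_scale; rewrite ?invr_eq0.
Qed.

End CurvePoints.

(** * Cylinders over the curve *)

Section ChowCone.
Variables (K : closedFieldType) (j : nat) (w : 'rV[K]_(chow_dim j).+1).
Implicit Types (a b x y : 'rV[K]_3).

Definition plane_poly a (i : 'I_4) : {mpoly K[3]} :=
  if unlift ord0 i is Some k then (a 0 k)%:MP
  else - \sum_k (a 0 k)%:MP * 'X_k.

Lemma plane_poly_eval a i y : (plane_poly a i).@[y 0] = plane_through a y 0 i.
Proof.
rewrite /plane_poly; case: unliftP => [k ->|->].
  by rewrite mevalC plane_throughS.
rewrite mevalN plane_through0 /=; congr (- _); rewrite raddf_sum /=.
by apply: eq_bigr => k _; rewrite mevalM mevalC mevalXU.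
Qed.

Definition chow_cone_tuple a b : (4 + 4).-tuple {mpoly K[3]} :=
  [tuple pair_fun (plane_poly a) (plane_poly b) i | i < 4 + 4].

(* The cylinder over the curve in the direction orthogonal to a and b. *)
Definition chow_cone a b : {mpoly K[3]} := chow_form w \mPo chow_cone_tuple a b.

Lemma chow_cone_tuple_eval a b y i : (tnth (chow_cone_tuple a b) i).@[y 0]
  = row_mx (plane_through a y) (plane_through b y) 0 i.
Proof.
rewrite tnth_mktuple; case: (split_ordP i) => k ->.
  by rewrite pair_funl row_mxEl plane_poly_eval.
by rewrite pair_funr row_mxEr plane_poly_eval.
Qed.

Lemma chow_cone_eval a b y :
  (chow_cone a b).@[y 0] = chow_eval w (plane_through a y) (plane_through b y).
Proof.
by rewrite comp_mpoly_meval; apply: meval_eq => i; rewrite chow_cone_tuple_eval.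
Qed.

Lemma plane_poly_deriv a i k :
  (plane_poly a i)^`M(k) = if i == ord0 then - (a 0 k)%:MP else 0.
Proof.
rewrite /plane_poly; case: unliftP => [l ->|->]; first by rewrite mderivC.
rewrite eqxx mderivN; congr (- _); rewrite raddf_sum /= (bigD1 k) //=.
rewrite big1 => [|l lk].
  rewrite addr0 mderiv_mulC mderivX mnm1E eqxx scale1r.
  rewrite (_ : (U_(k) - U_(k))%MM = 0%MM) ?mpolyX0 ?mulr1 //.
  by apply/mnmP => i'; rewrite mnmBE subnn mnm0E.
by rewrite mderiv_mulC mderivX mnm1E (negPf lk) scale0r mulr0.
Qed.

(** Only the zeroth coordinate of [plane_through a y] moves with [y], with gradient [- a], so only
    two partial derivatives of the form remain. *)
Lemma chow_cone_gradient a b x (z := row_mx (plane_through a x) (plane_through b x)) :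
  gradient (chow_cone a b) x =
  - ((chow_form w)^`M(lshift 4 ord0)).@[z 0] *: a
  - ((chow_form w)^`M(rshift 4 ord0)).@[z 0] *: b.
Proof.
apply/rowP => i; rewrite !mxE mderiv_comp raddf_sum big_split_ord /=.
have cz p : (p \mPo chow_cone_tuple a b).@[x 0] = p.@[z 0].
  rewrite comp_mpoly_meval; apply: meval_eq => l.
  by rewrite chow_cone_tuple_eval.
congr (_ + _); rewrite (bigD1 ord0) //= big1 ?addr0 => [|l l0].
- rewrite mevalM cz tnth_mktuple pair_funl plane_poly_deriv eqxx mevalN mevalC.
  by rewrite mulrN mulNr.
- rewrite tnth_mktuple pair_funl plane_poly_deriv (negPf l0).
  by rewrite mulr0 meval0.
- rewrite mevalM cz tnth_mktuple pair_funr plane_poly_deriv eqxx mevalN mevalC.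
  by rewrite mulrN.
- rewrite tnth_mktuple pair_funr plane_poly_deriv (negPf l0).
  by rewrite mulr0 meval0.
Qed.

End ChowCone.

(** * Transversal plane sections at regular points *)

Section RegularPoints.
Variables (K : closedFieldType) (X : 'rV[K]_4 -> Prop) (j : nat).
Variable w : 'rV[K]_(chow_dim j.+1).+1.
Hypotheses (closedX : proj_closed X) (chowX : is_chow_vector X w).
Hypothesis degX : proj_curve_degree X j.+1.
Implicit Types (a b x y : 'rV[K]_3).

Lemma chow_cone_vanish a b : vanishing_ideal (affine_part X) (chow_cone w a b).
Proof.
by move=> x Xx; rewrite chow_cone_eval; apply: (iffRL (on_curveP closedX chowX degX x)).
Qed.

Lemma det3_mul_eq0 a b c x : det3 a b c != 0 ->
  (forall u, u \in [:: a; b; c] -> \sum_k u 0 k * x 0 k = 0) -> x = 0.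
Proof.
rewrite -unitfE -unitmxE => uM h.
suff Mx : three_rows a b c *m x^T = 0.
  by rewrite -[x]trmxK -[x^T](mulKmx uM) Mx mulmx0 trmx0.
apply/matrixP => i k; rewrite [RHS]mxE (ord1 k) {k} mxE.
under eq_bigr => l _ do rewrite [x^T _ _]mxE.
have [M0 M1 M2] := three_rowsE a b c.
elim/ord3_forall: i.
- under eq_bigr => l _ do rewrite M0; apply: h; rewrite !inE eqxx //.
- under eq_bigr => l _ do rewrite M1; apply: h; rewrite !inE eqxx ?orbT //.
- under eq_bigr => l _ do rewrite M2; apply: h; rewrite !inE eqxx ?orbT //.
Qed.

(** Rules out that two section points collide at [x]. Euler's relation reduces a kernel vector [d]
    to its affine direction [e]; transversality gives [e = 0], so [d] is a multiple of [hpt x], and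
    [dot v (hpt x) != 0] makes it zero. *)
Lemma det_four_rows_neq0 (f1 f2 : {mpoly K[3]}) a (v : 'rV[K]_4) x :
  f1.@[x 0] = 0 -> f2.@[x 0] = 0 ->
  det3 (gradient f1 x) (gradient f2 x) a != 0 -> dot v (hpt x) != 0 ->
  \det (four_rows (\row_l ((affine_hom f1)^`M(l)).@[hpt x 0])
    (\row_l ((affine_hom f2)^`M(l)).@[hpt x 0]) (plane_through a x) v) != 0.
Proof.
move=> f1x f2x d3 vx; set g1 := \row_l _; set g2 := \row_l _.
apply/negP; rewrite -det_tr => /det0P[d d0 dM].
have Md : four_rows g1 g2 (plane_through a x) v *m d^T = 0.
  by rewrite -[four_rows _ _ _ _]trmxK -trmx_mul dM trmx0.
have dots i : dot (row i (four_rows g1 g2 (plane_through a x) v)) d = 0.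
  have := congr1 (fun A : 'cV_4 => A i 0) Md; rewrite /= !mxE => <-.
  by apply: eq_bigr => l _; rewrite !mxE.
have rowsE i : row i (four_rows g1 g2 (plane_through a x) v) =
    if i == 0 then g1 else if i == 1 then g2
    else if i == 2%:R then plane_through a x else v.
  by apply/rowP => l; rewrite !mxE.
have := dots 0; have := dots 1; have := dots 2%:R; have := dots 3%:R.
rewrite !rowsE /=.
pose e : 'rV[K]_3 := \row_k (d 0 (lift ord0 k) - d 0 ord0 * x 0 k).
have grad_dot f : f.@[x 0] = 0 ->
    dot (\row_l ((affine_hom f)^`M(l)).@[hpt x 0]) d
    = \sum_k gradient f x 0 k * e 0 k.
  move=> fx.
  have := affine_hom_euler fx; rewrite big_ord_recl hpt0 mulr1.
  move/eqP; rewrite addr_eq0 => /eqP eu.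
  rewrite dot_recl mxE eu mulNr mulr_suml -sumrN -big_split /=.
  apply: eq_bigr => k _; rewrite hptS !mxE affine_hom_gradS mulrBr.
  by rewrite addrC -mulrA (mulrC (x 0 k)).
rewrite (grad_dot f1) // (grad_dot f2) // dot_plane_through => dv da d2 d1.
have e0 : e = 0.
  apply: (det3_mul_eq0 d3) => u; rewrite !inE => /or3P[] /eqP-> //.
  by rewrite -[RHS]da; apply: eq_bigr => k _; rewrite [e 0 k]mxE.
have dE : d = d 0 ord0 *: hpt x.
  apply/rowP => i; rewrite mxE; case: (unliftP ord0 i) => [k ->|->].
    rewrite hptS; apply/eqP; rewrite -subr_eq0.
    by have /rowP/(_ k) := e0; rewrite !mxE => ->.
  by rewrite hpt0 mulr1.
move/eqP: dv; rewrite dE dotZr mulf_eq0 (negPf vx) orbF => /eqP d00.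
by rewrite dE d00 scale0r eqxx in d0.
Qed.

Lemma add_scale_deltaE n (u : 'rV[K]_n) s k l :
  (u + s *: delta_mx 0 k) 0 l = u 0 l + s * (l == k)%:R.
Proof. by rewrite !mxE eqxx. Qed.

Lemma det3_polyf E n (c : E -> 'rV[K]_n) (u v z : E -> 'rV[K]_3) :
  polyvec c u -> polyvec c v -> polyvec c z ->
  polyf c (fun e => det3 (u e) (v e) (z e)).
Proof.
move=> Hu Hv Hz; apply: polyf_ext (fun e => esym (det3E _ _ _)) _.
by apply: polyfD; [apply: polyfB|]; apply: polyfM => //; apply: polyfB;
  apply: polyfM.
Qed.

(* A line through x in the plane u0 that misses the other points of the plane
   section meets the curve with multiplicity one in the sense of the Chow
   form: by transversality only one factor of the form vanishes there. *)
Lemma chow_form_deriv_neq0 (f1 f2 : {mpoly K[3]}) x :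
  X (hpt x) -> vanishing_ideal (affine_part X) f1 ->
  vanishing_ideal (affine_part X) f2 ->
  row_free (col_mx (gradient f1 x) (gradient f2 x)) ->
  exists a (g : 'rV[K]_3 -> K),
  [/\ a != 0, polyf id g, exists b, g b != 0
    & forall b, g b != 0 -> ((chow_form w)^`M(rshift 4 ord0)).@[
        row_mx (plane_through a x) (plane_through b x) 0] != 0].
Proof.
move=> Xx f1X f2X /row_free_det3[n0 Hn0].
have f1x := f1X x Xx; have f2x := f2X x Xx.
have Ssurj := @cext_surj K 'rV_3 3 id 4 (@id_surj K 3).
have pfst : polyvec (@cext K 'rV_3 3 id 4) (fun e => e.1).
  exact: (@polyvec_fst K 'rV_3 3 id 4 3 id (@polyf_coord K 'rV_3 3 id)).
have psnd : polyvec (@cext K 'rV_3 3 id 4) (fun e => e.2) .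
  exact: polyvec_snd.
have pcst m (z : 'rV[K]_m) : polyvec (@cext K 'rV_3 3 id 4) (fun _ => z).
  by move=> i; apply: polyf_const.
have [a [v [av0 da vx]]] : exists a (v : 'rV[K]_4),
   [/\ chow_eval w (plane_through a x) v != 0,
       det3 (gradient f1 x) (gradient f2 x) a != 0 & dot v (hpt x) != 0].
  have P1 : polyf (@cext K 'rV_3 3 id 4)
      (fun e => chow_eval w (plane_through e.1 x) e.2).
    by apply: polyf_chow_eval => //; apply: polyvec_plane_through.
  have P2 : polyf (@cext K 'rV_3 3 id 4)
      (fun e => det3 (gradient f1 x) (gradient f2 x) e.1) by apply: det3_polyf.
  have P3 : polyf (@cext K 'rV_3 3 id 4) (fun e => dot e.2 (hpt x)).
    exact: polyf_dot.
  have [a0 [b0 ab0]] := chow_eval_generic chowX x.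
  have [||e [e23 e1]] := polyf_generic Ssurj (polyfM P2 P3) P1.
  - by exists (n0, delta_mx 0 ord0); rewrite /= dot_delta hpt0 mulr1.
  - by exists (a0, b0).
  by move: e23; rewrite mulf_eq0 => /norP[e2 e3]; exists e.1, e.2.
have [p [Hp pE p_eq]] := plane_section_specialization closedX chowX degX av0 vx.
have p_x i : (forall b, dot (plane_through b x) (p i) = 0) -> p i = hpt x.
  move=> /hpt_proportional pi; have [_ _ vpi] := Hp i.
  suff c1 : p i 0 ord0 = 1 by rewrite pi c1 scale1r.
  by apply: (mulIf vx); rewrite mul1r -dotZr -pi.
have pf_b i : polyf id (fun b => dot (plane_through b x) (p i)).
  apply: polyf_dot; last by move=> k; apply: polyf_const.
  apply: polyvec_plane_through; first exact: polyf_coord.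
  by move=> k; apply: polyf_const.
have nz_or i : p i = hpt x \/ exists b, dot (plane_through b x) (p i) != 0.
  have [h|h] := pselect (exists b, dot (plane_through b x) (p i) != 0); first by right.
  by left; apply: p_x => b; apply/eqP; apply: contraT => nz; case: h; exists b.
have [i pi] : exists i, p i = hpt x.
  apply: contrapT => none.
  have [i _|b Hb] := polyf_generic_prod (@id_surj K 3) (P := xpredT) pf_b.
    by case: (nz_or i) => // e; case: none; exists i.
  have /eqP := pE (plane_through b x).
  rewrite (iffRL (on_curveP closedX chowX degX x)) // mulr0 eq_sym mulf_eq0.
  rewrite (negPf av0) /= => /prodf_eq0[i _].
  by rewrite (negPf (Hb i isT)).
(* A second limit point at [hpt x] would make the determinant of the four rows vanish, against
   transversality. *)
have pk k : k != i -> exists b, dot (plane_through b x) (p k) != 0.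
  move=> ki; case: (nz_or k) => // pkx.
  have /eqP := p_eq k i ki (etrans pkx (esym pi)) _ _
    (affine_hom_vanish closedX f1X) (affine_hom_vanish closedX f2X).
  by rewrite pkx (negPf (det_four_rows_neq0 _ _ da vx)).
pose g b := \prod_(k | k != i) dot (plane_through b x) (p k).
exists a, g; split.
- apply: contraNneq da => ->; rewrite det3E !mxE; apply/eqP; ring.
- exact: polyf_prod.
- have [b Hb] := polyf_generic_prod (@id_surj K 3) pf_b pk.
  by exists b; apply/prodf_neq0.
move=> b gb0.
have [D [DE D0]] := divided_difference_eval (chow_form w).
pose u0 := plane_through a x; pose vb := plane_through b x.
pose line (t : 'rV[K]_1) := vb + t 0 0 *: delta_mx 0 ord0.
pose Dt (t : 'rV[K]_1) :=
  (D (rshift 4 ord0)).@[row_mx (row_mx u0 (line t)) (row_mx u0 vb) 0].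
have pline : polyvec id line.
  move=> k; apply: (@polyf_ext _ _ _ _ (fun t : 'rV[K]_1 => vb 0 k + t 0 0 * (k == ord0)%:R)).
    by move=> t; rewrite add_scale_deltaE.
  apply: polyfD; first exact: polyf_const.
  by apply: polyfM; [apply: polyf_coord | apply: polyf_const].
(* Along [line] the form is [t] times [Dt], and the factor belonging to [p i] is [t] itself.
   Cancelling [t] where it is nonzero and using density reaches [t = 0], where [Dt] is the wanted
   partial derivative. *)
have key t : dot v (hpt x) ^+ j.+1 * Dt t
    = chow_eval w u0 v * \prod_(k | k != i) dot (line t) (p k).
  move: t; apply: (@polyf_eq K 'rV_1 1 id (@id_surj K 1) _ _ (fun t => t 0 0)).
  - apply: polyfM; first exact: polyf_const.
    apply: polyf_meval => l; case: (split_ordP l) => l' ->; last first.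
      by apply: polyf_ext (fun e => esym (row_mxEr _ _ _ _)) _; apply: polyf_const.
    apply: polyf_ext (fun e => esym (row_mxEl _ _ _ _)) _.
    case: (split_ordP l') => k ->.
      by apply: polyf_ext (fun e => esym (row_mxEl _ _ _ _)) _; apply: polyf_const.
    by apply: polyf_ext (fun e => esym (row_mxEr _ _ _ _)) _; apply: pline.
  - apply: polyfM; first exact: polyf_const.
    by apply: polyf_prod => k; apply: polyf_dot => // l; apply: polyf_const.
  - exact: polyf_coord.
  - by exists (const_mx 1); rewrite mxE oner_neq0.
  move=> t t0; apply: (mulIf t0); rewrite -mulrA.
  have DtE : Dt t * t 0 0 = chow_eval w u0 (line t).
    rewrite -[RHS]subr0 -[X in _ - X](iffRL (on_curveP closedX chowX degX x) Xx a b).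
    rewrite /chow_eval DE (bigD1 (rshift 4 ord0)) //= big1 => [|l].
      rewrite addr0 /Dt; congr (_ * _); rewrite !row_mxEr.
      by rewrite add_scale_deltaE eqxx mulr1 addrC addKr.
    case: (split_ordP l) => k -> kl; first by rewrite !row_mxEl subrr mulr0.
    rewrite !row_mxEr add_scale_deltaE.
    move: kl; rewrite (inj_eq (@rshift_inj _ _)) => /negPf->.
    by rewrite mulr0 addr0 subrr mulr0.
  rewrite DtE pE (bigD1 i) //= [RHS]mulrAC -mulrA; congr (_ * _).
  by rewrite pi dotDl dotZl dot_delta hpt0 dot_plane_through_hpt add0r mulr1.
have := key 0; rewrite /Dt (_ : line 0 = vb); last first.
  by rewrite /line mxE scale0r addr0.
rewrite D0 => e; apply: contraNneq gb0 => F0.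
move/eqP: e; rewrite F0 mulr0 eq_sym mulf_eq0 (negPf av0) /=.
exact.
Qed.

(** Both cones share the normal [a], so the determinant of their gradients with [a] loses its [a]
    components and equals [det3 a b b'] times two partial derivatives; all three factors are nonzero
    for generic [b] and [b']. *)
Lemma regular_chow_cones (f1 f2 : {mpoly K[3]}) x :
  X (hpt x) -> vanishing_ideal (affine_part X) f1 ->
  vanishing_ideal (affine_part X) f2 ->
  row_free (col_mx (gradient f1 x) (gradient f2 x)) ->
  exists a b b', row_free (col_mx (gradient (chow_cone w a b) x)
                                  (gradient (chow_cone w a b') x)).
Proof.
move=> Xx f1X f2X rf.
have [a [g [a0 pg [b0 gb0] Hg]]] := chow_form_deriv_neq0 Xx f1X f2X rf.
have [e [n0 aen]] : exists e n0, det3 a e n0 != 0.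
  have /rV0Pn[k] := a0; elim/ord3_forall: k => ak.
  - exists (delta_mx 0 1), (delta_mx 0 2%:R).
    by rewrite (_ : det3 _ _ _ = a 0 0) // det3E !mxE /=; ring.
  - exists (delta_mx 0 2%:R), (delta_mx 0 0).
    by rewrite (_ : det3 _ _ _ = a 0 1) // det3E !mxE /=; ring.
  - exists (delta_mx 0 0), (delta_mx 0 1).
    by rewrite (_ : det3 _ _ _ = a 0 2%:R) // det3E !mxE /=; ring.
have pcst (z : 'rV[K]_3) : polyvec id (fun _ : 'rV[K]_3 => z).
  by move=> i; apply: polyf_const.
have pid : polyvec id (fun z : 'rV[K]_3 => z) by apply: polyf_coord.
have [||b [gb ab]] := polyf_generic (@id_surj K 3) pg
   (det3_polyf (pcst a) pid (pcst n0)).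
- by exists b0.
- by exists e.
have [||b' [gb' abb]] := polyf_generic (@id_surj K 3) pg
   (det3_polyf (pcst a) (pcst b) pid).
- by exists b0.
- by exists n0.
exists a, b, b'; apply/row_free_det3; exists a.
have := Hg b gb; have := Hg b' gb'; rewrite !chow_cone_gradient.
set u := _.@[_]; set u' := _.@[_]; set s := _.@[_]; set s' := _.@[_].
move=> u0 s0.
have -> : det3 (- s *: a - u' *: b) (- s' *: a - u *: b') a
   = u * u' * det3 a b b'.
  rewrite !det3E !mxE; ring.
by rewrite !mulf_neq0.
Qed.

End RegularPoints.

(** * Local ideals and tangency *)

Section OrderIdeal.
Variables (K : fieldType) (x : 'rV[K]_3).
Implicit Types p q : {mpoly K[3]}.

Definition shift p : {mpoly K[3]} :=
  p \mPo [tuple 'X_i + (x 0 i)%:MP | i < 3].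

Lemma mcoeff0_meval n (p : {mpoly K[n]}) : p@_0%MM = p.@[fun=> 0].
Proof.
elim/mpoly_ring_ind: p => [a|i|p q IHp IHq|p q IHp IHq].
- by rewrite mevalC mcoeffC eqxx mulr1.
- by rewrite mevalXU mcoeffX mnm1_eq0.
- by rewrite mcoeffD mevalD IHp IHq.
- by rewrite mevalM -IHp -IHq rmorphM.
Qed.

Lemma shift_mcoeff0 p : (shift p)@_0%MM = p.@[x 0].
Proof.
rewrite mcoeff0_meval comp_mpoly_meval; apply: meval_eq => i.
by rewrite tnth_mktuple mevalD mevalXU mevalC add0r.
Qed.

Lemma order_ideal_vanish p : p.@[x 0] = 0 <-> order_ideal x 1 p.
Proof.
split=> [px m|/(_ 0%MM)]; last by rewrite mdeg0 -/(shift p) shift_mcoeff0; apply.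
by rewrite ltnS leqn0 mdeg_eq0 => /eqP->; rewrite -/(shift p) shift_mcoeff0.
Qed.

Lemma order_idealD s p q :
  order_ideal x s p -> order_ideal x s q -> order_ideal x s (p + q).
Proof.
by move=> op oq m ms; rewrite comp_mpolyD mcoeffD op ?oq ?addr0.
Qed.

Lemma order_idealM s t p q :
  order_ideal x s p -> order_ideal x t q -> order_ideal x (s + t) (p * q).
Proof.
move=> op oq m ms; rewrite rmorphM /= mcoeffM big1 // => k /eqP mk.
have [/op->|sk] := ltnP (mdeg k.1) s; first by rewrite mul0r.
have e := congr1 (@mdeg 3) mk; rewrite mdegD in e.
rewrite (oq k.2) ?mulr0 // -(ltn_add2l s) (leq_ltn_trans _ ms) //.
by apply: leq_trans (leq_add sk (leqnn _)) _; rewrite -e.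
Qed.

Lemma order_ideal0 p : order_ideal x 0 p.
Proof. by []. Qed.

Lemma order_idealMl s p q : order_ideal x s q -> order_ideal x s (p * q).
Proof. exact: (@order_idealM 0 s p q (@order_ideal0 p)). Qed.

Lemma order_idealX s p k : order_ideal x s p -> order_ideal x (s * k) (p ^+ k).
Proof.
move=> op; elim: k => [|k IHk]; first by rewrite muln0.
by rewrite mulnS exprS; apply: order_idealM.
Qed.

Lemma order_ideal_zero s : order_ideal x s 0.
Proof. by move=> m _; rewrite comp_mpoly0 mcoeff0. Qed.

End OrderIdeal.

Section LocalIdeal.
Variables (K : fieldType) (x : 'rV[K]_3) (I : {mpoly K[3]} -> Prop).
Hypothesis idI : is_ideal I.

Lemma local_ideal_clear phi : local_ideal I x phi ->
  exists q g, [/\ q.@[x 0] != 0, I g & tofrac q * phi = tofrac g].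
Proof.
have [I0 ID IM] := idI.
case=> n [a [g [la Ig ->]]]; elim: n a g la Ig => [|n IHn] a g la Ig.
  by exists 1, 0; rewrite big_ord0 meval1 oner_neq0 mulr0 rmorph0.
rewrite big_ord_recl.
have [q [h [q0 Ih qh]]] := IHn (fun i => a (lift ord0 i)) (fun i => g (lift ord0 i))
  (fun i => la _) (fun i => Ig _).
have [p [q' [q'0 aE]]] := la ord0.
exists (q * q'), (q * p * g ord0 + q' * h); split.
- by rewrite mevalM mulf_neq0.
- by apply: ID; apply: IM.
have q'f : tofrac q' != 0 :> {fraction {mpoly K[3]}}.
  by rewrite tofrac_eq0; apply: contraNneq q'0 => ->; rewrite meval0.
rewrite mulrDr !rmorphD !rmorphM /= -qh aE; congr (_ + _).
  rewrite -!mulrA; congr (_ * _).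
  by rewrite mulrCA [_ * (_ * tofrac (g _))]mulrA mulfV // mul1r.
by rewrite mulrA (mulrC (tofrac q)).
Qed.

Lemma local_ideal_div q g : q.@[x 0] != 0 -> I g ->
  local_ideal I x (tofrac g / tofrac q).
Proof.
move=> q0 Ig; exists 1%N, (fun=> tofrac 1 / tofrac q), (fun=> g); split=> //.
  by move=> _; exists 1, q.
by rewrite big_ord1 rmorph1 mul1r mulrC.
Qed.

End LocalIdeal.

(** A common denominator trades the local ring for polynomials; localization survives only as the
    multiplier [q] with nonzero value at [x]. *)
Lemma tangentP (K : fieldType) (gamma : 'rV[K]_3 -> Prop) r T x :
  tangent_to_order r gamma T x <->
  exists q g, [/\ q.@[x 0] != 0, vanishing_ideal gamma g
                & order_ideal x r.+1 (q * T - g)].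
Proof.
have idI : is_ideal (vanishing_ideal gamma).
  split=> [y _|a b a0 b0 y gy|a b b0 y gy]; first by rewrite meval0.
    by rewrite mevalD a0 ?b0 ?addr0.
  by rewrite mevalM b0 ?mulr0.
have idO : is_ideal (order_ideal x r.+1).
  split=> [|a b|a b]; [exact: order_ideal_zero|exact: order_idealD|exact: order_idealMl].
split=> [[phi1 [phi2 [l1 l2 E]]]|[q [g [q0 gI go]]]].
  have [q1 [g [q10 Ig E1]]] := local_ideal_clear idI l1.
  have [q2 [h [q20 Ih E2]]] := local_ideal_clear idO l2.
  exists (q1 * q2), (q2 * g); split; first by rewrite mevalM mulf_neq0.
    by case: idI => _ _; apply.
  suff -> : q1 * q2 * T - q2 * g = q1 * h by case: idO => _ _; apply.
  apply/eqP; rewrite subr_eq -tofrac_eq; apply/eqP.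
  rewrite rmorphD !rmorphM /= -E1 -E2 E; ring.
exists (tofrac g / tofrac q), (tofrac (q * T - g) / tofrac q).
split; [exact: local_ideal_div|exact: local_ideal_div|].
have qf : tofrac q != 0 :> {fraction {mpoly K[3]}}.
  by rewrite tofrac_eq0; apply: contraNneq q0 => ->; rewrite meval0.
rewrite -mulrDl -rmorphD /= addrC subrK rmorphM /= mulrC mulKf //.
Qed.

Lemma taylor_first (K : closedFieldType) n (f : {mpoly K[n]}) (x : 'rV[K]_n) :
  exists A : 'I_n -> {mpoly K[n]},
    f - (f.@[x 0])%:MP = \sum_k A k * ('X_k - (x 0 k)%:MP)
    /\ forall k, (A k).@[x 0] = (f^`M(k)).@[x 0].
Proof.
have [D [DE D0]] := divided_difference_eval f.
pose A k : {mpoly K[n]} := D k \mPo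
  [tuple pair_fun (fun l => 'X_l) (fun l => (x 0 l)%:MP) i | i < n + n].
have AE k (y : 'rV[K]_n) : (A k).@[y 0] = (D k).@[row_mx y x 0].
  rewrite comp_mpoly_meval; apply: meval_eq => i; rewrite tnth_mktuple.
  case: (split_ordP i) => l ->; first by rewrite pair_funl mevalXU row_mxEl.
  by rewrite pair_funr mevalC row_mxEr.
exists A; split=> [|k]; last by rewrite AE D0.
apply: mpoly_eval_inj => y; rewrite mevalB mevalC DE raddf_sum /=.
by apply: eq_bigr => k _; rewrite mevalM mevalB mevalXU mevalC AE.
Qed.

Section IrreducibleCurve.
Variables (K : closedFieldType) (X : 'rV[K]_4 -> Prop).
Hypothesis irrX : proj_irreducible X.

(** The forms [affine_hom p] and [affine_hom q] cut out closed sets that together cover [X], its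
    points at infinity included; irreducibility puts [X] inside one of them. *)
Lemma vanishing_ideal_prime p q :
  vanishing_ideal (affine_part X) (p * q) ->
  vanishing_ideal (affine_part X) p \/ vanishing_ideal (affine_part X) q.
Proof.
have [cX _ irr] := irrX => pqX.
pose Y f (v : 'rV[K]_4) := v != 0 /\ zero_locus [:: affine_hom f] v.
have cY f : proj_closed (Y f).
  exists [:: affine_hom f] => // h; rewrite inE => /eqP->.
  by exists (1 + msize f)%N; apply: affine_hom_homog.
have YE f : subset_of X (Y f) -> vanishing_ideal (affine_part X) f.
  move=> XY y Xy; have [_ /(_ _ (mem_head _ _))] := XY _ Xy.
  by rewrite -/(hpt y) affine_hom_eval_hpt.
case: (irr (Y p) (Y q) (cY p) (cY q)) => [v Xv|/YE|/YE]; [|by left|by right].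
have v0 : v != 0 by have [S _ SX] := cX; have /SX[] := Xv.
have : (affine_hom p * affine_hom q).@[v 0] = 0.
  rewrite mevalM; have [v00|v00] := eqVneq (v 0 ord0) 0.
    by rewrite affine_hom_eq0 ?mul0r // v00 eqxx.
  rewrite (hpt_decomp v00).
  rewrite !(dhomog_meval _ _ (affine_hom_homog _)) !affine_hom_eval_hpt.
  set y := \row_k _; rewrite mulrACA -mevalM pqX ?mulr0 //.
  rewrite /affine_part -/(hpt _).
  have -> : hpt y = (v 0 ord0)^-1 *: v.
    by rewrite [X in _ = _ *: X](hpt_decomp v00) scalerA mulVf // scale1r.
  by apply: proj_closed_scale; rewrite ?invr_eq0.
move=> /eqP; rewrite mevalM mulf_eq0 => /orP[] /eqP e; [left|right]; split=> // h.
  by rewrite inE => /eqP->.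
by rewrite inE => /eqP->.
Qed.

Variables (j : nat) (degX : proj_curve_degree X j.+1).

(** Otherwise the plane at infinity and the point [hpt x] cover [X], so by irreducibility [X] is
    that point; but a generic plane misses it while its section has [j.+1] points. *)
Lemma curve_not_point x : X (hpt x) ->
  exists k, ~ vanishing_ideal (affine_part X) ('X_k - (x 0 k)%:MP).
Proof.
have [cX _ irr] := irrX => Xx; apply: contrapT => none.
have van k : vanishing_ideal (affine_part X) ('X_k - (x 0 k)%:MP).
  by apply: contrapT => nk; apply: none; exists k.
pose Y (v : 'rV[K]_4) := v != 0 /\ zero_locus [:: 'X_ord0] v.
pose f k : {mpoly K[4]} := 'X_(lift ord0 k) - x 0 k *: 'X_ord0.
pose Z (v : 'rV[K]_4) := v != 0 /\ zero_locus [seq f k | k <- enum 'I_3] v.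
have cY : proj_closed Y.
  exists [:: 'X_ord0] => // h; rewrite inE => /eqP->.
  by exists 1%N; rewrite dhomogX /= mdeg1.
have cZ : proj_closed Z.
  exists [seq f k | k <- enum 'I_3] => // h /mapP[k _ ->]; exists 1%N.
  by rewrite rpredB ?rpredZ // dhomogX /= mdeg1.
have v0 v : X v -> v != 0 by have [S _ SX] := cX; move=> /SX[].
case: (irr Y Z cY cZ) => [v Xv|XY|XZ].
- have [v00|v00] := eqVneq (v 0 ord0) 0.
    by left; split=> [|h]; [exact: v0 | rewrite inE => /eqP->; rewrite mevalXU].
  right; split=> [|h /mapP[k _ ->]]; first exact: v0.
  have vE := hpt_decomp v00; move: vE; set y := \row_k _ => vE.
  have Xy : affine_part X y.
    rewrite /affine_part -/(hpt _).
    have -> : hpt y = (v 0 ord0)^-1 *: v.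
      by rewrite [X in _ = _ *: X]vE scalerA mulVf // scale1r.
    by apply: proj_closed_scale; rewrite ?invr_eq0.
  have := van k y Xy; rewrite mevalB mevalXU mevalC /y mxE => /eqP.
  rewrite subr_eq0 => /eqP e.
  by rewrite mevalB mevalZ !mevalXU -e divfK // subrr.
- have [_ /(_ _ (mem_head _ _))] := XY _ Xx.
  by rewrite mevalXU hpt0 => /eqP; rewrite oner_eq0.
have [g g0 Hg] := degX.
have [||||u [gu ux]] := @polyf_generic K 'rV_4 4 id (@id_surj K 4) (fun u => g.@[u 0])
  (fun u => dot u (hpt x)).
- by apply: polyf_meval => i; apply: polyf_coord.
- by apply: polyf_dot; [apply: polyf_coord | move=> i; apply: polyf_const].
- exact: mpoly_eval_neq0.
- by exists (delta_mx 0 ord0); rewrite dot_delta hpt0 oner_neq0.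
have [p [Xp _ _]] := Hg u gu; have [Xp0 up0] := Xp ord0.
have [p0 Zp] := XZ _ Xp0; move: Xp0 up0 p0 Zp; move: (p ord0) => q Xq uq q0 Zq.
have qE : q = q 0 ord0 *: hpt x.
  apply/rowP => i; rewrite mxE; case: (unliftP ord0 i) => [k ->|->].
    have := Zq (f k) (map_f f (mem_enum _ k)).
    rewrite mevalB mevalZ !mevalXU hptS => /eqP; rewrite subr_eq0 => /eqP->.
    by rewrite mulrC.
  by rewrite hpt0 mulr1.
move/eqP: uq; rewrite qE dotZr mulf_eq0 (negPf ux) orbF => /eqP q00.
by rewrite qE q00 scale0r eqxx in q0.
Qed.

End IrreducibleCurve.

(* At a regular point the ideal of the curve is locally generated by two
   polynomials, the maximal ideal modulo them is generated by one linear form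
   ell, and no power of ell vanishes on the curve. *)
Section LocalGenerators.
Variables (K : closedFieldType) (X : 'rV[K]_4 -> Prop) (j : nat).
Hypotheses (irrX : proj_irreducible X) (degX : proj_curve_degree X j.+1).
Variables (x : 'rV[K]_3) (f1 f2 : {mpoly K[3]}).
Hypotheses (Xx : X (hpt x)) (f1X : vanishing_ideal (affine_part X) f1).
Hypothesis f2X : vanishing_ideal (affine_part X) f2.
Hypothesis rf : row_free (col_mx (gradient f1 x) (gradient f2 x)).

(** Cramer's rule: [f1], [f2] and a linear form [ell] are expressed through the ['X_k - x_k] by a
    matrix whose determinant is nonzero at [x]; the adjugate expresses each ['X_k - x_k] through
    them. *)
Lemma local_parameter : exists ell : {mpoly K[3]},
  [/\ ell.@[x 0] = 0
    & forall p, p.@[x 0] = 0 -> exists q b c1 c2,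
        q.@[x 0] != 0 /\ q * p = b * ell + c1 * f1 + c2 * f2].
Proof.
have /row_free_det3[n Hn] := rf.
have [A1 [A1E A1x]] := taylor_first f1 x; have [A2 [A2E A2x]] := taylor_first f2 x.
have f1x := f1X Xx; have f2x := f2X Xx.
rewrite f1x mpolyC0 subr0 in A1E; rewrite f2x mpolyC0 subr0 in A2E.
pose Y k : {mpoly K[3]} := 'X_k - (x 0 k)%:MP.
pose M := three_rows (\row_k A1 k) (\row_k A2 k) (\row_k (n 0 k)%:MP).
pose ell : {mpoly K[3]} := \sum_k (n 0 k)%:MP * Y k.
have Yx k : (Y k).@[x 0] = 0 by rewrite mevalB mevalXU mevalC subrr.
exists ell; split=> [|p px].
  by rewrite raddf_sum big1 // => k _ /=; rewrite mevalM Yx mulr0.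
have Mx : (\det M).@[x 0] != 0.
  rewrite -/(det3 _ _ _) (_ : _.@[_] = det3 (gradient f1 x) (gradient f2 x) n) //.
  rewrite !det3E !mxE; rewrite mevalD mevalB !(mevalM, mevalB, mevalC) !A1x !A2x //.
have [M0 M1 M2] := three_rowsE (\row_k A1 k) (\row_k A2 k)
  (\row_k (n 0 k)%:MP : 'rV[{mpoly K[3]}]_3).
have YE k : \det M * Y k =
    (\adj M) k 2%:R * ell + (\adj M) k 0 * f1 + (\adj M) k 1 * f2.
  have := congr1 (fun B : 'M_3 => (B *m \col_l Y l) k 0) (mul_adj_mx M).
  rewrite mul_scalar_mx -mulmxA !mxE => <-.
  have S3 (F : 'I_3 -> {mpoly K[3]}) : \sum_i F i = F 2%:R + F 0 + F 1.
    rewrite !big_ord_recl big_ord0 addr0 -[RHS]addrA [RHS]addrC -[RHS]addrA.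
    by congr (F _ + (F _ + F _)); apply: val_inj.
  rewrite S3 !mxE; congr (_ * _ + _ * _ + _ * _).
  - by rewrite /ell; apply: eq_bigr => l _; rewrite M2 !mxE.
  - by rewrite A1E; apply: eq_bigr => l _; rewrite M0 !mxE.
  - by rewrite A2E; apply: eq_bigr => l _; rewrite M1 !mxE.
have [P [PE _]] := taylor_first p x; rewrite px mpolyC0 subr0 in PE.
exists (\det M), (\sum_k P k * (\adj M) k 2%:R), (\sum_k P k * (\adj M) k 0),
  (\sum_k P k * (\adj M) k 1); split=> //.
rewrite PE mulr_sumr !mulr_suml -!big_split /=; apply: eq_bigr => k _.
by rewrite mulrCA YE !mulrDr !mulrA.
Qed.

(** Induction on the power of [ell]: its coefficient [b] vanishes on the curve, because the ideal is
    prime and contains no power of [ell]; hence [b] vanishes at [x] and yields one more factor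
    [ell]. Approximation to every order is enough for tangency of finite order. *)
Lemma local_generators k g : vanishing_ideal (affine_part X) g ->
  exists q h c1 c2, [/\ q.@[x 0] != 0, order_ideal x k h
    & q * g = h + c1 * f1 + c2 * f2].
Proof.
move=> gX; have [ell [ellx Hell]] := local_parameter.
have ellX : ~ vanishing_ideal (affine_part X) ell.
  move=> ellX; have [l nl] := curve_not_point irrX degX Xx; apply: nl.
  have [|q [b [c1 [c2 [q0 qE]]]]] := Hell ('X_l - (x 0 l)%:MP).
    by rewrite mevalB mevalXU mevalC subrr.
  have : vanishing_ideal (affine_part X) (q * ('X_l - (x 0 l)%:MP)).
    move=> y Xy; rewrite qE !mevalD !mevalM ellX ?f1X ?f2X //.
    by rewrite !mulr0 !addr0.
  by case/(vanishing_ideal_prime irrX) => // /(_ x Xx) /eqP; rewrite (negPf q0).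
have [q [b [c1 [c2 [q0 qE]]]]] : exists q b c1 c2,
    q.@[x 0] != 0 /\ q * g = b * ell ^+ k + c1 * f1 + c2 * f2.
  elim: k => [|k [q [b [c1 [c2 [q0 qE]]]]]].
    exists 1, g, 0, 0; rewrite meval1 oner_neq0 expr0; split=> //.
    by rewrite !mul0r !addr0 mulrC.
  have : vanishing_ideal (affine_part X) (b * ell ^+ k).
    move=> y Xy; rewrite (_ : b * ell ^+ k = q * g - c1 * f1 - c2 * f2).
      by rewrite !mevalB !mevalM gX ?f1X ?f2X // !mulr0 !subr0.
    rewrite qE; ring.
  have elk : ~ vanishing_ideal (affine_part X) (ell ^+ k).
    elim: (k) => [|l IHl]; first by move/(_ x Xx)/eqP; rewrite expr0 meval1 oner_eq0.
    by rewrite exprS => /(vanishing_ideal_prime irrX)[].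
  case/(vanishing_ideal_prime irrX) => // bX.
  have [q' [b' [c1' [c2' [q'0 q'E]]]]] := Hell b (bX x Xx).
  exists (q' * q), b', (c1' * ell ^+ k + q' * c1), (c2' * ell ^+ k + q' * c2).
  rewrite mevalM mulf_neq0 //; split=> //.
  rewrite -mulrA qE !mulrDr mulrA q'E exprS; ring.
exists q, (b * ell ^+ k), c1, c2; split=> //.
apply: order_idealMl.
by have := @order_idealX _ _ _ _ k (iffLR (order_ideal_vanish x ell) ellx); rewrite mul1n.
Qed.

Lemma regular_tangentP r T :
  tangent_to_order r (affine_part X) T x <->
  exists q a1 a2, q.@[x 0] != 0
    /\ order_ideal x r.+1 (q * T - a1 * f1 - a2 * f2).
Proof.
rewrite tangentP; split=> [[q [g [q0 gX go]]]|[q [a1 [a2 [q0 o]]]]]; last first.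
  exists q, (a1 * f1 + a2 * f2); split=> //.
    by move=> y Xy; rewrite mevalD !mevalM f1X ?f2X // !mulr0 addr0.
  by rewrite opprD addrA.
have [q' [h [c1 [c2 [q'0 ho E]]]]] := local_generators r.+1 gX.
exists (q' * q), c1, c2; split; first by rewrite mevalM mulf_neq0.
rewrite (_ : _ - _ = q' * (q * T - g) + h).
  by apply: order_idealD => //; apply: order_idealMl.
rewrite mulrBr E; ring.
Qed.

End LocalGenerators.

(** * Jets and the first-order form of tangency *)

Section Jets.
Variables (K : closedFieldType) (r : nat).
Implicit Types (x : 'rV[K]_3) (p q : {mpoly K[3]}).

Definition eq_upto p q : Prop :=
  forall m : 'X_{1..3}, (mdeg m < r.+1)%N -> p@_m = q@_m.

Lemma eq_uptoM p p' q q' :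
  eq_upto p p' -> eq_upto q q' -> eq_upto (p * q) (p' * q').
Proof.
move=> pp qq m ms; rewrite !mcoeffM; apply: eq_bigr => k /eqP mk.
have e := congr1 (@mdeg 3) mk; rewrite mdegD in e.
have le1 := leq_trans (leq_addr _ _) (eq_leq (esym e)).
have le2 := leq_trans (leq_addl _ _) (eq_leq (esym e)).
by rewrite pp ?qq // (leq_ltn_trans _ ms).
Qed.

Lemma eq_uptoB p p' q q' :
  eq_upto p p' -> eq_upto q q' -> eq_upto (p - q) (p' - q').
Proof. by move=> pp qq m ms; rewrite !mcoeffB pp ?qq. Qed.

Definition jet_dim : nat := #|{: 'X_{1..3 < r.+1}}|.

Definition jet_poly (v : 'rV[K]_jet_dim) : {mpoly K[3]} :=
  \sum_(m : 'X_{1..3 < r.+1}) v 0 (enum_rank m) *: 'X_[m].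

Definition jet p x : 'rV[K]_jet_dim :=
  \row_(i < jet_dim)
    (shift x p)@_(enum_val (i : 'I_#|{: 'X_{1..3 < r.+1}}|)).

Lemma jet_polyE v (m : 'X_{1..3 < r.+1}) : (jet_poly v)@_m = v 0 (enum_rank m).
Proof.
rewrite raddf_sum (bigD1 m) //= big1 => [|m' mm].
  by rewrite mcoeffZ mcoeffX eqxx mulr1 addr0.
by rewrite mcoeffZ mcoeffX -bmeqP (negPf mm) mulr0.
Qed.

Lemma jet_poly_jet p x : eq_upto (jet_poly (jet p x)) (shift x p).
Proof.
move=> m ms; rewrite -[m]/(val (BMultinom ms)) jet_polyE mxE.
by rewrite enum_rankK.
Qed.

Definition unshift x p : {mpoly K[3]} :=
  p \mPo [tuple 'X_i - (x 0 i)%:MP | i < 3].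

Lemma unshiftK x p : shift x (unshift x p) = p.
Proof.
apply: mpoly_eval_inj => y; rewrite !comp_mpoly_meval; apply: meval_eq => i.
rewrite !tnth_mktuple mevalB mevalXU mevalC tnth_mktuple mevalD mevalXU mevalC.
by rewrite addrK.
Qed.

(** Puts gradients in terms of coefficients of the translated polynomial, whose polynomial
    dependence on the parameters is what [polymp] tracks. *)
Lemma gradient_shift p x k : gradient p x 0 k = (shift x p)@_U_(k).
Proof.
have -> : (shift x p)@_U_(k) = ((shift x p)^`M(k))@_0%MM.
  by rewrite mcoeff_deriv mnm0E add0m mulr1n.
rewrite mcoeff0_meval mderiv_comp raddf_sum /= (bigD1 k) //= big1 => [|l lk].
  rewrite mxE addr0 mevalM comp_mpoly_meval tnth_mktuple mderivD mderivC addr0.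
  rewrite mderivX mnm1E eqxx scale1r (_ : (U_(k) - U_(k))%MM = 0%MM); last first.
    by apply/mnmP => j; rewrite mnmBE subnn mnm0E.
  rewrite mpolyX0 meval1 mulr1; apply: meval_eq => i.
  by rewrite tnth_mktuple mevalD mevalXU mevalC add0r.
rewrite mevalM tnth_mktuple mderivD mderivC addr0 mderivX mnm1E (negPf lk).
by rewrite scale0r meval0 mulr0.
Qed.

Definition linear_part p : 'rV[K]_3 := \row_k p@_U_(k).

Lemma linear_part_shift p x : linear_part (shift x p) = gradient p x.
Proof. by apply/rowP => k; rewrite [LHS]mxE gradient_shift. Qed.

Lemma order_ideal_shift x s p : order_ideal x s p <->
  forall m : 'X_{1..3}, (mdeg m < s)%N -> (shift x p)@_m = 0.
Proof. by []. Qed.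

Lemma shiftB x p q : shift x (p - q) = shift x p - shift x q.
Proof. exact: comp_mpolyB. Qed.

Lemma shiftM x p q : shift x (p * q) = shift x p * shift x q.
Proof. exact: rmorphM. Qed.

End Jets.

Section TangencyFormula.
Variables (K : closedFieldType) (r : nat).
Notation N := (jet_dim r).

(* Two cylinders with independent gradients at x generate the ideal of the curve
   locally, so tangency says that q tau = c1 f1 + c2 f2 up to order r for some
   polynomial q invertible at x; n is a third direction that witnesses the
   independence of the gradients. *)
Definition jet_tangent j (w : 'rV[K]_(chow_dim j).+1) (x : 'rV[K]_3)
    (tau : 'rV[K]_N) : Prop :=
  on_curve w x /\
  exists (a b a' b' n : 'rV[K]_3) (q c1 c2 : 'rV[K]_N),
  [/\ det3 (linear_part (shift x (chow_cone w a b)))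
           (linear_part (shift x (chow_cone w a' b'))) n != 0,
      (jet_poly q)@_0%MM != 0
    & forall m : 'X_{1..3 < r.+1},
      (jet_poly q * jet_poly tau
       - jet_poly c1 * shift x (chow_cone w a b)
       - jet_poly c2 * shift x (chow_cone w a' b'))@_m = 0].

Section ConeCoefficients.
Variables (E : Type) (n : nat) (c : E -> 'rV[K]_n).

Lemma polymp_shift_cone j (w : E -> 'rV[K]_(chow_dim j).+1)
    (x a b : E -> 'rV[K]_3) :
  polyvec c w -> polyvec c x -> polyvec c a -> polyvec c b ->
  polymp c (fun e => shift (x e) (chow_cone (w e) (a e) (b e))).
Proof.
move=> Hw Hx Ha Hb.
have coneE e : shift (x e) (chow_cone (w e) (a e) (b e)) =
  \sum_(i < (chow_dim j).+1) (w e 0 i)%:MP *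
    \prod_(k < 4 + 4) shift (x e) (tnth (chow_cone_tuple (a e) (b e)) k)
      ^+ nth 0%MM (chow_monoms j) i k.
  rewrite /chow_cone /chow_form /shift.
  rewrite (raddf_sum (comp_mpoly (chow_cone_tuple _ _))) raddf_sum /=.
  apply: eq_bigr => i _.
  rewrite comp_mpolyZ comp_mpolyX -mul_mpolyC rmorphM /= comp_mpolyC.
  by congr (_ * _); rewrite rmorph_prod /=; apply: eq_bigr => k _; rewrite rmorphXn.
move=> m; apply: polyf_ext (fun e => esym (congr1 (mcoeff m) (coneE e))) _.
apply: polymp_sum => i; apply: polympM; first exact/polympC/Hw.
apply: polymp_prod => k; apply: polympX.
have plane_shift (d : E -> 'rV[K]_3) l : polyvec c d ->
    polymp c (fun e => shift (x e) (plane_poly (d e) l)).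
  move=> Hd; rewrite /plane_poly; case: (unliftP ord0 l) => [l' _|_] m'.
    apply: (@polyf_ext _ _ _ _ (fun e => (d e 0 l')%:MP_[3]@_m')).
      by move=> e; rewrite /shift comp_mpolyC.
    exact/polympC/Hd.
  apply: (@polyf_ext _ _ _ _ (fun e =>
    (- \sum_k (d e 0 k)%:MP_[3] * ('X_k + (x e 0 k)%:MP))@_m')).
    move=> e; rewrite /shift comp_mpolyN; congr ((- _)@_ _).
    rewrite raddf_sum /=; apply: eq_bigr => k' _.
    by rewrite rmorphM /= comp_mpolyC comp_mpolyXU -tnth_nth tnth_mktuple.
  apply/polympN/polymp_sum => k'; apply: polympM; first exact/polympC/Hd.
  by apply: polympD; [apply: polymp_const | apply/polympC/Hx].
case: (split_ordP k) => l -> m'.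
  apply: (@polyf_ext _ _ _ _ (fun e => (shift (x e) (plane_poly (a e) l))@_m')).
    by move=> e; rewrite tnth_mktuple pair_funl.
  exact: plane_shift.
apply: (@polyf_ext _ _ _ _ (fun e => (shift (x e) (plane_poly (b e) l))@_m')).
  by move=> e; rewrite tnth_mktuple pair_funr.
exact: plane_shift.
Qed.

End ConeCoefficients.

Local Opaque chow_cone shift.

(** Independent cones exist at a regular point and conversely witness regularity. With them as
    generators only coefficients of degree at most [r] are compared, so multipliers pass to jets and
    are lifted back by [unshift]. *)
Lemma jet_tangentP (X : 'rV[K]_4 -> Prop) j (w : 'rV[K]_(chow_dim j.+1).+1) x T :
  proj_irreducible X -> proj_curve_degree X j.+1 -> is_chow_vector X w ->
  regular_point (affine_part X) x /\ tangent_to_order r (affine_part X) T x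
  <-> jet_tangent w x (jet r T x).
Proof.
move=> irrX degX chowX; have [cX _ _] := irrX.
split=> [[[Xx [f1 [f2 [f1X f2X rf]]]] tT]|].
  split; first exact/(on_curveP cX chowX degX).
  have [a [b [b' rf']]] := regular_chow_cones cX chowX degX Xx f1X f2X rf.
  have v1 := chow_cone_vanish cX chowX degX a b.
  have v2 := chow_cone_vanish cX chowX degX a b'.
  have /(regular_tangentP irrX degX Xx v1 v2 rf')[q [c1 [c2 [q0 ord]]]] := tT.
  have [n Hn] := iffLR (row_free_det3 _ _) rf'.
  exists a, b, a, b', n, (jet r q x), (jet r c1 x), (jet r c2 x).
  split.
    rewrite linear_part_shift.
    rewrite linear_part_shift.
    exact: Hn.
    by rewrite jet_poly_jet ?mdeg0 // shift_mcoeff0; exact: q0.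
  move=> m; rewrite -[RHS](iffLR (order_ideal_shift _ _ _) ord m (bmdeg m)).
  rewrite 2!shiftB 3!shiftM.
  have J p : eq_upto r (jet_poly (jet r p x)) (shift x p) by apply: jet_poly_jet.
  have refl (p : {mpoly K[3]}) : eq_upto r p p by [].
  have e := eq_uptoB (eq_uptoB (eq_uptoM (J q) (J T)) (eq_uptoM (J c1) (refl _)))
    (eq_uptoM (J c2) (refl _)).
  by apply: e; apply: bmdeg.
case=> /(on_curveP cX chowX degX) Xx [a [b [a' [b' [n [q [c1 [c2 [dn q0 H]]]]]]]]].
have v1 := chow_cone_vanish cX chowX degX a b.
have v2 := chow_cone_vanish cX chowX degX a' b'.
have rf : row_free (col_mx (gradient (chow_cone w a b) x)
                           (gradient (chow_cone w a' b') x)).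
  by apply/row_free_det3; exists n; rewrite -!linear_part_shift.
split; first by split=> //; exists (chow_cone w a b), (chow_cone w a' b').
apply/(regular_tangentP irrX degX Xx v1 v2 rf).
exists (unshift x (jet_poly q)), (unshift x (jet_poly c1)), (unshift x (jet_poly c2)).
split; first by rewrite -shift_mcoeff0 unshiftK.
apply/order_ideal_shift => m ms; rewrite 2!shiftB 3!shiftM !unshiftK.
rewrite -[RHS](H (BMultinom ms)).
have J p : eq_upto r (shift x p) (jet_poly (jet r p x)).
  by move=> m' ms'; rewrite jet_poly_jet.
have refl (p : {mpoly K[3]}) : eq_upto r p p by [].
have e := eq_uptoB (eq_uptoB (eq_uptoM (refl _) (J T))
  (eq_uptoM (refl _) (refl _))) (eq_uptoM (refl _) (refl _)).
by apply: e.
Qed.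

Section Definable.
Variables (E : Type) (n : nat) (c : E -> 'rV[K]_n).

Lemma polymp_jet_poly (v : E -> 'rV[K]_N) :
  polyvec c v -> polymp c (fun e => jet_poly (v e)).
Proof.
move=> Hv; apply: polymp_sum => m m'.
apply: (@polyf_ext _ _ _ _ (fun e => v e 0 (enum_rank m) * ('X_[m] : {mpoly K[3]})@_m')).
  by move=> e; rewrite mcoeffZ.
by apply: polyfM; [exact: Hv | exact: polyf_const].
Qed.

Lemma definable_on_curve j (w : E -> 'rV[K]_(chow_dim j).+1) (y : E -> 'rV[K]_3) :
  polyvec c w -> polyvec c y -> definable c (fun e => on_curve (w e) (y e)).
Proof.
move=> Hw Hy; apply: definable_all; apply: definable_all => /=.
have Hw2 := polyvec_fst 3 (polyvec_fst 3 Hw).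
have Hy2 := polyvec_fst 3 (polyvec_fst 3 Hy).
have Ha := polyvec_fst 3 (@polyvec_snd K E n c 3).
have Hb := @polyvec_snd K _ _ (cext c (m:=3)) 3.
by apply/definable_eq0/polyf_chow_eval => //; apply: polyvec_plane_through.
Qed.

End Definable.

End TangencyFormula.

Section DefinableJetTangent.
Variables (K : closedFieldType) (r : nat).
Variables (E : Type) (n : nat) (c : E -> 'rV[K]_n).

Notation N := (jet_dim r).
Notation up3 := (polyvec_fst 3).
Notation upN := (polyvec_fst N).

Lemma definable_jet_tangent j (w : E -> 'rV[K]_(chow_dim j).+1)
    (x : E -> 'rV[K]_3) (tau : E -> 'rV[K]_(jet_dim r)) :
  polyvec c w -> polyvec c x -> polyvec c tau ->
  definable c (fun e => jet_tangent (w e) (x e) (tau e)).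
Proof.
move=> Hw Hx Ht; apply: definable_and; first exact: definable_on_curve.
do 8 apply: definable_ex.
set u1 := @cext K E n c 3; set u2 := cext u1 (m:=3); set u3 := cext u2 (m:=3).
set u4 := cext u3 (m:=3); set u5 := cext u4 (m:=3); set u6 := cext u5 (m:=N).
set u7 := cext u6 (m:=N); set u8 := cext u7 (m:=N).
have {}Hw := upN (upN (upN (up3 (up3 (up3 (up3 (up3 Hw))))))).
have {}Hx := upN (upN (upN (up3 (up3 (up3 (up3 (up3 Hx))))))).
have {}Ht := upN (upN (upN (up3 (up3 (up3 (up3 (up3 Ht))))))).
have Ha := upN (upN (upN (up3 (up3 (up3 (up3 (@polyvec_snd K _ _ c 3))))))).
have Hb := upN (upN (upN (up3 (up3 (up3 (@polyvec_snd K _ _ u1 3)))))).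
have Ha' := upN (upN (upN (up3 (up3 (@polyvec_snd K _ _ u2 3))))).
have Hb' := upN (upN (upN (up3 (@polyvec_snd K _ _ u3 3)))).
have Hn := upN (upN (upN (@polyvec_snd K _ _ u4 3))).
have Hq := upN (upN (@polyvec_snd K _ _ u5 N)).
have Hc1 := upN (@polyvec_snd K _ _ u6 N).
have Hc2 := @polyvec_snd K _ _ u7 N.
have S1 := polymp_shift_cone Hw Hx Ha Hb.
have S2 := polymp_shift_cone Hw Hx Ha' Hb'.
apply: definable_and3.
- refine (definable_neq0 (f := fun _ => det3 _ _ _) _); apply: det3_polyf => //.
    move=> k; apply: polyf_ext (S1 U_(k)%MM) => e; by rewrite [RHS]mxE.
  move=> k; apply: polyf_ext (S2 U_(k)%MM) => e; by rewrite [RHS]mxE.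
- refine (definable_neq0 (f := fun _ => _@_0%MM) _); exact: (polymp_jet_poly Hq).
apply: definable_forall_fin => m; apply: definable_eq0.
have P1 := polympM (polymp_jet_poly Hq) (polymp_jet_poly Ht).
have P2 := polympM (polymp_jet_poly Hc1) S1.
have P3 := polympM (polymp_jet_poly Hc2) S2.
exact: (polympD (polympD P1 (polympN P2)) (polympN P3) m).
Qed.

End DefinableJetTangent.

(** * The parameter space *)

Section ScaledChowVectors.
Variable K : fieldType.

Lemma chow_formZ j a (w : 'rV[K]_(chow_dim j).+1) :
  chow_form (a *: w) = a *: chow_form w.
Proof.
by rewrite /chow_form scaler_sumr; apply: eq_bigr => i _; rewrite mxE scalerA.
Qed.

Lemma irreducible_eltZ n a (p : {mpoly K[n]}) :
  a != 0 -> irreducible_elt p -> irreducible_elt (a *: p).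
Proof.
move=> a0 [p0 pu pirr]; split.
- by rewrite scaler_eq0 negb_or a0.
- apply: contra pu; rewrite -mul_mpolyC => u.
  by move: u; rewrite unitrM => /andP[].
move=> b c; rewrite -mul_mpolyC => abc.
have aC : a%:MP_[n] * a^-1%:MP_[n] = 1 by rewrite -mpolyCM divff.
have [|bu|cu] := pirr (a^-1%:MP * b) c.
- by rewrite -mulrA -abc mulrA [_ * a%:MP]mulrC aC mul1r.
- by left; move: bu; rewrite unitrM => /andP[].
by right.
Qed.

Lemma is_chow_vectorZ X j a (w : 'rV[K]_(chow_dim j).+1) :
  a != 0 -> is_chow_vector X w -> is_chow_vector X (a *: w).
Proof.
move=> a0 [wirr wX]; split=> [|u v]; rewrite chow_formZ.
  exact: irreducible_eltZ.
rewrite mevalZ -wX; split=> [/eqP|->]; last by rewrite mulr0.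
by rewrite mulf_eq0 (negPf a0) => /eqP.
Qed.

End ScaledChowVectors.

Section ParameterSpace.
Variables (K : closedFieldType) (D : nat).
Variable L : forall j : 'I_D, 'M[K]_((chow_dim j.+1).+1).
Hypothesis unitL : forall j, L j \in unitmx.
Implicit Types (j : 'I_D) (Z : 'rV[K]_(chow_ambient_dim D)).

(** Inverse of the affine chart on one factor: the leading 1 is restored and [L] undone. This gives
    the Chow vector up to a nonzero scalar, which changes neither irreducibility nor zeros. *)
Definition chow_vec j Z : 'rV[K]_(chow_dim j.+1).+1 :=
  row_mx (1%:M : 'M[K]_1) (submxrow Z j) *m invmx (L j).

Lemma chow_vec_embed j (w : 'rV[K]_(chow_dim j.+1).+1) :
  off_hyperplane (L j) w ->
  chow_vec j (embed_factor (affine_coord (L j) w)) = ((w *m L j) 0 0)^-1 *: w.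
Proof.
rewrite /off_hyperplane /chow_vec submxrow_embed_factor => w0.
have -> : row_mx (1%:M : 'M[K]_1) (affine_coord (L j) w) =
    ((w *m L j) 0 0)^-1 *: (w *m L j).
  apply/rowP => i; case: (split_ordP (i : 'I_(1 + chow_dim j.+1))) => k ->.
    by rewrite row_mxEl mxE [RHS]mxE ord1 lshift0 mulVf.
  rewrite row_mxEr mxE [RHS]mxE mulrC; congr (_ * (w *m L j) _ _).
  exact: val_inj.
by rewrite -scalemxAl mulmxK.
Qed.

Lemma is_chow_vector_chow_vec X j (w : 'rV[K]_(chow_dim j.+1).+1) :
  off_hyperplane (L j) w -> is_chow_vector X w ->
  is_chow_vector X (chow_vec j (embed_factor (affine_coord (L j) w))).
Proof.
by move=> w0 wX; rewrite chow_vec_embed //; apply: is_chow_vectorZ; rewrite ?invr_eq0.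
Qed.

Definition parameter_of_degree X j Z : Prop :=
  [/\ proj_irreducible_curve X,
      exists2 x, X x & x 0 0 != 0
    & exists w : 'rV[K]_(chow_dim j.+1).+1,
        [/\ proj_curve_degree X j.+1, is_chow_vector X w,
            off_hyperplane (L j) w
          & Z = embed_factor (affine_coord (L j) w)]].

Lemma parameter_of_degreeP X Z :
  parameter_of L X Z <-> exists j, parameter_of_degree X j Z.
Proof.
split=> [[cX X0 [j [w Hw]]]|[j [cX X0 [w Hw]]]].
  by exists j; split=> //; exists w.
by split=> //; exists j, w.
Qed.

(* A nonzero parameter determines the degree of its curve; the parameter 0 may
   be shared by curves of several degrees. *)
Definition in_factor j Z : Prop :=
  (forall i, i != j -> submxrow Z i = 0) /\
  (Z = 0 -> exists X, parameter_of_degree X j 0).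

Lemma submxrow_eq0 Z : (forall i, submxrow Z i = 0) -> Z = 0.
Proof. by move=> Z0; rewrite -[Z]submxrowK (eq_mxrow Z0) mxrow0. Qed.

(** A parameter of degree index [j'] has zero blocks off [j']. If its blocks off another index [j]
    also vanish, then [Z = 0], the case settled by the second clause of [in_factor]. *)
Lemma in_factorP j Z : curve_space L Z ->
  in_factor j Z <-> exists X, parameter_of_degree X j Z.
Proof.
move=> [X' /parameter_of_degreeP [j' PX']]; split; last first.
  move=> [X PX]; split=> [i ij|Z0]; last by exists X; rewrite -Z0.
  by have [_ _ [w [_ _ _ ->]]] := PX; rewrite submxrow_embed_factor_neq.
move=> [Zj Z0]; have [Z00|Zn0] := eqVneq Z 0; first by rewrite Z00; apply: Z0.
have [jj|jj] := eqVneq j j'; first by exists X'; rewrite jj.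
case/eqP: Zn0; apply: submxrow_eq0 => i; have [->|/Zj //] := eqVneq i j.
by have [_ _ [w [_ _ _ ->]]] := PX'; rewrite submxrow_embed_factor_neq.
Qed.

Variable C : 'rV[K]_(chow_ambient_dim D) -> Prop.
Hypothesis subC : subset_of C (curve_space L).

(** Trades the quantifier over curves for one over parameters and degrees; the curve is recovered as
    a set from [chow_vec]. *)
Lemma curve_in_tangentP r T x gamma :
  [/\ curve_in L C gamma, regular_point gamma x & tangent_to_order r gamma T x]
  <-> exists jZ : 'I_D * 'rV[K]_(chow_ambient_dim D),
      [/\ C jZ.2, in_factor jZ.1 jZ.2, gamma = on_curve (chow_vec jZ.1 jZ.2)
        & jet_tangent (chow_vec jZ.1 jZ.2) x (jet r T x)].
Proof.
have gammaE X j Z : parameter_of_degree X j Z ->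
    [/\ proj_irreducible X, proj_curve_degree X j.+1,
        is_chow_vector X (chow_vec j Z)
      & affine_part X = on_curve (chow_vec j Z)].
  move=> [[iX _] _ [w [dX wX w0 ZE]]].
  have WX : is_chow_vector X (chow_vec j Z).
    by rewrite ZE; apply: is_chow_vector_chow_vec.
  split=> //; apply/funext => y; apply/propext.
  by have [cX _ _] := iX; rewrite (on_curveP cX WX dX).
split=> [[[X [Z [/parameter_of_degreeP[j XZ] CZ gX]]] rx tx]|[[j Z] /=]].
  have [iX dX WX XE] := gammaE _ _ _ XZ.
  have {}gX : gamma = affine_part X by apply/funext => y; apply/propext/gX.
  exists (j, Z); split=> //=.
  - by apply/in_factorP; [apply: subC|exists X].
  - by rewrite gX.
  by apply/(jet_tangentP r x T iX dX WX); rewrite -gX.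
move=> [CZ /(in_factorP _ (subC CZ))[X XZ] -> tx].
have [iX dX WX XE] := gammaE _ _ _ XZ.
have [rx {}tx] := (jet_tangentP r x T iX dX WX).2 tx.
rewrite -XE; split=> //; exists X, Z; split=> //.
by apply/parameter_of_degreeP; exists j.
Qed.

Section Flecnodal.
Variables (t r : nat).

(** The [t] parameters are packed into one row vector, so one existential block ranges over them
    all; their degrees are a finite choice. *)
Definition flecnodal_jet (x : 'rV[K]_3) (tau : 'rV[K]_(jet_dim r)) : Prop :=
  exists (Z : 'rV[K]_(t * chow_ambient_dim D)) (j : {ffun 'I_t -> 'I_D}),
    (forall i, [/\ C (row i (vec_mx Z)), in_factor (j i) (row i (vec_mx Z))
                 & jet_tangent (chow_vec (j i) (row i (vec_mx Z))) x tau]) /\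
    (forall i k, ~ (i != k /\ forall y,
      on_curve (chow_vec (j i) (row i (vec_mx Z))) y <->
      on_curve (chow_vec (j k) (row k (vec_mx Z))) y)).

Lemma flecnodal_jetP T x : flecnodal L t C r T x <-> flecnodal_jet x (jet r T x).
Proof.
split=> [[gamma [gammaI gammaP]]|[Z [j [HZ I]]]].
  have /choice[jZ HjZ] i := (curve_in_tangentP r T x (gamma i)).1 (gammaP i).
  exists (mxvec (\matrix_i (jZ i).2)), [ffun i => (jZ i).1].
  split=> [i|i k [ik ikE]].
    by rewrite mxvecK rowK ffunE; have [] := HjZ i.
  apply: (gammaI _ _ ik) => y.
  have [_ _ -> _] := HjZ i; have [_ _ -> _] := HjZ k.
  by have := ikE y; rewrite mxvecK !rowK !ffunE.
exists (fun i => on_curve (chow_vec (j i) (row i (vec_mx Z)))); split.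
  by move=> i k ik ikE; apply: (I i k).
move=> i; apply/curve_in_tangentP; exists (j i, row i (vec_mx Z)) => /=.
by have [] := HZ i.
Qed.

End Flecnodal.
End ParameterSpace.

Section DefinableFlecnodal.
Variables (K : closedFieldType) (D : nat).
Variable L : forall j : 'I_D, 'M[K]_((chow_dim j.+1).+1).
Variables (E : Type) (n : nat) (c : E -> 'rV[K]_n).

Lemma polyvec_submxrow (Z : E -> 'rV[K]_(chow_ambient_dim D)) j :
  polyvec c Z -> polyvec c (fun e => submxrow (Z e) j).
Proof. by move=> HZ k; apply: polyf_ext (HZ _) => e; rewrite [RHS]mxE. Qed.

Lemma polyvec_chow_vec (Z : E -> 'rV[K]_(chow_ambient_dim D)) j :
  polyvec c Z -> polyvec c (fun e => chow_vec L j (Z e)).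
Proof.
move=> HZ k; apply: (@polyf_ext _ _ _ _ (fun e =>
    \sum_i row_mx (1%:M : 'M[K]_1) (submxrow (Z e) j) 0 i * invmx (L j) i k)).
  by move=> e; rewrite [RHS]mxE.
apply: polyf_sum => i; apply: polyfM; last exact: polyf_const.
case: (split_ordP i) => l ->.
  apply: (@polyf_ext _ _ _ _ (fun=> (1%:M : 'M[K]_1) 0 l)) => [e|].
    by rewrite row_mxEl.
  exact: polyf_const.
apply: (@polyf_ext _ _ _ _ (fun e => submxrow (Z e) j 0 l)) => [e|].
  by rewrite row_mxEr.
exact: polyvec_submxrow.
Qed.

Lemma definable_vec_eq0 m (v : E -> 'rV[K]_m) :
  polyvec c v -> definable c (fun e => v e = 0).
Proof.
move=> Hv; apply: (@definable_ext _ _ _ _ (fun e => forall i, v e 0 i = 0)).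
  by move=> e; split=> [v0|-> i]; [apply/rowP => i; rewrite v0 mxE|rewrite mxE].
by apply: definable_forall_fin => i; apply: definable_eq0.
Qed.

Lemma definable_in_factor (Z : E -> 'rV[K]_(chow_ambient_dim D)) j :
  polyvec c Z -> definable c (fun e => in_factor L j (Z e)).
Proof.
move=> HZ; apply: definable_and; last first.
  (* Whether some curve of this degree has parameter 0 does not depend on [Z], so it is a constant
     proposition. *)
  by apply: definable_imp; [apply: definable_vec_eq0|apply: definable_const].
apply: definable_forall_fin => i; apply: definable_imp.
  exact: definable_const.
exact/definable_vec_eq0/polyvec_submxrow.
Qed.

End DefinableFlecnodal.

Lemma definable_flecnodal_jet (K : closedFieldType) (D : nat)
    (L : forall j : 'I_D, 'M[K]_((chow_dim j.+1).+1)) C (t r : nat) :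
  constructible C ->
  definable (@cext K 'rV[K]_3 3 id (jet_dim r))
    (fun e => flecnodal_jet L C t e.1 e.2).
Proof.
move=> cC; apply: definable_ex; apply: definable_exists_fin => j.
set A := (t * _)%N; set u := @cext K _ 3 id (jet_dim r).
have Hx := polyvec_fst A (polyvec_fst (jet_dim r) (@polyf_coord K _ 3 id)).
have Htau := polyvec_fst A (@polyvec_snd K _ 3 id (jet_dim r)).
have HZ i : polyvec (cext u (m:=A)) (fun e => row i (vec_mx e.2)).
  move=> k; apply: polyf_ext (@polyvec_snd _ _ _ u A (mxvec_index i k)) => e.
  by rewrite !mxE.
have HW i := @polyvec_chow_vec K D L _ _ (cext u (m:=A)) _ (j i) (HZ i).
apply: definable_and.
  apply: definable_forall_fin => i; apply: definable_and3.
  - exact: definable_preim.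
  - exact: definable_in_factor.
  exact: definable_jet_tangent.
apply: definable_forall_fin => i; apply: definable_forall_fin => k.
apply: definable_not; apply: definable_and; first exact: definable_const.
apply: definable_all; apply: definable_iff; apply: definable_on_curve;
  try exact: polyvec_snd.
  exact: (polyvec_fst 3 (HW i)).
exact: (polyvec_fst 3 (HW k)).
Qed.

(** * Degrees *)

Section Degree.
Variables (K : fieldType) (n : nat).
Implicit Types p q : {mpoly K[n]}.

Lemma mp_degree_le p d : (mp_degree p <= d)%N = (msize p <= d.+1)%N.
Proof. by rewrite /mp_degree; case: (msize p). Qed.

Lemma mp_degreeM p q : (mp_degree (p * q) <= mp_degree p + mp_degree q)%N.
Proof.
have [->|p0] := eqVneq p 0; first by rewrite mul0r /mp_degree msize0.
have [->|q0] := eqVneq q 0; first by rewrite mulr0 /mp_degree msize0.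
rewrite /mp_degree msizeM //.
have: msize p != 0%N by rewrite msize_poly_eq0.
have: msize q != 0%N by rewrite msize_poly_eq0.
by case: (msize p) => // a; case: (msize q) => // b _ _; rewrite addnS.
Qed.

Lemma mp_degreeC a : mp_degree (a%:MP : {mpoly K[n]}) = 0%N.
Proof. by rewrite /mp_degree msizeC; case: eqP. Qed.

Lemma mp_degreeZ a p : (mp_degree (a *: p) <= mp_degree p)%N.
Proof. by rewrite -mul_mpolyC (leq_trans (mp_degreeM _ _)) // mp_degreeC. Qed.

Lemma mp_degreeX i : (mp_degree ('X_i : {mpoly K[n]}) <= 1)%N.
Proof. by rewrite /mp_degree msizeX mdeg1. Qed.

Lemma mp_degree_sum I (s : seq I) (P : pred I) (F : I -> {mpoly K[n]}) d :
  (forall i, P i -> mp_degree (F i) <= d)%N ->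
  (mp_degree (\sum_(i <- s | P i) F i) <= d)%N.
Proof.
move=> HF; elim/big_rec: _ => [|i p Pi IHp]; first by rewrite /mp_degree msize0.
move: IHp; have := HF i Pi; rewrite !mp_degree_le => Fi IHp.
by rewrite (leq_trans (msizeD_le _ _)) // geq_max Fi.
Qed.

Lemma mp_degree_prod I (s : seq I) (F : I -> {mpoly K[n]}) :
  (mp_degree (\prod_(i <- s) F i) <= \sum_(i <- s) mp_degree (F i))%N.
Proof.
elim: s => [|i s IHs]; first by rewrite !big_nil mp_degreeC.
by rewrite !big_cons (leq_trans (mp_degreeM _ _)) // leq_add2l.
Qed.

Lemma mp_degreeXn p d : (mp_degree (p ^+ d) <= d * mp_degree p)%N.
Proof.
elim: d => [|d IHd]; first by rewrite expr0 mp_degreeC.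
by rewrite exprS mulSn (leq_trans (mp_degreeM _ _)) // leq_add2l.
Qed.

Lemma mdeg_mp_degree p m : m \in msupp p -> (mdeg m <= mp_degree p)%N.
Proof.
move=> mp; rewrite -ltnS (leq_trans (msize_mdeg_lt mp)) //.
by rewrite /mp_degree leqSpred.
Qed.

End Degree.

Lemma mp_degree_comp (K : fieldType) n k (p : {mpoly K[k]})
    (lq : k.-tuple {mpoly K[n]}) d :
  (forall i, mp_degree (tnth lq i) <= d)%N ->
  (mp_degree (p \mPo lq) <= mp_degree p * d)%N.
Proof.
move=> Hlq; rewrite comp_mpolyEX; rewrite big_seq; apply: mp_degree_sum => m mp.
rewrite (leq_trans (mp_degreeZ _ _)) // comp_mpolyX.
rewrite (leq_trans (mp_degree_prod _ _)) //.
apply: (@leq_trans (\sum_(i < k) m i * d)).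
  apply: leq_sum => i _; rewrite (leq_trans (mp_degreeXn _ _)) //.
  by rewrite leq_mul2l Hlq orbT.
by rewrite -big_distrl /= -mdegE leq_mul2r mdeg_mp_degree ?orbT.
Qed.

Section ShiftDegree.
Variable K : fieldType.

(** The expansion of [T] at [x] has degree at most [mp_degree T] jointly in [x] and the expansion
    variables, hence so does each coefficient in [x]. *)
Lemma mcoeff_shift (T : {mpoly K[3]}) m :
  exists2 P : {mpoly K[3]}, (mp_degree P <= mp_degree T)%N
    & forall x : 'rV[K]_3, (shift x T)@_m = P.@[x 0].
Proof.
pose J d (F : 'rV[K]_3 -> {mpoly K[3]}) := forall m, exists2 P : {mpoly K[3]},
  (mp_degree P <= d)%N & forall x : 'rV[K]_3, (F x)@_m = P.@[x 0].
have JC d p : J d (fun=> p).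
  by move=> m'; exists (p@_m')%:MP; rewrite ?mp_degreeC // => x; rewrite mevalC.
have Jsum I (s : seq I) (Q0 : pred I) d (F : I -> 'rV[K]_3 -> {mpoly K[3]}) :
    (forall i, Q0 i -> J d (F i)) -> J d (fun x => \sum_(i <- s | Q0 i) F i x).
  move=> HF m'; elim: s => [|i s [Q dQ HQ]].
    exists 0 => [|x]; first by rewrite /mp_degree msize0.
    by rewrite big_nil mcoeff0 meval0.
  have [Q0i|nQ0i] := boolP (Q0 i); last first.
    by exists Q => // x; rewrite big_cons (negPf nQ0i).
  have [P dP HP] := HF i Q0i m'; exists (P + Q).
    move: dP dQ; rewrite !mp_degree_le => dP dQ.
    by rewrite (leq_trans (msizeD_le _ _)) // geq_max dP.
  by move=> x; rewrite big_cons Q0i mcoeffD HP HQ mevalD.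
have JM d d' F G : J d F -> J d' G -> J (d + d')%N (fun x => F x * G x).
  move=> HF HG m'.
  have /choice[P HP] m1 : exists P : {mpoly K[3]}, (mp_degree P <= d)%N /\
      forall x : 'rV[K]_3, (F x)@_m1 = P.@[x 0].
    by have [P] := HF m1; exists P.
  have /choice[Q HQ] m1 : exists P : {mpoly K[3]}, (mp_degree P <= d')%N /\
      forall x : 'rV[K]_3, (G x)@_m1 = P.@[x 0].
    by have [Q] := HG m1; exists Q.
  exists (\sum_(k : 'X_{1..3 < (mdeg m').+1, (mdeg m').+1} | m' == (k.1 + k.2)%MM)
            P k.1 * Q k.2).
    apply: mp_degree_sum => k _; rewrite (leq_trans (mp_degreeM _ _)) //.
    by rewrite leq_add ?(HP _).1 ?(HQ _).1.
  move=> x; rewrite mcoeffM raddf_sum /=; apply: eq_bigr => k _.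
  by rewrite (HP _).2 (HQ _).2 mevalM.
have Jle d d' F : (d <= d')%N -> J d F -> J d' F.
  move=> dd HF m'; have [P dP HP] := HF m'; exists P => //; exact: leq_trans dd.
have JX i : J 1%N (fun x => 'X_i + (x 0 i)%:MP).
  move=> m'; exists ((('X_i : {mpoly K[3]})@_m')%:MP + (m' == 0%MM)%:R *: 'X_i).
    rewrite mp_degree_le (leq_trans (msizeD_le _ _)) // geq_max -!mp_degree_le.
    by rewrite mp_degreeC (leq_trans (mp_degreeZ _ _)) // mp_degreeX.
  move=> x; rewrite mcoeffD mcoeffC mevalD mevalC mevalZ mevalXU.
  by rewrite [(m' == _)%:R * _]mulrC.
have JXn i d : J d (fun x => ('X_i + (x 0 i)%:MP) ^+ d).
  elim: d => [|d IHd] => [|m']; first exact: JC.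
  have [P dP HP] := JM _ _ _ _ (JX i) IHd m'.
  by exists P => // x; rewrite exprS HP.
suff /(_ m)[P dP HP] : J (mp_degree T) (fun x => shift x T) by exists P.
have shiftE x : shift x T = \sum_(m <- msupp T)
    T@_m *: \prod_(i < 3) ('X_i + (x 0 i)%:MP) ^+ m i.
  rewrite /shift comp_mpolyEX; apply: eq_bigr => m' _; rewrite comp_mpolyX.
  by congr (_ *: _); apply: eq_bigr => i _; rewrite tnth_mktuple.
have Jprod (s : seq 'I_3) (m1 : 'X_{1..3}) : J (\sum_(i <- s) m1 i)%N
    (fun x => \prod_(i <- s) ('X_i + (x 0 i)%:MP) ^+ m1 i).
  elim: s => [|i s IHs] m'.
    have [P dP HP] := JC 0%N 1 m'; exists P; rewrite ?big_nil // => x.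
    by rewrite big_nil (HP x).
  have [P dP HP] := JM _ _ _ _ (JXn i (m1 i)) IHs m'.
  by exists P; rewrite ?big_cons // => x; rewrite big_cons HP.
have JT : J (mp_degree T) (fun x => \sum_(m <- msupp T | m \in msupp T)
    T@_m *: \prod_(i < 3) ('X_i + (x 0 i)%:MP) ^+ m i).
  apply: Jsum => m1 m1T; apply: Jle (mdeg_mp_degree m1T) _ => m'.
  have [P dP HP] := JM _ _ _ _ (JC 0%N (T@_m1)%:MP) (Jprod (index_enum 'I_3) m1) m'.
  exists P; first by rewrite mdegE.
  by move=> x; rewrite -mul_mpolyC HP.
by move=> m'; have [P dP HP] := JT m'; exists P => // x; rewrite shiftE big_seq HP.
Qed.


End ShiftDegree.

Theorem theorem9p1 (K : closedFieldType) (D : nat) (hD : (1 <= D)%N)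
    (hK : forall p : nat, p \in [pchar K] -> (D < p)%N)
    (L : forall j : 'I_D, 'M[K]_((chow_dim j.+1).+1))
    (hL : forall j : 'I_D, L j \in unitmx)
    (C : 'rV[K]_(chow_ambient_dim D) -> Prop)
    (hC : constructible C) (hCsub : subset_of C (curve_space L))
    (t r : nat) (ht : (1 <= t)%N) (hr : (1 <= r)%N)
    (hrK : forall p : nat, p \in [pchar K] -> (r < p)%N) :
  exists (J : nat) (B : {set {ffun 'I_J -> bool}}) (c : nat),
    forall T : {mpoly K[3]}, (forall a : K, T != a%:MP) ->
    exists Flec : 'I_J -> {mpoly K[3]},
      (forall j : 'I_J, (mp_degree (Flec j) <= c * mp_degree T)%N) /\
      (forall x : 'rV[K]_3,
         flecnodal L t C r T x
         <-> [ffun j : 'I_J => (Flec j).@[x 0] != 0] \in B).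

Proof.
have [S cS HS] := definable_flecnodal_jet L t r hC.
have [J [q [B HB]]] := constructible_pattern cS.
(* The [q j] are fixed before [T], so the maximum of their degrees is a uniform constant. *)
exists J, B, (\max_j mp_degree (q j)) => T Tnc.
(* Besides the jet, the coordinates ['X_k] of the point are substituted; their degree 1 must also be
   bounded by that of [T]. *)
have degT : (0 < mp_degree T)%N.
  rewrite lt0n /mp_degree; apply: contraT; rewrite negbK => /eqP T0.
  have /msize1_polyC TC : (msize T <= 1)%N by move: T0; case: (msize T) => [|[]].
  by case/eqP: (Tnc T@_0%MM).
have /choice[P HP] (m : 'X_{1..3}) : exists P : {mpoly K[3]},
    (mp_degree P <= mp_degree T)%N /\
    forall x : 'rV[K]_3, (shift x T)@_m = P.@[x 0].
  by have [P] := mcoeff_shift T m; exists P.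
pose jetP i := P (enum_val (i : 'I_#|{: 'X_{1..3 < r.+1}}|)).
pose lq := [tuple pair_fun (fun k => 'X_k : {mpoly K[3]}) jetP i | i < 3 + jet_dim r].
exists (fun k => q k \mPo lq); split=> [k|x].
  rewrite (leq_trans (@mp_degree_comp _ _ _ _ _ (mp_degree T) _)) //.
    move=> i; rewrite tnth_mktuple; case: (split_ordP i) => l ->.
      by rewrite pair_funl (leq_trans (mp_degreeX _ _)).
    by rewrite pair_funr; have [] := HP (enum_val l).
  by rewrite leq_mul2r (leq_bigmax k) orbT.
rewrite flecnodal_jetP // (HS (x, jet r T x)) HB.
set f := finfun _; set g := finfun _; suff -> : f = g by [].
rewrite {}/f {}/g.
apply/ffunP => k; rewrite !ffunE comp_mpoly_meval; congr (_ != 0).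
apply: meval_eq => i; rewrite tnth_mktuple /cext; case: (split_ordP i) => l ->.
  by rewrite row_mxEl pair_funl mevalXU.
by rewrite row_mxEr pair_funr mxE (HP _).2.
Qed.
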